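(* Let $k$ be a finite field and $r\ge2$. The compatibility problem for systems of equations over $F_r$ is decidable: there is an algorithm which, given a finite system $S$ of equations $f(x_1,\dots,x_n)=0$ whose left-hand sides are Lie polynomials in variables $x_1,\dots,x_n$ with coefficients (constants) from $F_r$, decides whether $S$ has a solution in $F_r^n$.
   Context: $F_r$ is the free metabelian Lie algebra over $k$ of rank $r$ with free base $a_1,\dots,a_r$; elements of $F_r$ are given as Lie polynomials in $a_1,\dots,a_r$. Equations are elements of the free product $F_r\ast F(X)$ of $F_r$ with the free Lie algebra on $X=\{x_1,\dots,x_n\}$; a solution is a tuple $(b_1,\dots,b_n)\in F_r^n$ at which all of them vanish. *)

(* Defs.v *)
From HB Require Import structures.
From mathcomp Require Import all_boot all_order all_algebra.
From Stdlib Require List.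
Set Implicit Arguments. Unset Strict Implicit. Unset Printing Implicit Defensive.
Import GRing.Theory.
Local Open Scope ring_scope.

Record lieAlgebra (k : fieldType) := LieAlgebra {
  lie_sort :> lmodType k;
  lie_br : lie_sort -> lie_sort -> lie_sort;
  lie_brDl : forall (a : k) (x y z : lie_sort),
      lie_br (a *: x + y) z = a *: lie_br x z + lie_br y z;
  lie_brDr : forall (a : k) (x y z : lie_sort),
      lie_br z (a *: x + y) = a *: lie_br z x + lie_br z y;
  lie_brxx : forall x : lie_sort, lie_br x x = 0;
  lie_jacobi : forall x y z : lie_sort,
      lie_br x (lie_br y z) + lie_br y (lie_br z x) + lie_br z (lie_br x y) = 0
}.

Definition metabelian (k : fieldType) (L : lieAlgebra k) : Prop :=
  forall x y z w : L, lie_br (lie_br x y) (lie_br z w) = 0.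

Inductive lterm (k : Type) : Type :=
| LA of nat                      (* generator a_i of F_r *)
| LX of nat                      (* unknown x_j *)
| L0
| LAdd of lterm k & lterm k
| LScale of k & lterm k
| LBr of lterm k & lterm k.

Arguments L0 {k}.
Arguments LA {k}.
Arguments LX {k}.

Fixpoint leval (k : fieldType) (L : lieAlgebra k) (va vx : nat -> L)
    (t : lterm k) : L :=
  match t with
  | LA i => va i
  | LX j => vx j
  | L0 => 0
  | LAdd t u => leval va vx t + leval va vx u
  | LScale c t => c *: leval va vx t
  | LBr t u => lie_br (leval va vx t) (leval va vx u)
  end.

Fixpoint lwf (k : Type) (r n : nat) (t : lterm k) : bool :=
  match t with
  | LA i => (i < r)%N
  | LX j => (j < n)%N
  | L0 => true
  | LAdd t u => lwf r n t && lwf r n u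
  | LScale _ t => lwf r n t
  | LBr t u => lwf r n t && lwf r n u
  end.

(* An element of F_r is given by a Lie polynomial t in a_0..a_{r-1}
   (t with lwf r 0 t).  Since F_r is the free metabelian Lie algebra on
   a_0..a_{r-1}, a Lie polynomial in the a_i (and, after substitution,
   an equation evaluated at a tuple of elements of F_r) is 0 in F_r iff
   it vanishes in every metabelian Lie algebra over k under every
   assignment of the free generators. *)
Definition solution (k : fieldType) (r n : nat) (S : seq (lterm k))
    (b : seq (lterm k)) : Prop :=
  [/\ size b = n, all (lwf r 0) b &
    forall f, List.In f S ->
      forall (L : lieAlgebra k), metabelian L ->
      forall va : nat -> L,
        leval va (fun j => leval va (fun _ => 0) (nth L0 b j)) f = 0].

Definition solvable (k : fieldType) (r n : nat) (S : seq (lterm k)) : Prop :=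
  exists b, solution r n S b.

Inductive prf : Type :=
| PZero
| PSucc
| PProj of nat
| PComp of prf & seq prf
| PRec of prf & prf
| PMu of prf.

Inductive peval : prf -> seq nat -> nat -> Prop :=
| ev_zero v : peval PZero v 0
| ev_succ x v : peval PSucc (x :: v) x.+1
| ev_proj i v : (i < size v)%N -> peval (PProj i) v (nth 0%N v i)
| ev_comp f gs v w y : pevals gs v w -> peval f w y -> peval (PComp f gs) v y
| ev_rec0 f g v y : peval f v y -> peval (PRec f g) (0%N :: v) y
| ev_recS f g m v z y :
    peval (PRec f g) (m :: v) z -> peval g (m :: z :: v) y ->
    peval (PRec f g) (m.+1 :: v) y
| ev_mu f v m :
    peval f (m :: v) 0%N ->
    (forall j, (j < m)%N -> exists y, peval f (j :: v) y.+1) ->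
    peval (PMu f) v m
with pevals : seq prf -> seq nat -> seq nat -> Prop :=
| evs_nil v : pevals [::] v [::]
| evs_cons g gs v y ys :
    peval g v y -> pevals gs v ys -> pevals (g :: gs) v (y :: ys).

Fixpoint lterm_tree (k : finType) (t : lterm k) : GenTree.tree nat :=
  match t with
  | LA i => GenTree.Node 0 [:: GenTree.Leaf i]
  | LX j => GenTree.Node 1 [:: GenTree.Leaf j]
  | L0 => GenTree.Node 2 [::]
  | LAdd t u => GenTree.Node 3 [:: lterm_tree t; lterm_tree u]
  | LScale c t =>
      GenTree.Node 4 [:: GenTree.Leaf (nat_of_ord (enum_rank c)); lterm_tree t]
  | LBr t u => GenTree.Node 5 [:: lterm_tree t; lterm_tree u]
  end.

Definition encode_system (k : finType) (n : nat) (S : seq (lterm k)) : nat :=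
  pickle (n, map (@lterm_tree k) S).

(* Main.v *)
Require Import Defs.
From HB Require Import structures.
From mathcomp Require Import all_boot all_order all_algebra.
From mathcomp Require Import boolp mpoly ring.
From Stdlib Require List.

(* Solvability and unsolvability are both recursively enumerable.

   A solution is certified by an equational derivation of its equations from the
   axioms of metabelian Lie algebras. Unsolvability is certified by a finite
   metabelian Lie algebra, given by tables, in which the system has no solution.

   That such a finite algebra exists uses the Magnus embedding of [F_r] into the
   pairs [(u, p)] in [k^r * R^r], [R = k[X_1, .., X_r]], with bracket
   [(0, l(u) q - l(v) p)], [l(u) = sum u_i X_i]; its image is cut out by
   [sum X_i p_i = l(u)]. As [k] is finite there are finitely many choices for
   the linear parts [u] of the unknowns, and for each choice the system is
   linear over [R] in the [p]. A linear system [y A = c] unsolvable over [R] is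
   unsolvable over a finite quotient of [R]: a pseudo-inverse [B] of [A] over
   the fraction field, [A B A = d A] with [d] in [R] nonzero, shows that either
   [c B A <> d c], and residual finiteness of [R] suffices, or the system is
   unsolvable modulo [d]. Nagata's substitution makes [d] monic in one variable,
   so that [R / d] is free of finite rank over a polynomial ring in one variable
   less, and one concludes by induction. *)

Set Implicit Arguments.
Unset Strict Implicit.
Unset Printing Implicit Defensive.

(** * Computable functions *)

(** Term-handling programs written directly in [prf] would be unwieldy, so both searches are
    expressed as Horn clauses: a derivation is a list of steps whose validity is checked by bounded
    sums, and one minimization runs the two searches together. Correctness then amounts to assigning
    a meaning to each predicate, checked clause by clause, and to exhibiting the derivations that
    are needed. An unknown may not range over all pairs [(u, p)], only over the image of [F_r]. The
    condition cutting out this image is linear in [p], so it joins the equations as part of the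
    linear system; over a finite quotient the same condition still cuts out a subalgebra, and this
    is the refuting algebra. The quotients found for the various linear parts are merged in a
    product ring. When [c B A = d c], reduction modulo [d] loses nothing: a solution modulo [d] is
    corrected to an exact one by subtracting a multiple of [B]. *)

Notation dc := CodeSeq.decode.

(* Locked, so that conversion never computes these exponentially large
   numbers. *)
Fact pcons_key : unit. Proof. by []. Qed.
Definition pcons x y := locked_with pcons_key (2 ^ x * y.*2.+1).
Definition co (s : seq nat) : nat := foldr pcons 0 s.

Lemma pconsE x y : pcons x y = 2 ^ x * y.*2.+1.
Proof. by rewrite /pcons unlock. Qed.

Lemma co_code s : co s = CodeSeq.code s.
Proof. by elim: s => //= x s ->; rewrite pconsE. Qed.

Lemma coK : cancel co dc.
Proof. by move=> s; rewrite co_code CodeSeq.codeK. Qed.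

Lemma dcK : cancel dc co.
Proof. by move=> n; rewrite co_code CodeSeq.decodeK. Qed.

Section Computable.

Definition computable m (f : seq nat -> nat) : Prop :=
  exists p, forall v, size v = m -> peval p v (f v).

Lemma computable_ext m f g : (forall v, size v = m -> f v = g v) ->
  computable m f -> computable m g.
Proof. by move=> e [p Hp]; exists p => v sv; rewrite -e //; apply: Hp. Qed.

Lemma computable_nth m i : i < m -> computable m (fun v => nth 0 v i).
Proof. by move=> im; exists (PProj i) => v sv; apply: ev_proj; rewrite sv. Qed.

(** The hypotheses form a [foldr] of conjunctions so that, for a concrete list of functions, they
    reduce to an ordinary conjunction. *)
Lemma computable_comp m (fs : seq (seq nat -> nat)) F :
  computable (size fs) F ->
  foldr (fun f P => computable m f /\ P) True fs ->
  computable m (fun v => F [seq f v | f <- fs]).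
Proof.
move=> [p Hp] H.
have [gs Hgs]: exists gs, forall v, size v = m ->
    pevals gs v [seq f v | f <- fs].
  elim: fs H {Hp} => [|f fs IH] /=; first by exists [::] => v _; constructor.
  move=> [[q Hq] /IH [gs Hgs]]; exists (q :: gs) => v sv.
  by constructor; [apply: Hq | apply: Hgs].
exists (PComp p gs) => v sv; apply: ev_comp (Hgs v sv) _; apply: Hp.
by rewrite size_map.
Qed.

Lemma computable_comp1 m (F : nat -> nat) f :
  computable 1 (fun v => F (nth 0 v 0)) ->
  computable m f -> computable m (fun v => F (f v)).
Proof. by move=> HF Hf; apply: (@computable_comp m [:: f] _ HF). Qed.

Lemma computable_comp2 m (F : nat -> nat -> nat) f g :
  computable 2 (fun v => F (nth 0 v 0) (nth 0 v 1)) ->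
  computable m f -> computable m g -> computable m (fun v => F (f v) (g v)).
Proof. by move=> HF Hf Hg; apply: (@computable_comp m [:: f; g] _ HF). Qed.

Lemma computable_const m c : computable m (fun => c).
Proof.
elim: c => [|c [p Hp]]; first by exists PZero => v _; constructor.
exists (PComp PSucc [:: p]) => v sv.
by apply: ev_comp (ev_succ c [::]); repeat constructor; apply: Hp.
Qed.

Lemma computable_succ m f : computable m f -> computable m (fun v => (f v).+1).
Proof.
apply: (@computable_comp1 m S f); exists PSucc => v.
by case: v => [//|x v _]; constructor.
Qed.

Lemma computable_reindex m m' (js : seq nat) F : computable (size js) F ->
  all (fun j => j < m) js -> m' = m ->
  computable m' (fun v => F [seq nth 0 v j | j <- js]).
Proof.
move=> HF /allP Hjs ->.
pose fs := [seq (fun v => nth 0 v j) | j <- js].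
apply: (@computable_ext _ (fun v => F [seq f v | f <- fs])).
  by move=> v _; rewrite -map_comp.
apply: computable_comp; first by rewrite size_map.
rewrite {}/fs; elim: js Hjs {HF} => //= j js IH H; split.
  by apply: computable_nth; apply: H; rewrite mem_head.
by apply: IH => i Hi; apply: H; rewrite in_cons Hi orbT.
Qed.

Lemma map_nth_iota_drop (v : seq nat) a :
  [seq nth 0 v j | j <- iota a (size v - a)] = drop a v.
Proof.
rewrite -[RHS](@mkseq_nth _ 0) size_drop /mkseq -[a in iota a _]addn0 iotaDl.
by rewrite -map_comp; apply: eq_map => i /=; rewrite nth_drop.
Qed.

(** The step of a recursion sees index, accumulator and parameters, a summand only index and
    parameters; hence position 1 is dropped. *)
Lemma computable_skip1 m f : computable m.+1 f ->
  computable m.+2 (fun v => f (nth 0 v 0 :: behead (behead v))).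
Proof.
move=> Hf.
apply: (@computable_ext _ (fun v => f [seq nth 0 v j | j <- 0 :: iota 2 m])).
  move=> v sv /=; congr (f (_ :: _)).
  case: v sv => [|x [|y v]] //= [sv].
  by rewrite (iotaDl 2 0) -map_comp -[RHS]drop0 -map_nth_iota_drop subn0 sv.
apply: (@computable_reindex m.+2 _ (0 :: iota 2 m) f); rewrite /= ?size_iota //.
by apply/allP => j; rewrite mem_iota add2n => /andP [].
Qed.

(** [PRec] recurses on the head of its vector. Composing it with [b] followed by all projections
    makes the bound any function of [v], while the step still sees the whole of [v]. *)
Lemma computable_rec m f g b :
  computable m f -> computable m.+2 g -> computable m b ->
  computable m (fun v =>
    nat_rect (fun=> nat) (f v) (fun i z => g (i :: z :: v)) (b v)).
Proof.
move=> [pf Hf] [pg Hg] Hb.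
have HR : computable m.+1 (fun v => nat_rect (fun=> nat) (f (behead v))
   (fun i z => g (i :: z :: behead v)) (nth 0 v 0)).
  exists (PRec pf pg) => -[//|n v] [sv] /=.
  elim: n => [|n IH] /=; first by constructor; apply: Hf.
  by apply: ev_recS IH _; apply: Hg; rewrite /= sv.
pose fs := b :: [seq (fun v => nth 0 v j) | j <- iota 0 m].
pose R v := nat_rect (fun=> nat) (f (behead v))
   (fun i z => g (i :: z :: behead v)) (nth 0 v 0).
apply: (@computable_ext _ (fun v => R [seq f v | f <- fs])).
  move=> v sv; rewrite /R /= -map_comp.
  rewrite (_ : [seq _ | i <- iota 0 m] = v) //.
  by rewrite -[RHS]drop0 -map_nth_iota_drop subn0 sv.
apply: computable_comp; first by rewrite /= size_map size_iota.
split=> //.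
have : all (fun j => j < m) (iota 0 m) by apply/allP => j; rewrite mem_iota.
elim: (iota 0 m) => //= j js IH /andP [jm H]; split; last exact: IH.
exact: computable_nth.
Qed.

Lemma computable_add m f g : computable m f -> computable m g ->
  computable m (fun v => f v + g v).
Proof.
apply: (@computable_comp2 m addn f g).
apply: (@computable_ext _ (fun v => nat_rect (fun=> nat) (nth 0 v 0)
  (fun i z => (nth 0 (i :: z :: v) 1).+1) (nth 0 v 1))).
  by move=> v _; elim: (nth 0 v 1) => [|n /= ->]; rewrite ?addn0 ?addnS.
by apply: (@computable_rec 2 _ (fun w => (nth 0 w 1).+1));
  try apply: computable_succ; apply: computable_nth.
Qed.

Lemma computable_pred m f : computable m f -> computable m (fun v => (f v).-1).
Proof.
apply: (@computable_comp1 m predn).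
apply: (@computable_ext _ (fun v => nat_rect (fun=> nat) 0
  (fun i z => nth 0 (i :: z :: v) 0) (nth 0 v 0))).
  by move=> v _; case: (nth 0 v 0).
by apply: (@computable_rec 1 _ (fun w => nth 0 w 0));
  first [by apply: computable_nth | apply: computable_const].
Qed.

Lemma computable_sub m f g : computable m f -> computable m g ->
  computable m (fun v => f v - g v).
Proof.
apply: (@computable_comp2 m subn).
apply: (@computable_ext _ (fun v => nat_rect (fun=> nat) (nth 0 v 0)
  (fun i z => (nth 0 (i :: z :: v) 1).-1) (nth 0 v 1))).
  by move=> v _; elim: (nth 0 v 1) => [|n /= ->]; rewrite ?subn0 ?subnS.
by apply: (@computable_rec 2 _ (fun w => (nth 0 w 1).-1));
  try apply: computable_pred;
  apply: computable_nth.
Qed.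

Lemma computable_mul m f g : computable m f -> computable m g ->
  computable m (fun v => f v * g v).
Proof.
apply: (@computable_comp2 m muln).
apply: (@computable_ext _ (fun v => nat_rect (fun=> nat) 0
  (fun i z => nth 0 (i :: z :: v) 2 + nth 0 (i :: z :: v) 1) (nth 0 v 1))).
  by move=> v _; elim: (nth 0 v 1) => [|n /= ->]; rewrite ?muln0 ?mulnS.
by apply: (@computable_rec 2 _ (fun w => nth 0 w 2 + nth 0 w 1));
  try apply: computable_add;
  first [by apply: computable_nth | apply: computable_const].
Qed.

Lemma computable_exp2 m f : computable m f -> computable m (fun v => 2 ^ f v).
Proof.
apply: (@computable_comp1 m (expn 2)).
apply: (@computable_ext _ (fun v => nat_rect (fun=> nat) 1
  (fun i z => nth 0 (i :: z :: v) 1 + nth 0 (i :: z :: v) 1) (nth 0 v 0))).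
  by move=> v _; elim: (nth 0 v 0) => [|n /= ->] //; rewrite addnn expnS mul2n.
by apply: (@computable_rec 1 _ (fun w => nth 0 w 1 + nth 0 w 1));
  try apply: computable_add;
  first [by apply: computable_nth | apply: computable_const].
Qed.

Lemma computable_eq m f g : computable m f -> computable m g ->
  computable m (fun v => f v == g v).
Proof.
move=> Hf Hg.
apply: (@computable_ext _ (fun v => 1 - ((f v - g v) + (g v - f v)))).
  move=> v _; rewrite eqn_leq -!subn_eq0; case: (f v - g v) => [|n] //=.
  by case: (g v - f v) => [|n].
by apply: computable_sub; [apply: computable_const | apply: computable_add;
  apply: computable_sub].
Qed.

Lemma computable_gt0 m f : computable m f -> computable m (fun v => 0 < f v).
Proof.
move=> Hf; apply: (@computable_ext _ (fun v => 1 - (f v == 0))).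
  by move=> v _; case: (f v).
by apply: computable_sub; [|apply: computable_eq => //];
  apply: computable_const.
Qed.

Lemma computable_sum m b F : computable m b -> computable m.+1 F ->
  computable m (fun v => \sum_(i < b v) F (nat_of_ord i :: v)).
Proof.
move=> Hb HF; apply: (@computable_ext _ (fun v => nat_rect (fun=> nat) 0
  (fun i z => (fun w => nth 0 w 1 + F (nth 0 w 0 :: behead (behead w)))
     (i :: z :: v)) (b v))).
  move=> v _; elim: (b v) => [|n /= ->]; first by rewrite big_ord0.
  by rewrite big_ord_recr.
apply: (@computable_rec m (fun=> 0)
  (fun w => nth 0 w 1 + F (nth 0 w 0 :: behead (behead w))) b) => //.
  exact: computable_const.
by apply: computable_add; [apply: computable_nth | apply: computable_skip1].
Qed.

(** Minimization is applied to the product [F * G], so it stops as soon as either search succeeds;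
    whether [F] vanishes at the witness is the answer. *)
Lemma decide_mu (F G : nat -> nat -> nat) :
  computable 2 (fun v => F (nth 0 v 0) (nth 0 v 1)) ->
  computable 2 (fun v => G (nth 0 v 0) (nth 0 v 1)) ->
  exists M, forall x,
    ((exists w, F w x = 0) -> (forall w, G w x <> 0) -> peval M [:: x] 1) /\
    ((exists w, G w x = 0) -> (forall w, F w x <> 0) -> peval M [:: x] 0).
Proof.
move=> HF HG.
have [p Hp] : computable 2 (fun v =>
    F (nth 0 v 0) (nth 0 v 1) * G (nth 0 v 0) (nth 0 v 1)) by apply:
      computable_mul.
have [q Hq] : computable 2 (fun v => (F (nth 0 v 0) (nth 0 v 1) == 0)).
  by apply: computable_eq => //; apply: computable_const.
exists (PComp q [:: PMu p; PProj 0]) => x.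
have Hmu : (exists w, F w x * G w x == 0) ->
    exists2 w, F w x * G w x = 0 &
      peval (PComp q [:: PMu p; PProj 0]) [:: x] (F w x == 0).
  move=> E; case: (ex_minnP E) => w /eqP w0 wmin; exists w => //.
  apply: (@ev_comp _ _ _ [:: w; x]); last exact: (Hq [:: w; x]).
  apply: evs_cons; last by apply: evs_cons; [apply: ev_proj | constructor].
  apply: ev_mu; first by rewrite -w0; exact: (Hp [:: w; x]).
  (* [ev_mu] wants an explicit successor at each [j] below the witness; by minimality the product is
     positive there. *)
  move=> j jw; exists (F j x * G j x).-1.
  rewrite prednK; first exact: (Hp [:: j; x]).
  by rewrite lt0n; apply: contraTN jw => /wmin; rewrite -leqNgt.
split=> -[w Hw] N; case: Hmu => [|w' /eqP]; try (by exists w;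
  rewrite Hw ?muln0).
  by rewrite muln_eq0 => /orP [/eqP ->|/eqP /N].
by rewrite muln_eq0 => /orP [/eqP /N | _] //; case: eqP => [/N|].
Qed.

End Computable.

Lemma coE x s : co (x :: s) = pcons x (co s). Proof. by []. Qed.

Lemma co_inj : injective co. Proof. exact: can_inj coK. Qed.

Lemma pcons_inj x y x' y' : pcons x y = pcons x' y' -> x = x' /\ y = y'.
Proof.
rewrite -[y]dcK -[y']dcK -!coE => /co_inj [-> E].
by rewrite E.
Qed.

Lemma ltn_pcons x y : y < pcons x y.
Proof.
rewrite pconsE; apply: (@leq_trans y.*2.+1);
  first by rewrite ltnS -addnn leq_addr.
by rewrite leq_pmull // expn_gt0.
Qed.

Lemma size_dc c : size (dc c) <= c.
Proof.
rewrite -[c in _ <= c]dcK; elim: (dc c) => //= x s IH.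
exact: leq_ltn_trans IH (ltn_pcons _ _).
Qed.

(** * Recursive functions on coded lists *)

Section ComputableLists.

Definition chead c := nth 0 (dc c) 0.
Definition ctail c := co (behead (dc c)).

Lemma computable_pcons m f g : computable m f -> computable m g ->
  computable m (fun v => pcons (f v) (g v)).
Proof.
move=> Hf Hg; apply: (@computable_ext _ (fun v => 2 ^ f v * (g v + g v).+1)).
  by move=> v _; rewrite pconsE addnn.
by apply: computable_mul; [apply: computable_exp2 | apply: computable_succ;
  apply: computable_add].
Qed.

(** Decoding as a bounded search: both components of a nonzero code are smaller than it, so exactly
    one pair passes the test. The code 0 is the empty list, whose head and tail default to 0; hence
    the condition on [H 0 0]. *)
Lemma sum_pcons (H : nat -> nat -> nat) c : H 0 0 = 0 ->
  \sum_(i < c) \sum_(j < c) H i j * (pcons i j == c) = H (chead c) (ctail c).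
Proof.
move=> H0; rewrite /chead /ctail -[c in LHS]dcK.
case: (dc c) => [|x s] /=; first by rewrite big_ord0.
have xl : x < pcons x (co s).
  by have /andP [] := CodeSeq.ltn_code (x :: s); rewrite -co_code.
have sl := ltn_pcons x (co s).
rewrite (bigD1 (Ordinal xl)) //= (bigD1 (Ordinal sl)) //=.
rewrite eqxx muln1 big1 ?addn0 => [|j /eqP nj]; last first.
  by case: eqP => [/pcons_inj [_ e]|]; [case: nj;
    apply: val_inj | rewrite muln0].
rewrite big1 ?addn0 // => i /eqP ni; rewrite big1 // => j _.
by case: eqP => [/pcons_inj [e _]|]; [case: ni; apply: val_inj | rewrite muln0].
Qed.

Lemma computable_sum_pcons m (H : nat -> nat -> nat) f : H 0 0 = 0 ->
  computable 3 (fun v => H (nth 0 v 1) (nth 0 v 0)) -> computable m f ->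
  computable m (fun v => H (chead (f v)) (ctail (f v))).
Proof.
move=> H0 HH; apply: (@computable_comp1 m (fun c => H (chead c) (ctail c))).
apply: (@computable_ext _ (fun v => \sum_(i < nth 0 v 0) \sum_(j < nth 0 v 0)
   H i j * (pcons i j == nth 0 v 0))); first by move=> v _; rewrite sum_pcons.
pose F (v : seq nat) := H (nth 0 v 1) (nth 0 v 0) *
   (pcons (nth 0 v 1) (nth 0 v 0) == nth 0 v 2).
pose G (v : seq nat) := \sum_(j < nth 0 v 1) F (nat_of_ord j :: v).
apply: (@computable_ext _ (fun v => \sum_(i < nth 0 v 0) G (nat_of_ord i ::
  v))).
  by move=> v.
apply: computable_sum; first exact: computable_nth.
apply: computable_sum; first exact: computable_nth.
apply: computable_mul => //; apply: computable_eq; last exact: computable_nth.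
by apply: computable_pcons; apply: computable_nth.
Qed.

Lemma computable_chead m f :
  computable m f -> computable m (fun v => chead (f v)).
Proof. by apply: (@computable_sum_pcons m (fun i _ => i)); rewrite //;
  apply: computable_nth. Qed.

Lemma computable_ctail m f :
  computable m f -> computable m (fun v => ctail (f v)).
Proof. by apply: (@computable_sum_pcons m (fun _ j => j)); rewrite //;
  apply: computable_nth. Qed.

Lemma computable_cdrop m f g : computable m f -> computable m g ->
  computable m (fun v => co (drop (f v) (dc (g v)))).
Proof.
apply: (@computable_comp2 m (fun i c => co (drop i (dc c)))).
apply: (@computable_ext _ (fun v => nat_rect (fun=> nat) (nth 0 v 1)
  (fun i z => ctail (nth 0 (i :: z :: v) 1)) (nth 0 v 0))).
  move=> v _; elim: (nth 0 v 0) => [|n /= ->].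
    by rewrite drop0 dcK.
  by rewrite /ctail coK -drop1 drop_drop add1n.
by apply: (@computable_rec 2 _ (fun w => ctail (nth 0 w 1)));
  try apply: computable_ctail;
  apply: computable_nth.
Qed.

Lemma computable_cnth m f g : computable m f -> computable m g ->
  computable m (fun v => nth 0 (dc (g v)) (f v)).
Proof.
move=> Hf Hg.
apply: (@computable_ext _ (fun v => chead (co (drop (f v) (dc (g v)))))).
  by move=> v _; rewrite /chead coK nth_drop addn0.
by apply: computable_chead; apply: computable_cdrop.
Qed.

Lemma computable_csize_gt m f g : computable m f -> computable m g ->
  computable m (fun v => f v < size (dc (g v))).
Proof.
move=> Hf Hg.
apply: (@computable_ext _ (fun v => 0 < co (drop (f v) (dc (g v))))).
  move=> v _; rewrite -[f v < _]subn_gt0 -size_drop;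
    case: (drop _ _) => //= x s.
  by rewrite (leq_ltn_trans _ (ltn_pcons _ _)).
by apply: computable_gt0; apply: computable_cdrop.
Qed.

End ComputableLists.

(* Horn clauses over natural numbers, seen as nested lists through [co]. *)
Inductive pat := PV of nat | PC of nat | PS of pat | PK of pat & pat.
Definition atom := seq pat.
Definition clause := (atom * seq atom)%type.

Fixpoint peva (env : seq nat) (p : pat) : nat :=
  match p with
  | PV i => nth 0 env i
  | PC c => c
  | PS p => (peva env p).+1
  | PK p q => pcons (peva env p) (peva env q)
  end.

Inductive derives (P : seq clause) : seq nat -> Prop :=
| Derives cl env : List.In cl P ->
    (forall b, List.In b cl.2 -> derives P (map (peva env) b)) ->
    derives P (map (peva env) cl.1).

(** * Derivability from Horn clauses is recursively enumerable *)

Section DerivesRE.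
Variable P : seq clause.

(** A derivation is a list of steps, each supported by those that follow it. A step codes the
    derived fact together with the environment instantiating the clause, so that checking it needs
    no search for an environment. *)
Definition fact (e : nat) := nth 0 (dc e) 0.
Definition fenv (e : nat) := dc (nth 0 (dc e) 1).
Definition catom env (a : atom) := co (map (peva env) a).

Definition step_ok (e : nat) (l : seq nat) : bool :=
  has (fun cl => (catom (fenv e) cl.1 == fact e) &&
                 all (fun b => catom (fenv e) b \in map fact l) cl.2) P.

Fixpoint valid_drv (l : seq nat) : bool :=
  if l is e :: l' then step_ok e l' && valid_drv l' else true.

Lemma hasIn T (p : pred T) (s : seq T) :
  has p s <-> exists2 x, List.In x s & p x.
Proof.
elim: s => [|x s IH] /=; first by split=> // -[].
split=> [/orP [px|/IH [y ys py]]|[y [<-|ys] py]]; first by exists x; [left|].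
- by exists y; [right|].
- by rewrite py.
by apply/orP; right; apply/IH; exists y.
Qed.

Lemma allIn T (p : pred T) (s : seq T) :
  all p s <-> forall x, List.In x s -> p x.
Proof.
elim: s => [|x s IH] //=.
split=> [/andP [px /IH H] y [<-|/H] //|H].
by rewrite H; [apply/IH => y ys; apply: H; right | left].
Qed.

Lemma valid_drv_sound l : valid_drv l ->
  forall e, e \in map fact l -> derives P (dc e).
Proof.
elim: l => //= e l IH /andP [/hasIn [cl clP /andP [/eqP fe /allIn H]]] /IH D e'.
rewrite in_cons => /orP [/eqP ->|/D //].
rewrite -fe /catom coK; apply: Derives => // b /H /D.
by rewrite coK.
Qed.

Lemma valid_drv_cat l1 l2 : valid_drv l1 -> valid_drv l2 ->
  valid_drv (l1 ++ l2).
Proof.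
elim: l1 => //= e l IH /andP [/hasIn [cl clP /andP [fe /allIn H]]] v1 v2.
rewrite IH // andbT; apply/hasIn; exists cl; rewrite // fe /=.
by apply/allIn => b /H; rewrite map_cat mem_cat => ->.
Qed.

Lemma valid_drv_complete a : derives P a ->
  exists2 l, valid_drv l & co a \in map fact l.
Proof.
elim=> cl env clP _ IH.
have [l vl Hl] : exists2 l, valid_drv l &
    forall b, List.In b cl.2 -> co (map (peva env) b) \in map fact l.
  elim: cl.2 IH => [|b bs IHb] H; first by exists [::].
  have [l1 v1 H1] := H b (or_introl erefl).
  have [l2 v2 H2] := IHb (fun b' Hb' => H b' (or_intror Hb')).
  exists (l1 ++ l2) => [|b' /= [<-|/H2 H']]; first exact: valid_drv_cat.
    by rewrite map_cat mem_cat H1.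
  by rewrite map_cat mem_cat H' orbT.
pose e := co [:: co (map (peva env) cl.1); co env].
have fE : fact e = co (map (peva env) cl.1) by rewrite /fact coK.
have eE : fenv e = env by rewrite /fenv coK /= coK.
exists (e :: l); last by rewrite /= fE mem_head.
rewrite /= vl andbT; apply/hasIn; exists cl => //.
by rewrite fE eE /catom eqxx /=; apply/allIn.
Qed.

Lemma computable_peva m f p : computable m f ->
  computable m (fun v => peva (dc (f v)) p).
Proof.
move=> Hf; elim: p => [i|c|p IH|p IHp q IHq] /=.
- by apply: computable_cnth => //; apply: computable_const.
- exact: computable_const.
- exact: computable_succ.
- exact: computable_pcons.
Qed.

Lemma computable_catom m f a : computable m f ->
  computable m (fun v => catom (dc (f v)) a).
Proof.
move=> Hf; elim: a => [|p a IH] /=; first exact: computable_const.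
by apply: computable_pcons => //; apply: computable_peva.
Qed.

(** The code [l] is only an upper bound for the length of its list; the first factor discards the
    positions past the end, where [nth] returns 0. *)
Definition memN x l := \sum_(i < l)
  (i < size (dc l)) * (nth 0 (dc (nth 0 (dc l) i)) 0 == x).

Lemma memNE x l : (0 < memN x l) = (x \in map fact (dc l)).
Proof.
rewrite lt0n sum_nat_eq0; apply/forallPn/mapP => /=.
  case=> i; rewrite muln_eq0 negb_or !eqb0 !negbK => /andP [il /eqP e].
  by exists (nth 0 (dc l) i); rewrite ?mem_nth ?e.
case=> e /(nthP 0) [i il <-] xe.
exists (Ordinal (leq_trans il (size_dc l))).
by rewrite muln_eq0 negb_or !eqb0 !negbK /= il -/(fact _) -xe eqxx.
Qed.

Lemma computable_memN m f g : computable m f -> computable m g ->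
  computable m (fun v => memN (f v) (g v)).
Proof.
apply: (@computable_comp2 m memN).
pose F (w : seq nat) := (nth 0 w 0 < size (dc (nth 0 w 2))) *
  (nth 0 (dc (nth 0 (dc (nth 0 w 2)) (nth 0 w 0))) 0 == nth 0 w 1).
apply: (@computable_sum 2 _ F); first exact: computable_nth.
apply: computable_mul; first by apply: computable_csize_gt;
  apply: computable_nth.
apply: computable_eq; last exact: computable_nth.
by apply: (@computable_cnth 3);
  [apply: computable_const | apply: computable_cnth; apply: computable_nth].
Qed.

Definition stepN e l := foldr addn 0 [seq
  (catom (fenv e) cl.1 == fact e) *
  foldr muln 1 [seq memN (catom (fenv e) b) l | b <- cl.2] | cl <- P].

Lemma stepNE e l : (0 < stepN e l) = step_ok e (dc l).
Proof.
rewrite /stepN /step_ok; elim: P => //= cl P' <-; rewrite addn_gt0 muln_gt0.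
congr ((_ && _) || _); first by case: eqP.
by elim: cl.2 => //= b bs <-; rewrite muln_gt0 memNE.
Qed.

Lemma computable_stepN m f g : computable m f -> computable m g ->
  computable m (fun v => stepN (f v) (g v)).
Proof.
move=> Hf Hg; rewrite /stepN; elim: P => [|cl P' IH] /=;
  first exact: computable_const.
apply: computable_add => //; apply: computable_mul.
  apply: computable_eq; last by apply: computable_cnth => //;
    apply: computable_const.
  by apply: computable_catom; apply: computable_cnth => //;
    apply: computable_const.
elim: cl.2 => [|b bs IHb] /=; first exact: computable_const.
apply: computable_mul => //; apply: computable_memN => //.
by apply: computable_catom; apply: computable_cnth => //;
  apply: computable_const.
Qed.

(** The number of unjustified steps: validity becomes the vanishing of a number, the form that
    minimization expects. *)
Definition validN w := \sum_(i < w) (i < size (dc w)) *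
  (stepN (nth 0 (dc w) i) (co (drop i.+1 (dc w))) == 0).

Lemma validNE w : (validN w == 0) = valid_drv (dc w).
Proof.
have -> : valid_drv (dc w) =
    [forall i : 'I_(size (dc w)),
       step_ok (nth 0 (dc w) i) (drop i.+1 (dc w))].
  elim: (dc w) => [|e l IH] /=; first by symmetry; apply/forallP => -[].
  rewrite {}IH; apply/andP/forallP => [[H0 /forallP H] [[|i] Hi] //=|H].
  - by rewrite drop0.
  - exact: (H (Ordinal (Hi : i < size l))).
  split; first by have := H ord0; rewrite /= drop0.
  by apply/forallP => i; have := H (lift ord0 i).
rewrite sum_nat_eq0; apply/forallP/forallP => H i.
  have := H (Ordinal (leq_trans (ltn_ord i) (size_dc w))).
  by rewrite /= ltn_ord mul1n eqb0 -lt0n stepNE coK.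
apply/implyP => _; case: ltnP => //= il; rewrite mul1n eqb0 -lt0n stepNE.
by rewrite coK; apply: (H (Ordinal il)).
Qed.

Lemma computable_validN m f :
  computable m f -> computable m (fun v => validN (f v)).
Proof.
apply: (@computable_comp1 m validN).
pose F (w : seq nat) := (nth 0 w 0 < size (dc (nth 0 w 1))) *
  (stepN (nth 0 (dc (nth 0 w 1)) (nth 0 w 0))
     (co (drop (nth 0 w 0).+1 (dc (nth 0 w 1)))) == 0).
apply: (@computable_sum 1 _ F); first exact: computable_nth.
apply: computable_mul; first by apply: computable_csize_gt;
  apply: computable_nth.
apply: computable_eq; last exact: computable_const.
apply: computable_stepN; first by apply: computable_cnth; apply: computable_nth.
by apply: computable_cdrop; [apply: computable_succ|]; apply: computable_nth.
Qed.

Lemma derives_re tag : exists F : nat -> nat -> nat,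
  computable 2 (fun v => F (nth 0 v 0) (nth 0 v 1)) /\
  forall x, derives P [:: tag; x] <-> exists w, F w x = 0.
Proof.
exists (fun w x => validN w + (memN (co [:: tag; x]) w == 0)); split.
  apply: computable_add; first by apply: computable_validN;
    apply: computable_nth.
  apply: computable_eq; last exact: computable_const.
  apply: computable_memN; last exact: computable_nth.
  apply: computable_pcons; first exact: computable_const.
  by apply: computable_pcons; [apply: computable_nth | apply: computable_const].
move=> x; split=> [/valid_drv_complete [l vl Hl]|[w /eqP]].
  exists (co l); apply/eqP.
  by rewrite addn_eq0 validNE coK vl /= eqb0 -lt0n memNE coK.
rewrite addn_eq0 validNE eqb0 -lt0n memNE => /andP [v H].
by have := valid_drv_sound v H; rewrite coK.
Qed.

Lemma derives_decide : exists M, forall x,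
  (derives P [:: 1; x] -> ~ derives P [:: 2; x] -> peval M [:: x] 1) /\
  (derives P [:: 2; x] -> ~ derives P [:: 1; x] -> peval M [:: x] 0).
Proof.
have [F [cF HF]] := derives_re 1; have [G [cG HG]] := derives_re 2.
have [M HM] := decide_mu cF cG; exists M => x.
have [H1 H0] := HM x.
split=> /[dup] D; [move/HF => H N; apply: H1 | move/HG => H N; apply: H0] => //.
  by move=> w Hw; apply/N/HG; exists w.
by move=> w Hw; apply/N/HF; exists w.
Qed.

End DerivesRE.

Arguments co : simpl never.

(** * Lie structures and equational logic *)

Section Structures.
Import GRing.Theory.
Local Open Scope ring_scope.

(** No laws are imposed: terms, their quotient, finite tables and pairs over a ring share the
    evaluation [seval], and laws are proved where they hold. *)
Record lstruct (k : Type) := LStruct {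
  car :> Type;
  s0 : car;
  sadd : car -> car -> car;
  ssc : k -> car -> car;
  sbr : car -> car -> car
}.

Fixpoint seval (k : Type) (M : lstruct k) (va vx : nat -> M) (t : lterm k) :
  M :=
  match t with
  | LA i => va i
  | LX j => vx j
  | L0 => s0 M
  | LAdd t u => sadd (seval va vx t) (seval va vx u)
  | LScale c t => ssc c (seval va vx t)
  | LBr t u => sbr (seval va vx t) (seval va vx u)
  end.

Record is_hom (k : Type) (M N : lstruct k) (h : M -> N) : Prop := IsHom {
  hom0 : h (s0 M) = s0 N;
  homD : forall x y, h (sadd x y) = sadd (h x) (h y);
  homZ : forall c x, h (ssc c x) = ssc c (h x);
  homB : forall x y, h (sbr x y) = sbr (h x) (h y)
}.

Lemma seval_hom (k : Type) (M N : lstruct k) (h : M -> N) : is_hom h ->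
  forall va vx t, h (seval va vx t) = seval (h \o va) (h \o vx) t.
Proof.
move=> [h0 hD hZ hB] va vx; elim=> //= [t <- u <-|c t <-|t <- u <-].
- exact: hD.
- exact: hZ.
- exact: hB.
Qed.

Lemma seval_eq (k : Type) (M : lstruct k) r n (va va' vx vx' : nat -> M) t :
  lwf r n t -> (forall i, (i < r)%N -> va i = va' i) ->
  (forall j, (j < n)%N -> vx j = vx' j) -> seval va vx t = seval va' vx' t.
Proof.
move=> wt Ha Hx; elim: t wt => //= [t IHt u IHu|c t IHt|t IHt u IHu].
- by move=> /andP [/IHt -> /IHu ->].
- by move=> /IHt ->.
- by move=> /andP [/IHt -> /IHu ->].
Qed.

Definition lie_struct (k : fieldType) (L : lieAlgebra k) : lstruct k :=
  @LStruct k L 0 +%R *:%R (@lie_br k L).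

Lemma seval_lie (k : fieldType) (L : lieAlgebra k) (va vx : nat -> L) t :
  @seval k (lie_struct L) va vx t = leval va vx t.
Proof. by elim: t => //= [t -> u ->|c t ->|t -> u ->]. Qed.

Definition term_struct (k : Type) : lstruct k :=
  @LStruct k (lterm k) L0 (@LAdd k) (@LScale k) (@LBr k).

Definition lsubst (k : Type) (sa sx : nat -> lterm k) (t : lterm k) : lterm k :=
  @seval k (term_struct k) sa sx t.

Lemma is_hom_seval (k : Type) (M : lstruct k) (va vx : nat -> M) :
  @is_hom k (term_struct k) M (seval va vx).
Proof. by []. Qed.

Lemma seval_lsubst (k : Type) (M : lstruct k) (va vx : nat -> M) sa sx t :
  seval va vx (lsubst sa sx t) =
    seval (seval va vx \o sa) (seval va vx \o sx) t.
Proof. exact: (seval_hom (is_hom_seval va vx)). Qed.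

(** Only equations in the signature of [lterm], so that they can be the axioms of an equational
    calculus; scaling by [- 1] stands for the opposite. *)
Record metab_laws (k : fieldType) (M : lstruct k) : Prop := MetabLaws {
  law_addA : forall x y z : M, sadd (sadd x y) z = sadd x (sadd y z);
  law_addC : forall x y : M, sadd x y = sadd y x;
  law_add0 : forall x : M, sadd (s0 M) x = x;
  law_addN : forall x : M, sadd (ssc (- 1) x) x = s0 M;
  law_sc1 : forall x : M, ssc 1 x = x;
  law_brDl : forall x y z : M, sbr (sadd x y) z = sadd (sbr x z) (sbr y z);
  law_brDr : forall x y z : M, sbr z (sadd x y) = sadd (sbr z x) (sbr z y);
  law_brxx : forall x : M, sbr x x = s0 M;
  law_jacobi : forall x y z : M,
    sadd (sadd (sbr x (sbr y z)) (sbr y (sbr z x))) (sbr z (sbr x y)) = s0 M;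
  law_metab : forall x y z w : M, sbr (sbr x y) (sbr z w) = s0 M;
  law_scDr : forall c (x y : M), ssc c (sadd x y) = sadd (ssc c x) (ssc c y);
  law_brZl : forall c (x z : M), sbr (ssc c x) z = ssc c (sbr x z);
  law_brZr : forall c (x z : M), sbr z (ssc c x) = ssc c (sbr z x);
  law_scA : forall c d (x : M), ssc c (ssc d x) = ssc (c * d) x;
  law_scDl : forall c d (x : M), ssc (c + d) x = sadd (ssc c x) (ssc d x)
}.

Lemma lie_struct_laws (k : fieldType) (L : lieAlgebra k) :
  metabelian L -> metab_laws (lie_struct L).
Proof.
have brDl x y z : lie_br (x + y) z = lie_br x z + lie_br y z :> L.
  by have := lie_brDl 1 x y z; rewrite !scale1r.
have brDr x y z : lie_br z (x + y) = lie_br z x + lie_br z y :> L.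
  by have := lie_brDr 1 x y z; rewrite !scale1r.
have br0l z : lie_br 0 z = 0 :> L.
  by apply: (addrI (lie_br 0 z)); rewrite -brDl !addr0.
have br0r z : lie_br z 0 = 0 :> L.
  by apply: (addrI (lie_br z 0)); rewrite -brDr !addr0.
move=> mL; split=> //=.
- by move=> x y z; rewrite addrA.
- exact: addrC.
- exact: add0r.
- by move=> x; rewrite scaleN1r addNr.
- exact: scale1r.
- exact: lie_brxx.
- exact: lie_jacobi.
- by move=> c x y; rewrite scalerDr.
- by move=> c x z; have := lie_brDl c x 0 z; rewrite br0l !addr0.
- by move=> c x z; have := lie_brDr c x 0 z; rewrite br0r !addr0.
- by move=> c d x; rewrite scalerA.
- by move=> c d x; rewrite scalerDl.
Qed.

(** The proof of the laws is a parameter of the type, so that module instances can be attached to a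
    bare carrier; equality and choice on it are classical. *)
Definition lcar (k : fieldType) (M : lstruct k) of metab_laws M : Type := car M.

Section LieOfLaws.
Variables (k : fieldType) (M : lstruct k) (H : metab_laws M).

HB.instance Definition _ := gen_eqMixin (lcar H).
HB.instance Definition _ := gen_choiceMixin (lcar H).

Lemma lcar_addA : associative (@sadd k M).
Proof. by move=> x y z; rewrite (law_addA H). Qed.

HB.instance Definition _ := GRing.isZmodule.Build (lcar H)
  lcar_addA (law_addC H) (law_add0 H) (law_addN H).

Lemma lcar_scDl (x : lcar H) :
  {morph (fun c => ssc c x : lcar H) : c d / c + d}.
Proof. by move=> c d; apply: (law_scDl H). Qed.

HB.instance Definition _ := GRing.Zmodule_isLmodule.Build k (lcar H)
  (law_scA H) (law_sc1 H) (law_scDr H) lcar_scDl.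

Lemma lcar_brDl (a : k) (x y z : lcar H) :
  sbr (a *: x + y) z = a *: (sbr x z : lcar H) + sbr y z :> lcar H.
Proof. by rewrite [LHS](law_brDl H) (law_brZl H). Qed.

Lemma lcar_brDr (a : k) (x y z : lcar H) :
  sbr z (a *: x + y) = a *: (sbr z x : lcar H) + sbr z y :> lcar H.
Proof. by rewrite [LHS](law_brDr H) (law_brZr H). Qed.

Definition lie_of_laws : lieAlgebra k :=
  @LieAlgebra k (lcar H) (@sbr k M) lcar_brDl lcar_brDr (law_brxx H)
    (law_jacobi H).

Lemma lie_of_laws_metabelian : metabelian lie_of_laws.
Proof. exact: law_metab H. Qed.

Lemma leval_lie_of_laws (va vx : nat -> M) t :
  @leval k lie_of_laws va vx t = seval va vx t.
Proof. by elim: t => //= [t -> u ->|c t ->|t -> u ->]. Qed.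

End LieOfLaws.

Definition valid_eq (k : fieldType) (t u : lterm k) : Prop :=
  forall (L : lieAlgebra k), metabelian L ->
  forall va vx : nat -> L, leval va vx t = leval va vx u.

End Structures.

(** * Completeness of equational logic for metabelian Lie algebras *)

Section Equational.
Import GRing.Theory.
Local Open Scope ring_scope.
Variable k : finFieldType.

Let x : lterm k := LX 0.
Let y : lterm k := LX 1.
Let z : lterm k := LX 2.
Let w : lterm k := LX 3.

(** Scalars are not variables of terms, so a law with scalars is listed for all their values; the
    list is finite because [k] is. *)
Definition lie_axioms : seq (lterm k * lterm k) :=
  [:: (LAdd (LAdd x y) z, LAdd x (LAdd y z));
      (LAdd x y, LAdd y x);
      (LAdd L0 x, x);
      (LAdd (LScale (- 1) x) x, L0);
      (LScale 1 x, x);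
      (LBr (LAdd x y) z, LAdd (LBr x z) (LBr y z));
      (LBr z (LAdd x y), LAdd (LBr z x) (LBr z y));
      (LBr x x, L0);
      (LAdd (LAdd (LBr x (LBr y z)) (LBr y (LBr z x))) (LBr z (LBr x y)), L0);
      (LBr (LBr x y) (LBr z w), L0)] ++
  [seq (LScale c (LAdd x y), LAdd (LScale c x) (LScale c y)) | c <- enum k] ++
  [seq (LBr (LScale c x) z, LScale c (LBr x z)) | c <- enum k] ++
  [seq (LBr z (LScale c x), LScale c (LBr z x)) | c <- enum k] ++
  [seq (LScale cd.1 (LScale cd.2 x), LScale (cd.1 * cd.2) x)
     | cd <- enum {: k * k}] ++
  [seq (LScale (cd.1 + cd.2) x, LAdd (LScale cd.1 x) (LScale cd.2 x))
     | cd <- enum {: k * k}].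

Lemma Forall_cat A (P : A -> Prop) s1 s2 :
  List.Forall P (s1 ++ s2) <-> List.Forall P s1 /\ List.Forall P s2.
Proof.
elim: s1 => [|a s IH] /=; first by split=> [|[]] //; split.
by rewrite !List.Forall_cons_iff IH; tauto.
Qed.

Lemma Forall_map_enum (T : finType) A (f : T -> A) (P : A -> Prop) :
  List.Forall P (map f (enum T)) <-> forall c, P (f c).
Proof.
split=> [H c|H]; last by elim: (enum T) => //= *; constructor.
have : c \in enum T by rewrite mem_enum.
elim: (enum T) H => //= d s IH H; inversion_clear H.
by rewrite in_cons => /orP [/eqP ->|/IH] //; apply.
Qed.

Lemma lie_axioms_wf :
  List.Forall (fun e => lwf 0 4 e.1 && lwf 0 4 e.2) lie_axioms.
Proof.
rewrite /lie_axioms !Forall_cat; do !split; try exact/Forall_map_enum.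
by repeat constructor.
Qed.

Definition models (M : lstruct k) : Prop :=
  List.Forall (fun e => forall va vx : nat -> M,
    seval va vx e.1 = seval va vx e.2) lie_axioms.

Lemma modelsP (M : lstruct k) : models M <-> metab_laws M.
Proof.
rewrite /models /lie_axioms !Forall_cat !Forall_map_enum.
split=> [|[]]; last first.
  move=> *; split; first by repeat constructor => //=.
  by do !split => //= -[].
move=> [H [HA [HB [HC [HD HE]]]]].
pose v (a b c d : M) j := nth (s0 M) [:: a; b; c; d] j.
pose va (_ : nat) := s0 M; pose n := s0 M.
move: H; rewrite !List.Forall_cons_iff => -[H1 [H2 [H3 [H4 [H5 [H6 [H7 [H8 [H9
  [H10 _]]]]]]]]]].
split=> [a b c|a b|a|a|a|a b c|a b c|a|a b c|a b c d|e a b|e a b|e a b|e f a|e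
  f a].
- exact: (H1 va (v a b c n)).
- exact: (H2 va (v a b n n)).
- exact: (H3 va (v a n n n)).
- exact: (H4 va (v a n n n)).
- exact: (H5 va (v a n n n)).
- exact: (H6 va (v a b c n)).
- exact: (H7 va (v a b c n)).
- exact: (H8 va (v a n n n)).
- exact: (H9 va (v a b c n)).
- exact: (H10 va (v a b c d)).
- exact: (HA e va (v a b n n)).
- exact: (HB e va (v a n b n)).
- exact: (HC e va (v a n b n)).
- exact: (HD (e, f) va (v a n n n)).
- exact: (HE (e, f) va (v a n n n)).
Qed.

Inductive deq : lterm k -> lterm k -> Prop :=
| deq_refl t : deq t t
| deq_sym t u : deq t u -> deq u t
| deq_trans t u v : deq t u -> deq u v -> deq t v
| deq_add t t' u u' : deq t t' -> deq u u' -> deq (LAdd t u) (LAdd t' u')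
| deq_sc c t t' : deq t t' -> deq (LScale c t) (LScale c t')
| deq_br t t' u u' : deq t t' -> deq u u' -> deq (LBr t u) (LBr t' u')
| deq_ax e sa sx : List.In e lie_axioms ->
    deq (lsubst sa sx e.1) (lsubst sa sx e.2).

(** A class is the predicate [deq t] itself, so extensionality turns provable equality into equality
    of classes; representatives are picked by choice. *)
Definition qcar := {P : lterm k -> Prop | exists t, P = deq t}.
Definition qcls (t : lterm k) : qcar := exist _ (deq t) (ex_intro _ t erefl).
Definition qrep (q : qcar) : lterm k := projT1 (cid (proj2_sig q)).

Lemma qrepK : cancel qrep qcls.
Proof.
move=> [P HP]; rewrite /qrep /=; case: cid => t /= e.
by apply: eq_exist; rewrite /= e.
Qed.

Lemma qclsP t u : qcls t = qcls u <-> deq t u.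
Proof.
split=> [[e]|tu]; first by rewrite e; apply: deq_refl.
apply: eq_exist => /=; apply/funext => v; apply/propext; split.
  exact: deq_trans (deq_sym tu).
exact: deq_trans.
Qed.

Lemma qrep_cls t : deq (qrep (qcls t)) t.
Proof. by apply/qclsP; rewrite qrepK. Qed.

Definition quot_struct : lstruct k := @LStruct k qcar (qcls L0)
  (fun p q => qcls (LAdd (qrep p) (qrep q)))
  (fun c p => qcls (LScale c (qrep p)))
  (fun p q => qcls (LBr (qrep p) (qrep q))).

Lemma qcls_hom : @is_hom k (term_struct k) quot_struct qcls.
Proof.
split=> //= *; apply/qclsP; apply: deq_sym.
- by apply: deq_add; apply: qrep_cls.
- by apply: deq_sc; apply: qrep_cls.
- by apply: deq_br; apply: qrep_cls.
Qed.

Lemma quot_laws : metab_laws quot_struct.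
Proof.
apply/modelsP/List.Forall_forall => e He va vx.
(* Every assignment in the quotient lifts to terms, so the law to be checked is a substitution
   instance of an axiom. *)
have -> : va = qcls \o (qrep \o va) by apply/funext => i /=; rewrite qrepK.
have -> : vx = qcls \o (qrep \o vx) by apply/funext => i /=; rewrite qrepK.
by rewrite -!(seval_hom qcls_hom); apply/qclsP; apply: deq_ax.
Qed.

Lemma lsubst_id t : lsubst (@LA k) (@LX k) t = t.
Proof. by rewrite /lsubst; elim: t => //= [t -> u ->|c t ->|t -> u ->]. Qed.

(* Interpret in the algebra of terms modulo provable equality. *)
Lemma valid_deq t u : valid_eq t u -> deq t u.
Proof.
move=> /(_ _ (@lie_of_laws_metabelian _ _ quot_laws) (qcls \o @LA k) (qcls \o
  @LX k)).
rewrite !leval_lie_of_laws -!(seval_hom qcls_hom).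
by rewrite -/(lsubst _ _ t) -/(lsubst _ _ u) !lsubst_id => /qclsP.
Qed.

Lemma deq_valid t u : deq t u -> valid_eq t u.
Proof.
move=> D L mL va vx; rewrite -!seval_lie.
have /modelsP/List.Forall_forall mod := lie_struct_laws mL.
elim: D => //= [t1 t2 t3 _ -> _ -> //|t1 t2 u1 u2 _ -> _ -> //|c t1 t2 _ -> //
  |t1 t2 u1 u2 _ -> _ -> //|e sa sx /mod].
by rewrite !seval_lsubst.
Qed.
End Equational.

(** * A Horn clause program for the two semi-decisions *)

Section Codes.
Variable k : finFieldType.

Definition rk (c : k) : nat := enum_rank c.

Lemma rk_inj : injective rk.
Proof. by move=> c d /val_inj /enum_rank_inj. Qed.

Lemma rk_lt c : rk c < #|k|. Proof. exact: ltn_ord. Qed.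

Lemma rk_surj i : i < #|k| -> exists c, i = rk c.
Proof. by move=> ik; exists (enum_val (Ordinal ik)); rewrite /rk enum_valK. Qed.

(** Nested lists, which patterns can take apart into subterms; the input code is a flat list of
    tokens, translated by the parsing clauses. *)
Fixpoint tcode (t : lterm k) : nat :=
  match t with
  | LA i => pcons 0 (pcons i 0)
  | LX j => pcons 1 (pcons j 0)
  | L0 => pcons 2 0
  | LAdd t u => pcons 3 (pcons (tcode t) (pcons (tcode u) 0))
  | LScale c t => pcons 4 (pcons (rk c) (pcons (tcode t) 0))
  | LBr t u => pcons 5 (pcons (tcode t) (pcons (tcode u) 0))
  end.

Lemma tcode_inj : injective tcode.
Proof.
elim=> [i|j||t IHt u IHu|c t IHt|t IHt u IHu] [i'|j'||t' u'|c' t'|t' u'] //=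
  /pcons_inj [] // _ => [||H|H|H].
- by move=> /pcons_inj [->].
- by move=> /pcons_inj [->].
- by have [/IHt -> /pcons_inj [/IHu ->]] := pcons_inj H.
- by have [/rk_inj -> /pcons_inj [/IHt ->]] := pcons_inj H.
- by have [/IHt -> /pcons_inj [/IHu ->]] := pcons_inj H.
Qed.

(** The pickled [inl i] and [inr i] of [GenTree.encode]: leaves are [inr], a node labelled [i] opens
    with [inl i.+1] and closes with [inl 0]. Hence the shifted labels in [toks]. *)
Definition tokl i := co [:: co [:: i]; co [::]].
Definition tokr i := co [:: co [::]; co [:: i]].

Fixpoint toks (t : lterm k) : seq nat :=
  match t with
  | LA i => [:: tokl 1; tokr i; tokl 0]
  | LX j => [:: tokl 2; tokr j; tokl 0]
  | L0 => [:: tokl 3; tokl 0]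
  | LAdd t u => tokl 4 :: toks t ++ toks u ++ [:: tokl 0]
  | LScale c t => tokl 5 :: tokr (rk c) :: toks t ++ [:: tokl 0]
  | LBr t u => tokl 6 :: toks t ++ toks u ++ [:: tokl 0]
  end.

Lemma toksE (t : lterm k) :
  map (@pickle _) (GenTree.encode (lterm_tree t)) = toks t.
Proof.
have tl i : @pickle (nat + nat)%type (inl i) = tokl i by rewrite /tokl !co_code.
have tr i : @pickle (nat + nat)%type (inr i) = tokr i by rewrite /tokr !co_code.
elim: t => [i|j||t IHt u IHu|c t IHt|t IHt u IHu] //=;
  rewrite ?cats0 ?map_rcons ?map_cat ?IHt ?IHu ?tl ?tr -?cats1 -?catA;
    reflexivity.
Qed.

Lemma encode_systemE n (S : seq (lterm k)) :
  encode_system n S = co [:: n; co [seq co (toks t) | t <- S]].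
Proof.
rewrite /encode_system.
have -> : [seq co (toks t) | t <- S] =
    [seq CodeSeq.code (map (@pickle _) (GenTree.encode t))
       | t <- map (@lterm_tree k) S].
  by rewrite -map_comp; apply: eq_map => t /=; rewrite toksE co_code.
by rewrite !co_code.
Qed.

(** Unknowns become pattern variables, so that instantiating an axiom clause substitutes terms in
    the axiom. *)
Fixpoint tpat (t : lterm k) : pat :=
  match t with
  | LA i => PC (pcons 0 (pcons i 0))
  | LX j => PV j
  | L0 => PC (pcons 2 0)
  | LAdd t u => PK (PC 3) (PK (tpat t) (PK (tpat u) (PC 0)))
  | LScale c t => PK (PC 4) (PK (PC (rk c)) (PK (tpat t) (PC 0)))
  | LBr t u => PK (PC 5) (PK (tpat t) (PK (tpat u) (PC 0)))
  end.

Lemma tpatE env sx n t : lwf 0 n t ->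
  (forall j, j < n -> nth 0 env j = tcode (sx j)) ->
  peva env (tpat t) = tcode (lsubst (@LA k) sx t).
Proof.
rewrite /lsubst => wt H.
elim: t wt => //= [t IHt u IHu /andP [/IHt -> /IHu ->]|c t IHt /IHt ->
  |t IHt u IHu /andP [/IHt -> /IHu ->]] //.
Qed.

End Codes.

Section Program.
Variables (k : finFieldType) (r : nat).

Definition pl (s : seq pat) : pat := foldr PK (PC 0) s.

Let v := PV.
Let pLA i := pl [:: PC 0; i].
Let pLX j := pl [:: PC 1; j].
Let pL0 := pl [:: PC 2].
Let pAdd t u := pl [:: PC 3; t; u].
Let pSc c t := pl [:: PC 4; c; t].
Let pBr t u := pl [:: PC 5; t; u].
Let tl i := pl [:: pl [:: PC i]; PC 0].
Let tr p := pl [:: PC 0; pl [:: p]].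
(* A finite structure on [{0, .., N-1}]: its cardinal [N], zero, generators,
   and the tables of addition, scaling and bracket. *)
Let pD := pl [:: v 10; v 11; v 12; v 13; v 14; v 15].

(* Besides the axioms, the pairs [(t, t)] express that a table is total. *)
Definition obligations : seq (lterm k * lterm k) :=
  lie_axioms k ++
  [seq (t, t) | t <- [:: L0; LAdd (LX 0) (LX 1); LBr (LX 0) (LX 1)]] ++
  [seq (LScale c (LX 0), LScale c (LX 0)) | c <- enum k] ++
  [seq (LA (nat_of_ord i), LA (nat_of_ord i)) | i <- enum 'I_r].

(** The two evaluation atoms share the variable [i], which forces equal values. Each obligation has
    its own variable; the program numbers them from 20, clear of the variables 10 to 15 of [pD]. *)
Fixpoint obl_atoms i (l : seq (lterm k * lterm k)) : seq atom :=
  if l is e :: l' then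
    [:: [:: PC 11; pD; v 1; PC (tcode e.1); v i],
        [:: PC 11; pD; v 1; PC (tcode e.2); v i],
        [:: PC 12; v i; v 10] & obl_atoms i.+1 l']
  else [::].

(* Clauses sorted by head predicate, the entry of index [p] defining the
   predicate with tag [p]:
   1 solvable x, 2 unsolvable x, 3 parse tokens term rest, 4 parse-list,
   5 nth l j x, 6 subst b t u, 7 closed-term t, 8 closed-terms l n,
   9 provably-equal t u, 10 all-solved s b, 11 eval D env t x, 12 less i j,
   13 loop mode D s env m and 14 its inner loop (mode 0: obligations,
   mode 1: no solution), 15 term t. *)
Definition groups : seq (seq clause) := [::
  [::];
  [:: ([:: PC 1; pl [:: v 0; v 1]],
       [:: [:: PC 4; v 1; v 2]; [:: PC 8; v 3; v 0]; [:: PC 10; v 2; v 3]])];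
  [:: ([:: PC 2; pl [:: v 0; v 1]],
       [:: [:: PC 4; v 1; v 2]; [:: PC 12; PC 0; v 10];
           [:: PC 13; PC 0; pD; v 2; PC 0; PC 4];
           [:: PC 13; PC 1; pD; v 2; PC 0; v 0]])];
  [:: ([:: PC 3; PK (tl 1) (PK (tr (v 0)) (PK (tl 0) (v 1))); pLA (v 0); v 1],
       [::]);
      ([:: PC 3; PK (tl 2) (PK (tr (v 0)) (PK (tl 0) (v 1))); pLX (v 0); v 1],
       [::]);
      ([:: PC 3; PK (tl 3) (PK (tl 0) (v 1)); pL0; v 1], [::]);
      ([:: PC 3; PK (tl 4) (v 0); pAdd (v 1) (v 2); v 4],
       [:: [:: PC 3; v 0; v 1; v 3]; [:: PC 3; v 3; v 2; PK (tl 0) (v 4)]]);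
      ([:: PC 3; PK (tl 5) (PK (tr (v 5)) (v 0)); pSc (v 5) (v 1); v 4],
       [:: [:: PC 3; v 0; v 1; PK (tl 0) (v 4)]]);
      ([:: PC 3; PK (tl 6) (v 0); pBr (v 1) (v 2); v 4],
       [:: [:: PC 3; v 0; v 1; v 3]; [:: PC 3; v 3; v 2; PK (tl 0) (v 4)]])];
  [:: ([:: PC 4; PC 0; PC 0], [::]);
      ([:: PC 4; PK (v 0) (v 1); PK (v 2) (v 3)],
       [:: [:: PC 3; v 0; v 2; PC 0]; [:: PC 4; v 1; v 3]])];
  [:: ([:: PC 5; PK (v 0) (v 1); PC 0; v 0], [::]);
      ([:: PC 5; PK (v 0) (v 1); PS (v 2); v 3], [:: [:: PC 5; v 1; v 2;
        v 3]])];
  [:: ([:: PC 6; v 0; pLA (v 1); pLA (v 1)], [::]);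
      ([:: PC 6; v 0; pLX (v 1); v 2], [:: [:: PC 5; v 0; v 1; v 2]]);
      ([:: PC 6; v 0; pL0; pL0], [::]);
      ([:: PC 6; v 0; pAdd (v 1) (v 2); pAdd (v 3) (v 4)],
       [:: [:: PC 6; v 0; v 1; v 3]; [:: PC 6; v 0; v 2; v 4]]);
      ([:: PC 6; v 0; pSc (v 1) (v 2); pSc (v 1) (v 3)],
       [:: [:: PC 6; v 0; v 2; v 3]]);
      ([:: PC 6; v 0; pBr (v 1) (v 2); pBr (v 3) (v 4)],
       [:: [:: PC 6; v 0; v 1; v 3]; [:: PC 6; v 0; v 2; v 4]])];
  [:: ([:: PC 7; pLA (v 0)], [:: [:: PC 12; v 0; PC r]]);
      ([:: PC 7; pL0], [::]);
      ([:: PC 7; pAdd (v 0) (v 1)], [:: [:: PC 7; v 0]; [:: PC 7; v 1]]);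
      ([:: PC 7; pSc (v 0) (v 1)], [:: [:: PC 12; v 0; PC #|k|]; [:: PC 7;
        v 1]]);
      ([:: PC 7; pBr (v 0) (v 1)], [:: [:: PC 7; v 0]; [:: PC 7; v 1]])];
  [:: ([:: PC 8; PC 0; PC 0], [::]);
      ([:: PC 8; PK (v 0) (v 1); PS (v 2)],
       [:: [:: PC 7; v 0]; [:: PC 8; v 1; v 2]])];
  [:: ([:: PC 9; v 0; v 0], [:: [:: PC 15; v 0]]),
      ([:: PC 9; v 0; v 1], [:: [:: PC 9; v 1; v 0]]),
      ([:: PC 9; v 0; v 2], [:: [:: PC 9; v 0; v 1]; [:: PC 9; v 1; v 2]]),
      ([:: PC 9; pAdd (v 0) (v 1); pAdd (v 2) (v 3)],
       [:: [:: PC 9; v 0; v 2]; [:: PC 9; v 1; v 3]]),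
      ([:: PC 9; pSc (v 0) (v 1); pSc (v 0) (v 2)],
       [:: [:: PC 12; v 0; PC #|k|]; [:: PC 9; v 1; v 2]]),
      ([:: PC 9; pBr (v 0) (v 1); pBr (v 2) (v 3)],
       [:: [:: PC 9; v 0; v 2]; [:: PC 9; v 1; v 3]]) &
      [seq ([:: PC 9; tpat e.1; tpat e.2],
            [:: [:: PC 15; v 0]; [:: PC 15; v 1]; [:: PC 15; v 2];
                [:: PC 15; v 3]]) | e <- lie_axioms k]];
  [:: ([:: PC 10; PC 0; v 0], [::]);
      ([:: PC 10; PK (v 0) (v 1); v 2],
       [:: [:: PC 6; v 2; v 0; v 3]; [:: PC 9; v 3; pL0]; [:: PC 10; v 1;
         v 2]])];
  [:: ([:: PC 11; pD; v 0; pLA (v 1); v 2], [:: [:: PC 5; v 12; v 1; v 2]]);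
      ([:: PC 11; pD; v 0; pLX (v 1); v 2], [:: [:: PC 5; v 0; v 1; v 2]]);
      ([:: PC 11; pD; v 0; pL0; v 11], [::]);
      ([:: PC 11; pD; v 0; pAdd (v 1) (v 2); v 3],
       [:: [:: PC 11; pD; v 0; v 1; v 4]; [:: PC 11; pD; v 0; v 2; v 5];
           [:: PC 5; v 13; v 4; v 6]; [:: PC 5; v 6; v 5; v 3]]);
      ([:: PC 11; pD; v 0; pSc (v 1) (v 2); v 3],
       [:: [:: PC 11; pD; v 0; v 2; v 5];
           [:: PC 5; v 14; v 1; v 6]; [:: PC 5; v 6; v 5; v 3]]);
      ([:: PC 11; pD; v 0; pBr (v 1) (v 2); v 3],
       [:: [:: PC 11; pD; v 0; v 1; v 4]; [:: PC 11; pD; v 0; v 2; v 5];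
           [:: PC 5; v 15; v 4; v 6]; [:: PC 5; v 6; v 5; v 3]])];
  [:: ([:: PC 12; PC 0; PS (v 0)], [::]);
      ([:: PC 12; PS (v 0); PS (v 1)], [:: [:: PC 12; v 0; v 1]])];
  [:: ([:: PC 13; PC 0; pD; v 0; v 1; PC 0], obl_atoms 20 obligations);
      ([:: PC 13; PC 1; pD; v 0; v 1; PC 0],
       [:: [:: PC 5; v 0; v 2; v 3]; [:: PC 11; pD; v 1; v 3; v 4];
           [:: PC 12; v 4; v 11]]);
      ([:: PC 13; PC 1; pD; v 0; v 1; PC 0],
       [:: [:: PC 5; v 0; v 2; v 3]; [:: PC 11; pD; v 1; v 3; v 4];
           [:: PC 12; v 11; v 4]]);
      ([:: PC 13; v 0; pD; v 1; v 2; PS (v 3)],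
       [:: [:: PC 14; v 0; pD; v 1; v 2; v 3; v 10]])];
  [:: ([:: PC 14; v 0; pD; v 1; v 2; v 3; PC 0], [::]);
      ([:: PC 14; v 0; pD; v 1; v 2; v 3; PS (v 4)],
       [:: [:: PC 14; v 0; pD; v 1; v 2; v 3; v 4];
           [:: PC 13; v 0; pD; v 1; PK (v 4) (v 2); v 3]])];
  [:: ([:: PC 15; pLA (v 0)], [::]);
      ([:: PC 15; pLX (v 0)], [::]);
      ([:: PC 15; pL0], [::]);
      ([:: PC 15; pAdd (v 0) (v 1)], [:: [:: PC 15; v 0]; [:: PC 15; v 1]]);
      ([:: PC 15; pSc (v 0) (v 1)],
       [:: [:: PC 12; v 0; PC #|k|]; [:: PC 15; v 1]]);
      ([:: PC 15; pBr (v 0) (v 1)], [:: [:: PC 15; v 0]; [:: PC 15; v 1]])]].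

Definition program : seq clause := flatten groups.

Definition compD (D : nat) i := nth 0 (dc D) i.
Definition table2 (T x y : nat) : option nat :=
  obind (fun row => onth (dc row) y) (onth (dc T) x).

(** Partial, since [D] may be any number and a look-up may fall outside a table. *)
Fixpoint evD (D env : nat) (t : lterm k) : option nat :=
  match t with
  | LA i => onth (dc (compD D 2)) i
  | LX j => onth (dc env) j
  | L0 => Some (compD D 1)
  | LAdd t u => obind (fun x => obind (table2 (compD D 3) x) (evD D env u))
                  (evD D env t)
  | LScale c t => obind (table2 (compD D 4) (rk c)) (evD D env t)
  | LBr t u => obind (fun x => obind (table2 (compD D 5) x) (evD D env u))
                 (evD D env t)
  end.

Definition checked (mode D s env : nat) : Prop :=
  match mode with
  | 0 => forall e, List.In e obligations ->
      exists x, [/\ evD D env e.1 = Some x, evD D env e.2 = Some x &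
                    x < compD D 0]
  | 1 => forall S : seq (lterm k), s = co (map (@tcode k) S) ->
      exists f x, [/\ List.In f S, evD D env f = Some x & x <> compD D 1]
  | _ => True
  end.

(** Derivable facts may concern numbers that code nothing. Predicates computing from an input (3, 4,
    6, 10, 11) are therefore constrained only on codes, while 7, 8, 9 and 15 also assert that their
    arguments are codes. *)
Definition meaning (a : seq nat) : Prop :=
  if a isn't tag :: args then True else
  let a i := nth 0 args i in
  match tag with
  | 1 => forall n (S : seq (lterm k)), a 0 = encode_system n S ->
           all (lwf r n) S -> solvable r n S
  | 2 => forall n (S : seq (lterm k)), a 0 = encode_system n S ->
           all (lwf r n) S -> ~ solvable r n S
  | 3 => forall (t : lterm k) s, a 0 = co (toks t ++ s) ->
           a 1 = tcode t /\ a 2 = co s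
  | 4 => forall S : seq (lterm k), a 0 = co [seq co (toks t) | t <- S] ->
           a 1 = co (map (@tcode k) S)
  | 5 => onth (dc (a 0)) (a 1) = Some (a 2)
  | 6 => forall (b : seq (lterm k)) t, a 0 = co (map (@tcode k) b) ->
           a 1 = tcode t -> a 2 = tcode (lsubst (@LA k) (nth L0 b) t)
  | 7 => exists2 t : lterm k, a 0 = tcode t & lwf r 0 t
  | 8 => exists b : seq (lterm k),
           [/\ a 0 = co (map (@tcode k) b), a 1 = size b & all (lwf r 0) b]
  | 9 => exists t u : lterm k,
           [/\ a 0 = tcode t, a 1 = tcode u & valid_eq t u]
  | 10 => forall S b : seq (lterm k), a 0 = co (map (@tcode k) S) ->
           a 1 = co (map (@tcode k) b) -> forall f, List.In f S ->
           valid_eq (lsubst (@LA k) (nth L0 b) f) L0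
  | 11 => forall t : lterm k, a 2 = tcode t -> evD (a 0) (a 1) t = Some (a 3)
  | 12 => a 0 < a 1
  | 13 => forall xs, size xs = a 4 -> all (fun x => x < compD (a 1) 0) xs ->
           checked (a 0) (a 1) (a 2) (co (xs ++ dc (a 3)))
  | 14 => forall y, y < a 5 ->
           forall xs, size xs = a 4 -> all (fun x => x < compD (a 1) 0) xs ->
           checked (a 0) (a 1) (a 2) (co (xs ++ y :: dc (a 3)))
  | 15 => exists t : lterm k, a 0 = tcode t
  | _ => True
  end.

Definition clause_sound (cl : clause) : Prop := forall env,
  foldr (fun b Q => meaning (map (peva env) b) -> Q)
    (meaning (map (peva env) cl.1)) cl.2.

Lemma derives_sound P : List.Forall clause_sound P ->
  forall a, derives P a -> meaning a.
Proof.
move=> H a; elim=> cl env clP _ IH.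
have := List.Forall_forall clause_sound P; case=> /(_ H cl clP env) + _.
elim: cl.2 IH => //= b bs IHb IH /(_ (IH b (or_introl erefl))).
by apply: IHb => b' Hb'; apply: IH; right.
Qed.

End Program.

Lemma dc_pcons x y : dc (pcons x y) = x :: dc y.
Proof. by rewrite -[y in LHS]dcK -coE coK. Qed.

Lemma pcons_co x y s : pcons x y = co s -> exists2 s', s = x :: s' & y = co s'.
Proof.
move=> e; have := coK s; rewrite -e dc_pcons => <-.
by exists (dc y); rewrite ?dcK.
Qed.

Lemma co0 s : 0 = co s -> s = [::].
Proof. by move=> e; apply: co_inj; rewrite -e. Qed.

Lemma In_cat T (x : T) s1 s2 :
  List.In x (s1 ++ s2) <-> List.In x s1 \/ List.In x s2.
Proof.
elim: s1 => [|y s IH] /=; first by split=> [|[]] //; right.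
by rewrite IH; tauto.
Qed.

Lemma In_map_enum (T : finType) A (f : T -> A) c :
  List.In (f c) (map f (enum T)).
Proof.
have : c \in enum T by rewrite mem_enum.
elim: (enum T) => //= d s IH; rewrite in_cons => /orP [/eqP ->|/IH H].
  by left.
by right.
Qed.

Lemma In_nth T x0 (s : seq T) i : i < size s -> List.In (nth x0 s i) s.
Proof. by elim: s i => [|x s IH] [|i] //= H; [left | right; apply: IH]. Qed.

Lemma nth_In T x0 (s : seq T) x : List.In x s ->
  exists2 i, i < size s & nth x0 s i = x.
Proof.
elim: s => //= y s IH [->|/IH [i Hi <-]]; first by exists 0.
by exists i.+1.
Qed.

(** * Metabelian Lie algebras read off from accepted tables *)

Section FiniteModel.
Variables (k : finFieldType) (r : nat) (D : nat).
Local Notation N := (compD D 0).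
Hypothesis N0 : 0 < N.
Hypothesis chk : forall xs, size xs = 4 -> all (fun x => x < N) xs ->
  checked k r 0 D 0 (co xs).

Let o : 'I_N := Ordinal N0.
Let op (x : option nat) : 'I_N := insubd o (odflt 0 x).

(** Missing or oversized entries are sent to the element 0; the checked obligations exclude such
    entries for the operations, the zero and the first [r] generators. *)
Definition finmod : lstruct k := @LStruct k 'I_N (insubd o (compD D 1))
  (fun x y => op (table2 (compD D 3) x y))
  (fun c x => op (table2 (compD D 4) (rk c) x))
  (fun x y => op (table2 (compD D 5) x y)).

Definition finmod_gen (i : nat) : finmod := op (onth (dc (compD D 2)) i).
Definition finmod_env (env : seq nat) (j : nat) : finmod :=
  insubd o (nth 0 env j).

Lemma chk_total (t : lterm k) x y : List.In (t, t) (obligations k r) ->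
  x < N -> y < N -> exists2 z, evD D (co [:: x; y; 0; 0]) t = Some z & z < N.
Proof.
move=> Ht xN yN; have [//||z [e _ zN]] := @chk [:: x; y; 0; 0] _ _ _ Ht.
  by rewrite /= xN yN N0.
by exists z.
Qed.

Lemma opE x z : x = Some z -> z < N -> x = Some (nat_of_ord (op x)).
Proof. by move=> -> zN;
  rewrite /op /= -[nat_of_ord _]/(val _) val_insubd zN. Qed.

Lemma finmod_addE (x y : finmod) :
  table2 (compD D 3) (x : 'I_N) (y : 'I_N) =
  Some (nat_of_ord (sadd x y : 'I_N)).
Proof.
have [|//|//|z] := @chk_total (LAdd (LX 0) (LX 1)) (x : 'I_N) (y : 'I_N).
  by rewrite /obligations In_cat; right; right; left.
by rewrite /= coK /=; apply: opE.
Qed.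

Lemma finmod_brE (x y : finmod) :
  table2 (compD D 5) (x : 'I_N) (y : 'I_N) =
  Some (nat_of_ord (sbr x y : 'I_N)).
Proof.
have [|//|//|z] := @chk_total (LBr (LX 0) (LX 1)) (x : 'I_N) (y : 'I_N).
  by rewrite /obligations In_cat; right; right; right; left.
by rewrite /= coK /=; apply: opE.
Qed.

Lemma finmod_scE c (x : finmod) :
  table2 (compD D 4) (rk c) (x : 'I_N) = Some (nat_of_ord (ssc c x : 'I_N)).
Proof.
have [|//|//|z] := @chk_total (LScale c (LX 0)) (x : 'I_N) 0 => //.
  rewrite /obligations !In_cat; right; right; left.
  exact: (In_map_enum (fun c => (LScale c (LX 0), LScale c (LX 0)))).
by rewrite /= coK /=; apply: opE.
Qed.

Lemma finmod_0E : compD D 1 = nat_of_ord (s0 finmod : 'I_N).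
Proof.
have [|//|//|z] := @chk_total L0 0 0 => //.
  by rewrite /obligations In_cat; right; left.
move=> /= [e] zN; rewrite -[RHS]/(val (insubd o (compD D 1))).
by rewrite val_insubd e zN.
Qed.

Lemma finmod_genE i : i < r ->
  onth (dc (compD D 2)) i = Some (nat_of_ord (finmod_gen i : 'I_N)).
Proof.
move=> ir; have [|//|//|z] := @chk_total (LA i) 0 0 => //.
  rewrite /obligations !In_cat; right; right; right.
  exact: (In_map_enum (fun i : 'I_r => (LA i, LA i)) (Ordinal ir)).
by rewrite /=; apply: opE.
Qed.

Lemma finmodE env t : all (fun x => x < N) env -> lwf r (size env) t ->
  evD D (co env) t =
  Some (nat_of_ord (seval finmod_gen (finmod_env env) t : 'I_N)).
Proof.
move=> /(all_nthP 0) eN.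
elim: t => [i ir|j jn|_|t IHt u IHu|c t IHt|t IHt u IHu].
- exact: finmod_genE.
- rewrite /= coK onthE (nth_map 0) // /finmod_env.
  by rewrite -[nat_of_ord _]/(val _) val_insubd eN.
- by rewrite /= -finmod_0E.
- by move=> /= /andP [/IHt -> /IHu ->] /=; apply: finmod_addE.
- by move=> /= /IHt -> /=; apply: finmod_scE.
- by move=> /= /andP [/IHt -> /IHu ->] /=; apply: finmod_brE.
Qed.

Lemma finmod_laws : metab_laws finmod.
Proof.
apply/modelsP/List.Forall_forall => e He va vx.
have /List.Forall_forall/(_ e He) := lie_axioms_wf k; case/andP => w1 w2.
pose env := [seq nat_of_ord (vx j : 'I_N) | j <- iota 0 4].
have eN : all (fun x => x < N) env by rewrite /= !ltn_ord.
have E t : lwf 0 4 t -> seval va vx t = seval finmod_gen (finmod_env env) t.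
  move=> wt; apply: seval_eq wt _ _ => // j j4.
  apply: val_inj; rewrite /finmod_env val_insubd.
  by case: j j4 => [|[|[|[|//]]]] _ /=; rewrite ltn_ord.
have wr t : lwf 0 4 t -> lwf r 4 t.
  by elim: t => //= [t IHt u IHu /andP [/IHt -> /IHu]|t IHt u IHu /andP [/IHt
    -> /IHu]].
rewrite !E //.
have [|x [e1 e2 _]] := @chk env erefl eN e; first by rewrite In_cat; left.
apply: val_inj; apply: Some_inj.
by rewrite -[X in X = _]finmodE ?wr // -[RHS]finmodE ?wr // e1 e2.
Qed.

(** [solution] speaks of all metabelian algebras, hence of the one given by the tables: a solution
    in [F_r] is carried there by sending the free generators to the marked elements. *)
Lemma finmod_unsolvable n (S : seq (lterm k)) :
  all (lwf r n) S ->
  (forall xs, size xs = n -> all (fun x => x < N) xs ->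
     checked k r 1 D (co (map (@tcode k) S)) (co xs)) ->
  ~ solvable r n S.
Proof.
move=> wS H [b [sb wb Hb]].
pose L := lie_of_laws finmod_laws.
pose vx j : finmod := seval finmod_gen (fun=> s0 finmod) (nth L0 b j).
pose env := [seq nat_of_ord (vx j : 'I_N) | j <- iota 0 n].
have senv : size env = n by rewrite size_map size_iota.
have eN : all (fun x => x < N) env.
  by apply/allP => _ /mapP [j _ ->]; apply: ltn_ord.
have [f [x [fS ex]]] := H env senv eN _ erefl.
have wf : lwf r n f by move/allIn: wS => /(_ f fS).
have E : seval finmod_gen vx f = seval finmod_gen (finmod_env env) f.
  apply: seval_eq wf _ _ => // j jn; apply: val_inj.
  rewrite val_insubd (nth_map 0) ?size_iota // nth_iota // add0n.
  by rewrite ltn_ord.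
have Hf : seval finmod_gen vx f = s0 finmod.
  have := Hb f fS L (@lie_of_laws_metabelian _ _ finmod_laws) finmod_gen.
  rewrite leval_lie_of_laws => e; rewrite -[RHS]e; congr (seval _ _ _).
  by apply/funext => j; rewrite leval_lie_of_laws.
by move: ex; rewrite finmodE ?senv // => -[<-] []; rewrite finmod_0E -E Hf.
Qed.

End FiniteModel.

Lemma Forall_map T A (f : T -> A) (P : A -> Prop) s :
  (forall x, List.In x s -> P (f x)) -> List.Forall P (map f s).
Proof.
elim: s => [|x s IH] H /=; first by constructor.
by constructor; [apply: H; left | apply: IH => y ys; apply: H; right].
Qed.

(** * Soundness of the clauses *)

Section Soundness.
Variables (k : finFieldType) (r : nat).
Local Notation sound := (clause_sound k r).
Local Notation allsound g := (List.Forall sound (nth [::] (groups k r) g)).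

Lemma meaning3 x y z (t : lterm k) s :
  meaning k r [:: 3; x; y; z] -> x = co (toks t ++ s) ->
  y = tcode t /\ z = co s.
Proof. exact. Qed.

Lemma tokl_inj i j : tokl i = tokl j -> i = j.
Proof. by move=> /pcons_inj [/pcons_inj []]. Qed.

Lemma tokr_inj i j : tokr i = tokr j -> i = j.
Proof. by move=> /pcons_inj [_ /pcons_inj [/pcons_inj []]]. Qed.

Lemma toklE i : pcons (pcons i 0) (pcons 0 0) = tokl i. Proof. by []. Qed.
Lemma tokrE i : pcons 0 (pcons (pcons i 0) 0) = tokr i. Proof. by []. Qed.

Lemma pcons_coI x y a s : pcons x y = co (a :: s) -> x = a /\ y = co s.
Proof. exact: pcons_inj. Qed.

Lemma sound_parse : allsound 3.
Proof.
repeat (apply: List.Forall_cons); rewrite /clause_sound /=; last by constructor.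
- move=> env [i|j||t u|c t|t u] s /=;
  rewrite !toklE tokrE => /pcons_coI [/tokl_inj //].
  by move=> _ /pcons_coI [/tokr_inj -> /pcons_coI [_ ->]].
- move=> env [i|j||t u|c t|t u] s /=;
  rewrite !toklE tokrE => /pcons_coI [/tokl_inj //].
  by move=> _ /pcons_coI [/tokr_inj -> /pcons_coI [_ ->]].
- move=> env [i|j||t u|c t|t u] s /=;
  rewrite !toklE => /pcons_coI [/tokl_inj //].
  by move=> _ /pcons_coI [_ ->].
- move=> env H1 H2 [i|j||t u|c t|t u] s /=;
  rewrite !toklE => /pcons_coI [/tokl_inj //].
  rewrite -!catA => _ /(meaning3 H1) [-> /(meaning3 H2) [-> e]].
  by move: e; rewrite toklE => /pcons_coI [_ ->].
- move=> env H1 [i|j||t u|c t|t u] s /=;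
  rewrite !toklE tokrE => /pcons_coI [/tokl_inj //].
  rewrite -!catA => _ /pcons_coI [/tokr_inj -> /(meaning3 H1) [->]].
  by rewrite toklE => /pcons_coI [_ ->].
- move=> env H1 H2 [i|j||t u|c t|t u] s /=;
  rewrite !toklE => /pcons_coI [/tokl_inj //].
  rewrite -!catA => _ /(meaning3 H1) [-> /(meaning3 H2) [-> e]].
  by move: e; rewrite toklE => /pcons_coI [_ ->].
Qed.

Lemma sound_parses : allsound 4.
Proof.
repeat (apply: List.Forall_cons); rewrite /clause_sound /=; last by constructor.
- by move=> env [|t S] // /co0.
- move=> env H1 H2 [|t S] => [/pcons_co [] //|/pcons_coI [e1 e2]].
  have [//|-> _] := @meaning3 _ _ _ t [::] H1; first by rewrite cats0.
  by rewrite (H2 S e2).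
Qed.

Lemma sound_nth : allsound 5.
Proof.
repeat (apply: List.Forall_cons); rewrite /clause_sound /=; last by constructor.
- by move=> env; rewrite dc_pcons.
- by move=> env; rewrite dc_pcons.
Qed.

Lemma sound_subst : allsound 6.
Proof.
repeat (apply: List.Forall_cons); rewrite /clause_sound /=; last by constructor.
- move=> env b [i|j||t u|c t|t u] _ /pcons_inj [//];
  do ?by move=> _ /pcons_inj [].
- move=> env H b [i|j||t u|c t|t u] e /pcons_inj [//] _ /pcons_inj [ej _].
  move: H; rewrite e ej coK onthE.
  case: (ltnP j (size b)) => jb.
    by rewrite (nth_map 0) ?size_map // (nth_map L0) // => -[->].
  by rewrite nth_default ?size_map.
- by move=> env b [i|j||t u|c t|t u] _ /pcons_inj [].
- move=> env H1 H2 b [i|j||t u|c t|t u] e /pcons_inj [//] _.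
  by move=> /pcons_inj [e1 /pcons_inj [e2 _]]; rewrite (H1 b t) // (H2 b u).
- move=> env H b [i|j||t u|c t|t u] e /pcons_inj [//] _.
  by move=> /pcons_inj [e1 /pcons_inj [e2 _]]; rewrite (H b t) // e1.
- move=> env H1 H2 b [i|j||t u|c t|t u] e /pcons_inj [//] _.
  by move=> /pcons_inj [e1 /pcons_inj [e2 _]]; rewrite (H1 b t) // (H2 b u).
Qed.

Lemma sound_closed : allsound 7.
Proof.
repeat (apply: List.Forall_cons); rewrite /clause_sound /=; last by constructor.
- by move=> env ir; exists (LA (nth 0 env 0)).
- by exists L0.
- move=> env [t e1 w1] [u e2 w2].
  by exists (LAdd t u); rewrite /= ?e1 ?e2 ?w1.
- move=> env /rk_surj [c e] [t e1 w1].
  by exists (LScale c t); rewrite /= ?e ?e1.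
- move=> env [t e1 w1] [u e2 w2].
  by exists (LBr t u); rewrite /= ?e1 ?e2 ?w1.
Qed.

Lemma sound_closeds : allsound 8.
Proof.
repeat (apply: List.Forall_cons); rewrite /clause_sound /=; last by constructor.
- by exists [::].
- move=> env [t e1 w1] [b [e2 e3 wb]].
  by exists (t :: b); rewrite /= w1 wb e1 e2 e3.
Qed.

Lemma sound_eq_axioms : List.Forall sound
  [seq ([:: PC 9; tpat e.1; tpat e.2],
        [:: [:: PC 15; PV 0]; [:: PC 15; PV 1]; [:: PC 15; PV 2];
            [:: PC 15; PV 3]]) | e <- lie_axioms k].
Proof.
apply: Forall_map => e He env /=.
move=> [t0 E0] [t1 E1] [t2 E2] [t3 E3].
have /List.Forall_forall/(_ e He)/andP[w1 w2] := lie_axioms_wf k.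
pose sx j := nth L0 [:: t0; t1; t2; t3] j.
have H j : j < 4 -> nth 0 env j = tcode (sx j) by case: j => [|[|[|[|]]]].
exists (lsubst (@LA k) sx e.1), (lsubst (@LA k) sx e.2).
rewrite /= (tpatE w1 H) (tpatE w2 H); split=> //.
by apply: deq_valid; apply: deq_ax.
Qed.

Lemma sound_eq : allsound 9.
Proof.
rewrite -[nth _ _ _]/([:: _; _; _; _; _; _] ++ [seq _ | _ <- lie_axioms k]).
apply/Forall_cat; split; last exact: sound_eq_axioms.
repeat (apply: List.Forall_cons); rewrite /clause_sound /=; last by constructor.
- by move=> env [t e]; exists t, t; split=> // L _ va vx.
- by move=> env [t [u [e1 e2 v]]]; exists u, t; split=> // L mL va vx;
  rewrite v.
- move=> env [t [u [e1 e2 v]]] [u' [w [e3 e4 v']]]; exists t, w; split=> //.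
  have eu : u' = u by apply: tcode_inj; rewrite -e2 -e3.
  by move=> L mL va vx; rewrite v // -v' // eu.
- move=> env [t [t' [e1 e2 v]]] [u [u' [e3 e4 v']]].
  exists (LAdd t u), (LAdd t' u'); rewrite /= e1 e2 e3 e4;
    split=> // L mL va vx.
  by rewrite /= v ?v'.
- move=> env /rk_surj [c ec] [u [u' [e3 e4 v']]].
  exists (LScale c u), (LScale c u'); rewrite /= ec e3 e4;
    split=> // L mL va vx.
  by rewrite /= v'.
- move=> env [t [t' [e1 e2 v]]] [u [u' [e3 e4 v']]].
  exists (LBr t u), (LBr t' u'); rewrite /= e1 e2 e3 e4; split=> // L mL va vx.
  by rewrite /= v ?v'.
Qed.

Lemma sound_solved : allsound 10.
Proof.
repeat (apply: List.Forall_cons); rewrite /clause_sound /=; last by constructor.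
- by move=> env [|t S] b // /co0.
- move=> env H1 [t [u [e1 e2 v]]] H3 [|f S] b; first by move/pcons_co => [].
  move=> /pcons_coI [e3 e4] e5 f' [<-|]; last exact: H3.
  have <- : t = lsubst (@LA k) (nth L0 b) f.
    by apply: tcode_inj; rewrite -e1; apply: H1.
  by have -> : L0 = u by apply: tcode_inj; rewrite -e2.
Qed.

Lemma sound_eval : allsound 11.
Proof.
repeat (apply: List.Forall_cons); rewrite /clause_sound /=; last by constructor.
- move=> env H [i|j||t u|c t|t u] /pcons_inj [//] _ /pcons_inj [<- _].
  by rewrite /= /compD !dc_pcons.
- by move=> env H [i|j||t u|c t|t u] /pcons_inj [//] _ /pcons_inj [<- _].
- move=> env [i|j||t u|c t|t u] /pcons_inj [//] _ _.
  by rewrite /= /compD !dc_pcons.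
- move=> env H1 H2 H3 H4 [i|j||t u|c t|t u] /pcons_inj [//] _.
  move=> /pcons_inj [e1 /pcons_inj [e2 _]] /=.
  by rewrite (H1 t e1) /= (H2 u e2) /= /table2 /compD !dc_pcons /= H3.
- move=> env H2 H3 H4 [i|j||t u|c t|t u] /pcons_inj [//] _.
  move=> /pcons_inj [e1 /pcons_inj [e2 _]] /=.
  by rewrite (H2 t e2) /= /table2 /compD !dc_pcons /= -e1 H3.
- move=> env H1 H2 H3 H4 [i|j||t u|c t|t u] /pcons_inj [//] _.
  move=> /pcons_inj [e1 /pcons_inj [e2 _]] /=.
  by rewrite (H1 t e1) /= (H2 u e2) /= /table2 /compD !dc_pcons /= H3.
Qed.

Lemma sound_less : allsound 12.
Proof.
repeat (apply: List.Forall_cons); rewrite /clause_sound /=; last by constructor.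
- by [].
- by move=> env.
Qed.

Lemma obl_atoms_sound env i (l : seq (lterm k * lterm k)) (Q : Prop) :
  (let D := peva env (pl [:: PV 10; PV 11; PV 12; PV 13; PV 14; PV 15]) in
   (forall e, List.In e l -> exists x, [/\ evD D (nth 0 env 1) e.1 = Some x,
      evD D (nth 0 env 1) e.2 = Some x & x < compD D 0]) -> Q) ->
  foldr (fun b (Q : Prop) => meaning k r (map (peva env) b) -> Q) Q
    (obl_atoms i l).
Proof.
elim: l i Q => [|e l IH] i Q /= H; first by apply: H.
move=> H1 H2 H3; apply: IH => /= Hl; apply: H => e' [<-|/Hl //].
exists (nth 0 env i); split; [exact: H1 | exact: H2 |].
by rewrite /compD dc_pcons.
Qed.

Lemma sound_loop : allsound 13.
Proof.
repeat (apply: List.Forall_cons); rewrite /clause_sound; last by constructor.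
- move=> env; apply: (@obl_atoms_sound env 20 (obligations k r)) => /=
  H [|//] _ _.
  by rewrite cat0s dcK => e /H.
(* Horn clauses cannot negate: that a value differs from the zero of the algebra is split into the
   two strict inequalities of this clause and the next. *)
- move=> env /= H1 H2 H3 [|//] _ _ S eS; rewrite cat0s dcK.
  move: H1; rewrite eS coK onthE.
  case: (ltnP (nth 0 env 2) (size S)) => jS; last first.
    by rewrite nth_default ?size_map.
  rewrite (nth_map 0) ?size_map // (nth_map L0) // => -[ef].
  exists (nth L0 S (nth 0 env 2)), (nth 0 env 4); split.
  + exact: In_nth.
  + exact: H2.
  + by rewrite /compD !dc_pcons /= => e; rewrite e ltnn in H3.
- move=> env /= H1 H2 H3 [|//] _ _ S eS; rewrite cat0s dcK.
  move: H1; rewrite eS coK onthE.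
  case: (ltnP (nth 0 env 2) (size S)) => jS; last first.
    by rewrite nth_default ?size_map.
  rewrite (nth_map 0) ?size_map // (nth_map L0) // => -[ef].
  exists (nth L0 S (nth 0 env 2)), (nth 0 env 4); split.
  + exact: In_nth.
  + exact: H2.
  + by rewrite /compD !dc_pcons /= => e; rewrite e ltnn in H3.
(* The loop puts new values in front of the environment, so the value chosen first is the last entry
   of the tuple. *)
- move=> env /= H xs; case/lastP: xs => // xs y; rewrite size_rcons => -[sx].
  rewrite all_rcons => /andP [yN xN]; rewrite cat_rcons; apply: H => //.
  by move: yN; rewrite /compD dc_pcons.
Qed.

Lemma sound_loop_lt : allsound 14.
Proof.
repeat (apply: List.Forall_cons); rewrite /clause_sound /=; last by constructor.
- by [].
- move=> env H1 H2 y; rewrite ltnS leq_eqVlt => /orP [/eqP -> xs sx xN|].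
    by have := H2 xs sx xN; rewrite dc_pcons.
  exact: H1.
Qed.

Lemma sound_term : allsound 15.
Proof.
repeat (apply: List.Forall_cons); rewrite /clause_sound /=; last by constructor.
- by move=> env; exists (LA (nth 0 env 0)).
- by move=> env; exists (LX (nth 0 env 0)).
- by exists L0.
- by move=> env [t ->] [u ->]; exists (LAdd t u).
- by move=> env /rk_surj [c ->] [u ->]; exists (LScale c u).
- by move=> env [t ->] [u ->]; exists (LBr t u).
Qed.

Lemma leval_lsubst (L : lieAlgebra k) (va : nat -> L) b f :
  leval va (fun j => leval va (fun=> 0%R) (nth L0 b j)) f =
  leval va (fun=> 0%R) (lsubst (@LA k) (nth L0 b) f).
Proof.
have -> : (fun j => leval va (fun=> 0%R) (nth L0 b j)) =
    @seval k (lie_struct L) va (fun=> 0%R) \o nth L0 b.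
  by apply/funext => j /=; rewrite seval_lie.
by rewrite -[RHS]seval_lie seval_lsubst -seval_lie.
Qed.

Lemma sound_solvable : allsound 1.
Proof.
repeat (apply: List.Forall_cons); rewrite /clause_sound /=; last by constructor.
move=> env H1 [b [e1 e2 wb]] H3 n S.
rewrite encode_systemE => /pcons_coI [e3 /pcons_coI [e4 _]] wS.
exists b; split; [by rewrite -e3 e2 | by [] |] => f fS L mL va.
by rewrite leval_lsubst (H3 S b (H1 S e4) e1 f fS).
Qed.

Lemma sound_unsolvable : allsound 2.
Proof.
repeat (apply: List.Forall_cons); rewrite /clause_sound /=; last by constructor.
move=> env H1 H2 H3 H4 n S.
rewrite encode_systemE => /pcons_coI [e3 /pcons_coI [e4 _]] wS.
set D := pcons (nth 0 env 10) _ in H3 H4.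
apply: (@finmod_unsolvable k r D) wS _.
- by rewrite /compD dc_pcons.
- by move=> xs sx xN; have := H3 xs sx xN; rewrite cats0.
- move=> xs sx xN; rewrite -(H1 S e4).
  by have := H4 xs; rewrite cats0; apply; rewrite // sx e3.
Qed.

Lemma program_sound a : derives (program k r) a -> meaning k r a.
Proof.
apply: derives_sound.
have H g : List.Forall sound (nth [::] (groups k r) g).
  case: g => [|g]; first by constructor.
  case: g => [|g]; first exact: sound_solvable.
  case: g => [|g]; first exact: sound_unsolvable.
  case: g => [|g]; first exact: sound_parse.
  case: g => [|g]; first exact: sound_parses.
  case: g => [|g]; first exact: sound_nth.
  case: g => [|g]; first exact: sound_subst.
  case: g => [|g]; first exact: sound_closed.
  case: g => [|g]; first exact: sound_closeds.
  case: g => [|g]; first exact: sound_eq.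
  case: g => [|g]; first exact: sound_solved.
  case: g => [|g]; first exact: sound_eval.
  case: g => [|g]; first exact: sound_less.
  case: g => [|g]; first exact: sound_loop.
  case: g => [|g]; first exact: sound_loop_lt.
  case: g => [|g]; first exact: sound_term.
  by rewrite /= nth_nil; constructor.
rewrite /program; elim: (groups k r) H => [|g gs IH] H; first by constructor.
by apply/Forall_cat; split; [apply: (H 0) | apply: IH => i; apply: (H i.+1)].
Qed.

End Soundness.

(** * Completeness of the clauses *)

Section Completeness.
Variables (k : finFieldType) (r : nat).
Local Notation pr := (program k r).
Local Notation gr := (groups k r).

Definition body_ok (env : seq nat) (b : seq atom) : Prop :=
  foldr (fun a (Q : Prop) => derives pr (map (peva env) a) /\ Q) True b.

Lemma use_clause g i env a : i < size (nth [::] gr g) ->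
  map (peva env) (nth ([::], [::]) (nth [::] gr g) i).1 = a ->
  body_ok env (nth ([::], [::]) (nth [::] gr g) i).2 -> derives pr a.
Proof.
move=> isz <- H; apply: Derives.
  have Hg : List.In (nth [::] gr g) gr.
    apply: In_nth; rewrite ltnNge; apply: contraTN isz => sg.
    by rewrite nth_default.
  have Hc := In_nth ([::], [::]) isz; rewrite /program.
  elim: gr (nth [::] gr g) Hg Hc => //= g' gs IH G [->|/IH H'] Hc; apply/In_cat.
    by left.
  by right; apply: H'.
move: H; rewrite /body_ok; elim: (_.2) => //= b bs IH [H1 /IH H2] b' [<-|] //.
exact: H2.
Qed.

Lemma derives_nth l j : j < size l -> derives pr [:: 5; co l; j; nth 0 l j].
Proof.
elim: l j => [//|x l IH] [|j] /= jl.
  by apply: (@use_clause 5 0 [:: x; co l]).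
apply: (@use_clause 5 1 [:: x; co l; j; nth 0 l j]) => //.
by split=> //; apply: IH.
Qed.

Lemma derives_less i j : i < j -> derives pr [:: 12; i; j].
Proof.
elim: i j => [|i IH] [|j] // ij; first by apply: (@use_clause 12 0 [:: j]).
by apply: (@use_clause 12 1 [:: i; j]) => //; split=> //; apply: IH.
Qed.

Lemma derives_parse (t : lterm k) s :
  derives pr [:: 3; co (toks t ++ s); tcode t; co s].
Proof.
elim: t s => [i|j||t IHt u IHu|c t IHt|t IHt u IHu] s.
- by apply: (@use_clause 3 0 [:: i; co s]).
- by apply: (@use_clause 3 1 [:: j; co s]).
- by apply: (@use_clause 3 2 [:: 0; co s]).
- rewrite /= -!catA.
  apply: (@use_clause 3 3 [:: co (toks t ++ toks u ++ tokl 0 :: s);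
    tcode t; tcode u; co (toks u ++ tokl 0 :: s); co s]) => //.
  by split; [apply: IHt | split=> //; apply: (IHu (tokl 0 :: s))].
- rewrite /= -!catA.
  apply: (@use_clause 3 4 [:: co (toks t ++ tokl 0 :: s);
    tcode t; 0; 0; co s; rk c]) => //.
  by split=> //; apply: (IHt (tokl 0 :: s)).
- rewrite /= -!catA.
  apply: (@use_clause 3 5 [:: co (toks t ++ toks u ++ tokl 0 :: s);
    tcode t; tcode u; co (toks u ++ tokl 0 :: s); co s]) => //.
  by split; [apply: IHt | split=> //; apply: (IHu (tokl 0 :: s))].
Qed.

Lemma derives_parses (S : seq (lterm k)) :
  derives pr [:: 4; co [seq co (toks t) | t <- S]; co (map (@tcode k) S)].
Proof.
elim: S => [|t S IH]; first by apply: (@use_clause 4 0 [::]).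
apply: (@use_clause 4 1 [:: co (toks t); co [seq co (toks t) | t <- S];
  tcode t; co (map (@tcode k) S)]) => //.
by split=> //; have := derives_parse t [::]; rewrite cats0.
Qed.

Lemma derives_subst (b : seq (lterm k)) t : lwf r (size b) t ->
  derives pr [:: 6; co (map (@tcode k) b); tcode t;
                 tcode (lsubst (@LA k) (nth L0 b) t)].
Proof.
set B := co _.
elim: t => [i|j||t IHt u IHu|c t IHt|t IHt u IHu] /=.
- by move=> _; apply: (@use_clause 6 0 [:: B; i]).
- move=> jb; set x := tcode _.
  apply: (@use_clause 6 1 [:: B; j; x]) => //; split=> //.
  have -> : x = nth 0 (map (@tcode k) b) j by rewrite (nth_map L0).
  by apply: derives_nth; rewrite size_map.
- by move=> _; apply: (@use_clause 6 2 [:: B]).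
- move=> /andP [/IHt H1 /IHu H2].
  by apply: (@use_clause 6 3 [:: B; tcode t; tcode u;
    tcode (lsubst (@LA k) (nth L0 b) t); tcode (lsubst (@LA k) (nth L0 b) u)]).
- move=> /IHt H1.
  by apply: (@use_clause 6 4 [:: B; rk c; tcode t;
    tcode (lsubst (@LA k) (nth L0 b) t)]).
- move=> /andP [/IHt H1 /IHu H2].
  by apply: (@use_clause 6 5 [:: B; tcode t; tcode u;
    tcode (lsubst (@LA k) (nth L0 b) t); tcode (lsubst (@LA k) (nth L0 b) u)]).
Qed.

Lemma derives_closed (t : lterm k) : lwf r 0 t -> derives pr [:: 7; tcode t].
Proof.
elim: t => [i|j||t IHt u IHu|c t IHt|t IHt u IHu] //=.
- move=> ir; apply: (@use_clause 7 0 [:: i]) => //.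
  by split=> //; apply: derives_less.
- by move=> _; apply: (@use_clause 7 1 [::]).
- by move=> /andP [/IHt H1 /IHu H2]; apply: (@use_clause 7 2 [:: tcode t;
  tcode u]).
- move=> /IHt H1; apply: (@use_clause 7 3 [:: rk c; tcode t]) => //.
  by split=> //; apply: derives_less (rk_lt c).
- by move=> /andP [/IHt H1 /IHu H2]; apply: (@use_clause 7 4 [:: tcode t;
  tcode u]).
Qed.

Lemma derives_closeds (b : seq (lterm k)) : all (lwf r 0) b ->
  derives pr [:: 8; co (map (@tcode k) b); size b].
Proof.
elim: b => [|t b IH] /=; first by move=> _; apply: (@use_clause 8 0 [::]).
move=> /andP [/derives_closed H1 /IH H2].
by apply: (@use_clause 8 1 [:: tcode t; co (map (@tcode k) b); size b]).
Qed.

Lemma derives_term (t : lterm k) : derives pr [:: 15; tcode t].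
Proof.
elim: t => [i|j||t IHt u IHu|c t IHt|t IHt u IHu] /=.
- by apply: (@use_clause 15 0 [:: i]).
- by apply: (@use_clause 15 1 [:: j]).
- by apply: (@use_clause 15 2 [::]).
- by apply: (@use_clause 15 3 [:: tcode t; tcode u]).
- apply: (@use_clause 15 4 [:: rk c; tcode t]) => //.
  by split=> //; apply: derives_less (rk_lt c).
- by apply: (@use_clause 15 5 [:: tcode t; tcode u]).
Qed.

(** The axioms contain no generators, so the clauses, which instantiate unknowns only, cover every
    instance allowed by [deq_ax]. *)
Lemma lwf_subst_eq (t : lterm k) sa sx n : lwf 0 n t ->
  lsubst sa sx t = lsubst (@LA k) sx t.
Proof. by move=> w; exact:
  (@seval_eq k (term_struct k) 0 n sa (@LA k) sx sx t w). Qed.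

Lemma derives_eq (t u : lterm k) : deq t u -> derives pr [:: 9; tcode t;
  tcode u].
Proof.
elim=> {t u} [t|t u _ H|t u w _ H1 _ H2|t t' u u' _ H1 _ H2|c t t' _ H
  |t t' u u' _ H1 _ H2|e sa sx He].
- apply: (@use_clause 9 0 [:: tcode t]) => //; split=> //; exact: derives_term.
- by apply: (@use_clause 9 1 [:: tcode u; tcode t]).
- by apply: (@use_clause 9 2 [:: tcode t; tcode u; tcode w]).
- by apply: (@use_clause 9 3 [:: tcode t; tcode u; tcode t'; tcode u']).
- apply: (@use_clause 9 4 [:: rk c; tcode t; tcode t']) => //.
  by split=> //; apply: derives_less (rk_lt c).
- by apply: (@use_clause 9 5 [:: tcode t; tcode u; tcode t'; tcode u']).
have /List.Forall_forall/(_ e He)/andP[w1 w2] := lie_axioms_wf k.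
have [i il ei] := nth_In (L0, L0) He.
pose env := [seq tcode (sx j) | j <- iota 0 4].
have H j : j < 4 -> nth 0 env j = tcode (sx j) by case: j => [|[|[|[|]]]].
pose cl (e : lterm k * lterm k) : clause := ([:: PC 9; tpat e.1; tpat e.2],
  [:: [:: PC 15; PV 0]; [:: PC 15; PV 1]; [:: PC 15; PV 2]; [:: PC 15; PV 3]]).
have E : nth ([::], [::]) (nth [::] gr 9) (6 + i) = cl e.
  by rewrite -[LHS]/(nth ([::], [::]) (map cl (lie_axioms k)) i)
    (nth_map (L0, L0)) ?ei.
apply: (@use_clause 9 (6 + i) env).
- by rewrite -[size _]/(6 + size (map cl (lie_axioms k))) size_map ltn_add2l.
- by rewrite E /= (tpatE w1 H) (tpatE w2 H) (lwf_subst_eq _ _ w1)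
    (lwf_subst_eq _ _ w2).
by rewrite E; do !split=> //; apply: derives_term.
Qed.

Lemma derives_solved (S b : seq (lterm k)) : all (lwf r (size b)) S ->
  (forall f, List.In f S -> deq (lsubst (@LA k) (nth L0 b) f) L0) ->
  derives pr [:: 10; co (map (@tcode k) S); co (map (@tcode k) b)].
Proof.
set B := co (map _ b).
elim: S => [|f S IH] /= wS H; first by apply: (@use_clause 10 0 [:: B]).
have /andP [wf /IH {}IH] := wS.
apply: (@use_clause 10 1 [:: tcode f; co (map (@tcode k) S); B;
  tcode (lsubst (@LA k) (nth L0 b) f)]) => //.
split; first exact: derives_subst.
split; first by apply: (@derives_eq _ L0); apply: H; left.
by split=> //; apply: IH => f' Hf'; apply: H; right.
Qed.

Lemma lwf_lsubst n (b : seq (lterm k)) f : size b = n -> all (lwf r 0) b ->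
  lwf r n f -> lwf r 0 (lsubst (@LA k) (nth L0 b) f).
Proof.
rewrite /lsubst => sb /allIn wb.
elim: f => //= [j|t IHt u IHu /andP [/IHt -> /IHu ->]
  |t IHt u IHu /andP [/IHt -> /IHu ->]] //.
by move=> jn; apply: wb; apply: In_nth; rewrite sb.
Qed.

Lemma solvable_derives n (S : seq (lterm k)) : all (lwf r n) S ->
  solvable r n S -> derives pr [:: 1; encode_system n S].
Proof.
move=> wS [b [sb wb Hb]]; rewrite encode_systemE.
apply: (@use_clause 1 0 [:: n; co [seq co (toks t) | t <- S];
  co (map (@tcode k) S); co (map (@tcode k) b)]) => //.
split; first exact: derives_parses.
split; first by rewrite -sb; apply: derives_closeds.
split=> //; apply: derives_solved; first by rewrite sb.
(* [valid_deq] also quantifies over values of unknowns; [vx] is immaterial because the substituted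
   equation is closed. *)
move=> f fS; apply: valid_deq => L mL va vx.
have wf : lwf r n f by move/allIn: wS => /(_ f fS).
rewrite /= -[RHS](Hb f fS L mL va) leval_lsubst -!seval_lie.
have w := lwf_lsubst sb wb wf.
by apply: (@seval_eq k (lie_struct L) r 0 va va vx (fun=> 0%R) _ w).
Qed.

Section FiniteStructure.
Variables (F : finType) (f0 : F) (fadd : F -> F -> F) (fsc : k -> F -> F).
Variables (fbr : F -> F -> F).
Let M : lstruct k := @LStruct k F f0 fadd fsc fbr.
Hypothesis M_laws : metab_laws M.
Variable va : nat -> M.

Let rF (x : F) : nat := enum_rank x.
Let N := #|F|.
Let gens := co [seq rF (va i) | i <- iota 0 r].
Let table (T : finType) (op : T -> F -> F) :=
  co [seq co [seq rF (op x y) | y <- enum F] | x <- enum T].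
Let D := co [:: N; rF f0; gens; table fadd; table fsc; table fbr].
Let denv := [:: N; rF f0; gens; table fadd; table fsc; table fbr].

Lemma derives_enum (T : finType) (g : T -> nat) x :
  derives pr [:: 5; co [seq g x | x <- enum T]; nat_of_ord (enum_rank x); g x].
Proof.
have -> : g x = nth 0 [seq g x | x <- enum T] (enum_rank x).
  by rewrite (nth_map x) ?nth_enum_rank // -cardE.
by apply: derives_nth; rewrite size_map -cardE.
Qed.

Lemma derives_eval (xs : seq F) t : lwf r (size xs) t ->
  derives pr [:: 11; D; co (map rF xs); tcode t;
                 rF (seval va (nth f0 xs) t)].
Proof.
set e := co (map rF xs).
(* The local variables are padded to ten entries so that the algebra occupies the variables 10 to
   15. *)
pose E (s : seq nat) := take 10 (s ++ nseq 10 0) ++ denv.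
elim: t => [i|j||t IHt u IHu|c t IHt|t IHt u IHu] /=.
- move=> ir; apply: (@use_clause 11 0 (E [:: e; i; rF (va i)])) => //.
  split=> //=; have -> : rF (va i) = nth 0 [seq rF (va i) | i <- iota 0 r] i.
    by rewrite (nth_map 0) ?size_iota // nth_iota.
  by apply: derives_nth; rewrite size_map size_iota.
- move=> jx; apply: (@use_clause 11 1 (E [:: e; j; rF (nth f0 xs j)])) => //.
  by split=> //=; rewrite -(nth_map _ 0) //; apply: derives_nth;
    rewrite size_map.
- by move=> _; apply: (@use_clause 11 2 (E [:: e])).
- move=> /andP [/IHt H1 /IHu H2]; set x := seval va _ t; set y := seval va _ u.
  apply: (@use_clause 11 3 (E [:: e; tcode t; tcode u; rF (fadd x y);
    rF x; rF y; co [seq rF (fadd x y) | y <- enum F]])) => //.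
  do 2!split=> //; split; last by split=> //; exact: derives_enum.
  exact: (derives_enum (fun x => co [seq rF (fadd x y) | y <- enum F])).
- move=> /IHt H2; set y := seval va _ t.
  apply: (@use_clause 11 4 (E [:: e; rk c; tcode t; rF (fsc c y);
    0; rF y; co [seq rF (fsc c y) | y <- enum F]])) => //.
  split=> //; split; last by split=> //; exact: derives_enum.
  exact: (derives_enum (fun c => co [seq rF (fsc c y) | y <- enum F])).
- move=> /andP [/IHt H1 /IHu H2]; set x := seval va _ t; set y := seval va _ u.
  apply: (@use_clause 11 5 (E [:: e; tcode t; tcode u; rF (fbr x y);
    rF x; rF y; co [seq rF (fbr x y) | y <- enum F]])) => //.
  do 2!split=> //; split; last by split=> //; exact: derives_enum.
  exact: (derives_enum (fun x => co [seq rF (fbr x y) | y <- enum F])).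
Qed.

Lemma derives_loop mode s m env :
  (forall xs : seq F, size xs = m ->
     derives pr [:: 13; mode; D; s; co (map rF xs ++ env); 0]) ->
  derives pr [:: 13; mode; D; s; co env; m].
Proof.
elim: m env => [|m IH] env H; first by apply: (H [::]).
pose E (l : seq nat) := take 10 (l ++ nseq 10 0) ++ denv.
apply: (@use_clause 13 3 (E [:: mode; s; co env; m])) => //; split=> //=.
suff : forall y, y <= N -> derives pr [:: 14; mode; D; s; co env; m; y].
  exact.
elim=> [|y IHy] yN; first by apply: (@use_clause 14 0 (E [:: mode; s; co env;
  m])).
apply: (@use_clause 14 1 (E [:: mode; s; co env; m; y])) => //.
split; first by apply: IHy; apply: ltnW.
split=> //; apply: (IH (y :: env)) => xs sx.
have := H (rcons xs (enum_val (Ordinal yN))).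
by rewrite size_rcons sx map_rcons /rF enum_valK cat_rcons; apply.
Qed.

Lemma obligations_wf :
  List.Forall (fun e => lwf r 4 e.1 && lwf r 4 e.2) (obligations k r).
Proof.
rewrite /obligations; apply/Forall_cat; split.
  have wr (t : lterm k) : lwf 0 4 t -> lwf r 4 t.
    by elim: t => //= [t IHt u IHu /andP [/IHt -> /IHu]
      |t IHt u IHu /andP [/IHt -> /IHu]].
  apply: List.Forall_impl (lie_axioms_wf k) => e /andP [w1 w2].
  by rewrite !wr.
apply/Forall_cat; split; first by repeat constructor.
apply/Forall_cat; split; apply/Forall_map_enum => //= i.
by rewrite ltn_ord.
Qed.

Lemma obligations_models : List.Forall (fun e => forall vx : nat -> M,
  seval va vx e.1 = seval va vx e.2) (obligations k r).
Proof.
rewrite /obligations; apply/Forall_cat; split.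
  have /modelsP := M_laws.
  by apply: List.Forall_impl => e H vx; apply: H.
apply/Forall_cat; split; first by repeat constructor.
by apply/Forall_cat; split; apply/Forall_map_enum.
Qed.

Lemma derives_obligations s (xs : seq F) : size xs = 4 ->
  derives pr [:: 13; 0; D; s; co (map rF xs); 0].
Proof.
(* The layout that the clause imposes: the algebra at 10 to 15, the values of the obligations from
   20 on, zeros in the gaps. *)
move=> sx; pose E := [:: s; co (map rF xs)] ++ nseq 8 0 ++ denv ++ nseq 4 0 ++
   [seq rF (seval va (nth f0 xs) e.1) | e <- obligations k r].
apply: (@use_clause 13 0 E) => //.
have : forall j, j < size (obligations k r) -> nth 0 E (20 + j) =
    rF (seval va (nth f0 xs) (nth (L0, L0) (obligations k r) j).1).
  move=> j jl; rewrite -[RHS](nth_map _ 0 (fun e => rF (seval va (nth f0 xs)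
    e.1))) //.
have := obligations_models; have := obligations_wf.
rewrite -[(nth _ _ _).2]/(obl_atoms 20 (obligations k r)).
elim: (obligations k r) 20 => [|e l IH] i // /List.Forall_cons_iff [/andP [w1
  w2] wl].
move=> /List.Forall_cons_iff [me ml] H.
have Ei : nth 0 E i = rF (seval va (nth f0 xs) e.1) by rewrite -[i]addn0 H.
split; first by rewrite /= Ei; apply: derives_eval; rewrite sx.
split; first by rewrite /= Ei me; apply: derives_eval; rewrite sx.
split; first by rewrite /= Ei; apply: derives_less (ltn_ord _).
by apply: IH => // j jl; rewrite addSnnS H.
Qed.

Lemma derives_unsolvable n (S : seq (lterm k)) : all (lwf r n) S ->
  (forall vx : nat -> M, exists2 f, List.In f S & seval va vx f <> f0) ->
  derives pr [:: 2; encode_system n S].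
Proof.
move=> wS H; rewrite encode_systemE.
pose E (l : seq nat) := take 10 (l ++ nseq 10 0) ++ denv.
set s := co (map (@tcode k) S).
apply: (@use_clause 2 0 (E [:: n; co [seq co (toks t) | t <- S]; s])) => //.
split; first exact: derives_parses.
split; first by apply: derives_less; apply/card_gt0P; exists f0.
split.
  by apply: (@derives_loop 0 s 4 [::]) => xs sx; rewrite cats0;
    apply: derives_obligations.
split=> //; apply: (@derives_loop 1 s n [::]) => xs sx; rewrite cats0.
have [f fS nz] := H (nth f0 xs).
have wf : lwf r n f by move/allIn: wS => /(_ f fS).
have [i iS ei] := nth_In L0 fS.
pose x := rF (seval va (nth f0 xs) f).
have D1 : derives pr [:: 5; s; i; tcode f].
  rewrite -ei -(nth_map _ 0) //; apply: derives_nth; by rewrite size_map.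
have D2 : derives pr [:: 11; D; co (map rF xs); tcode f; x].
  by apply: derives_eval; rewrite sx.
have /eqP : x <> rF f0 by move=> /ord_inj /enum_rank_inj.
rewrite neq_ltn => /orP [/derives_less D3|/derives_less D3].
  by apply: (@use_clause 13 1 (E [:: s; co (map rF xs); i; tcode f; x])).
by apply: (@use_clause 13 2 (E [:: s; co (map rF xs); i; tcode f; x])).
Qed.

End FiniteStructure.
End Completeness.

(** * Linear systems over polynomial rings *)

Section LinearSystems.
Import GRing.Theory.
Local Open Scope ring_scope.

HB.instance Definition _ (A : finComNzRingType) (h : {poly A}) :=
  Finite.on {poly %/ h}.

(** Finite index types, because later systems are indexed by products and sums of such types. *)
Definition solvable_sys (R : comNzRingType) (I J : finType) (A : J -> I -> R)
    (c : I -> R) : Prop :=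
  exists y : J -> R, forall i, \sum_j y j * A j i = c i.

Lemma frac_numden (R : idomainType) (x : {fraction R}) :
  exists n d : R, d != 0 /\ FracField.tofrac d * x = FracField.tofrac n.
Proof.
elim/quotW: x => f; exists (frac f).1, (frac f).2.
split; first exact: denom_ratioP.
rewrite !piE; apply/eqP; rewrite piE /= FracField.equivfE.
by rewrite !numden_Ratio ?(oner_eq0, mulf_neq0, denom_ratioP, mul1r,
  mulr1) // mulrC.
Qed.

Lemma common_denominator (R : idomainType) (s : seq {fraction R}) :
  exists2 d : R, d != 0 & forall x, x \in s ->
    exists n, FracField.tofrac d * x = FracField.tofrac n.
Proof.
elim: s => [|x s [d d0 IH]]; first by exists 1; rewrite ?oner_eq0.
have [n [e [e0 He]]] := frac_numden x; exists (d * e);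
  first by rewrite mulf_neq0.
move=> y; rewrite in_cons => /orP [/eqP ->|/IH [m Hm]].
  by exists (d * n); rewrite !rmorphM /= -mulrA He.
by exists (e * m); rewrite mulrC !rmorphM /= mulrA [y * _]mulrC Hm mulrC.
Qed.

Lemma scaled_inverse (R : idomainType) n m (A : 'M[R]_(n, m)) :
  exists (B : 'M[R]_(m, n)) (d : R), d != 0 /\ A *m B *m A = d *: A.
Proof.
pose F := @FracField.tofrac R; pose P := pinvmx (map_mx F A).
have [d d0 Hd] := common_denominator [seq P ij.1 ij.2 | ij <- enum {:
  'I_m * 'I_n}].
have [B HB] : exists B : 'M[R]_(m, n), map_mx F B = F d *: P.
  have /choice [b Hb] (ij : 'I_m * 'I_n) : exists x, F d * P ij.1 ij.2 = F x.
    by apply: Hd; apply/mapP; exists ij; rewrite ?mem_enum.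
  exists (\matrix_(i, j) b (i, j)); apply/matrixP => i j.
  by rewrite [LHS]mxE [RHS]mxE mxE -(Hb (i, j)).
exists B, d; split=> //.
apply/matrixP => i j; apply/eqP; rewrite -tofrac_eq; apply/eqP.
have : map_mx F (A *m B *m A) = map_mx F (d *: A).
  rewrite !map_mxM HB map_mxZ -scalemxAr -scalemxAl /P mulmxKpV //.
by move=> /matrixP /(_ i j); rewrite !mxE.
Qed.

(** [d (y A) = y A B A = (c + d z) B A = d c + d (z B A)], so [d] times [(y - z B) A] is [d c], and
    [d] cancels. *)
Lemma solve_of_mod (R : idomainType) n m (A : 'M[R]_(n, m)) (B : 'M[R]_(m, n))
    (d : R) (c z : 'rV[R]_m) (y : 'rV[R]_n) :
  d != 0 -> A *m B *m A = d *: A -> c *m B *m A = d *: c ->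
  y *m A = c + d *: z -> exists y', y' *m A = c.
Proof.
move=> d0 HA Hc Hy; exists (y - z *m B); rewrite mulmxBl.
have inj (u v : 'rV[R]_m) : d *: u = d *: v -> u = v.
  move=> /rowP e; apply/rowP => i; move: (e i); rewrite !mxE.
  exact: mulfI.
apply: inj; have : y *m (A *m B *m A) = (c + d *: z) *m B *m A.
  by rewrite !mulmxA Hy.
rewrite HA -scalemxAr !mulmxDl Hc -!scalemxAl scalerBr => ->.
by rewrite addrK.
Qed.

(** A necessary condition for solvability whose ingredients are carried along by ring morphisms: if
    it fails in a finite quotient, the system is refuted there. *)
Lemma solve_compat (R : comNzRingType) n m (A : 'M[R]_(n, m))
    (B : 'M[R]_(m, n)) (d : R) (c : 'rV[R]_m) (y : 'rV[R]_n) :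
  A *m B *m A = d *: A -> y *m A = c -> c *m B *m A = d *: c.
Proof. by move=> HA <-; rewrite -!mulmxA [A *m _]mulmxA HA scalemxAr. Qed.

Definition sysmx (R : comNzRingType) (I J : finType) (A : J -> I -> R) :=
  \matrix_(a < #|J|, b < #|I|) A (enum_val a) (enum_val b).
Definition sysrow (R : comNzRingType) (I : finType) (c : I -> R) :=
  \row_(b < #|I|) c (enum_val b).

Lemma sysrowM (R : comNzRingType) (I J : finType) (A : J -> I -> R) y i :
  (sysrow y *m sysmx A) 0 (enum_rank i) = \sum_j y j * A j i.
Proof.
rewrite mxE (reindex_onto (@enum_rank J) (@enum_val J predT)) /=; last first.
  by move=> j _; rewrite enum_valK.
apply: eq_big => [j|j _]; first by rewrite enum_rankK eqxx.
by rewrite !mxE !enum_rankK.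
Qed.

Lemma rowP_rank (R : comNzRingType) (I : finType) (u v : 'rV[R]_#|I|) :
  (forall i, u 0 (enum_rank i) = v 0 (enum_rank i)) -> u = v.
Proof. by move=> e; apply/rowP => b; rewrite -(enum_valK b). Qed.

Lemma solvable_sysP (R : comNzRingType) (I J : finType) (A : J -> I -> R) c :
  solvable_sys A c <-> exists y, y *m sysmx A = sysrow c.
Proof.
split=> [[y Hy]|[y Hy]].
  exists (sysrow y); apply: rowP_rank => i.
  by rewrite sysrowM Hy !mxE enum_rankK.
exists (fun j => y 0 (enum_rank j)) => i; rewrite -sysrowM.
have -> : sysrow (fun j => y 0 (enum_rank j)) = y.
  by apply/rowP => b; rewrite mxE enum_valK.
by rewrite Hy mxE enum_rankK.
Qed.

Lemma solvable_sys_morph (R S : comNzRingType) (f : {rmorphism R -> S})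
    (I J : finType) (A : J -> I -> R) c :
  solvable_sys A c -> solvable_sys (fun j i => f (A j i)) (fun i => f (c i)).
Proof.
move=> [y Hy]; exists (fun j => f (y j)) => i; rewrite -Hy rmorph_sum.
by apply: eq_bigr => j _; rewrite rmorphM.
Qed.

Lemma map_sysmx (R S : comNzRingType) (f : {rmorphism R -> S})
    (I J : finType) (A : J -> I -> R) :
  map_mx f (sysmx A) = sysmx (fun j i => f (A j i)).
Proof. by apply/matrixP => i j; rewrite !mxE. Qed.

Lemma map_sysrow (R S : comNzRingType) (f : {rmorphism R -> S})
    (I : finType) (c : I -> R) :
  map_mx f (sysrow c) = sysrow (fun i => f (c i)).
Proof. by apply/matrixP => i j; rewrite !mxE. Qed.

Definition finitely_refutable (R : comNzRingType) : Prop :=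
  forall (I J : finType) (A : J -> I -> R) (c : I -> R), ~ solvable_sys A c ->
  exists (Q : finComNzRingType) (f : {rmorphism R -> Q}),
    ~ solvable_sys (fun j i => f (A j i)) (fun i => f (c i)).

Definition residually_finite (R : comNzRingType) : Prop :=
  forall h : R, h != 0 ->
  exists (Q : finComNzRingType) (f : {rmorphism R -> Q}), f h != 0.

Lemma unsolvable_mod (R : idomainType) (I J : finType) (A : J -> I -> R) c :
  residually_finite R -> ~ solvable_sys A c ->
  (exists (Q : finComNzRingType) (f : {rmorphism R -> Q}),
    ~ solvable_sys (fun j i => f (A j i)) (fun i => f (c i))) \/
  exists2 d : R, d != 0 & ~ exists (y : J -> R) (z : I -> R), forall i,
    \sum_j y j * A j i = c i + d * z i.
Proof.
move=> RF U.
have [B [d [d0 HA]]] := scaled_inverse (sysmx A).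
have [Hc|Hc] := eqVneq (sysrow c *m B *m sysmx A) (d *: sysrow c); [right|left].
  exists d => // -[y [z H]]; apply: U; apply/solvable_sysP.
  apply: (@solve_of_mod _ _ _ _ B d _ (sysrow z) (sysrow y)) => //.
  apply: rowP_rank => i; rewrite sysrowM H !mxE enum_rankK.
  by rewrite mulrC [z i * _]mulrC.
have [i Hi] : exists i, (sysrow c *m B *m sysmx A - d *: sysrow c) 0 i != 0.
  apply/existsP; apply: contraR Hc; rewrite negb_exists => /forallP H.
  by rewrite -subr_eq0; apply/eqP/rowP => i; rewrite [RHS]mxE; apply/eqP;
    rewrite -[_ == _]negbK.
have [Q [f Hf]] := RF _ Hi; exists Q, f => /solvable_sysP [y].
rewrite -map_sysmx -map_sysrow => Hy.
have HA' : map_mx f (sysmx A) *m map_mx f B *m map_mx f (sysmx A) =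
    f d *: map_mx f (sysmx A) by rewrite -!map_mxM HA map_mxZ.
have := solve_compat HA' Hy; rewrite -!map_mxM -map_mxZ => /rowP /(_ i) e.
move: Hf; rewrite !mxE rmorphB /= subr_eq0; move: e; rewrite !mxE => -> /eqP.
by [].
Qed.

End LinearSystems.

(** * Systems over the quotient by a monic polynomial *)

Section QuotientSystems.
Import GRing.Theory.
Local Open Scope ring_scope.

Lemma mk_monicE (S : comNzRingType) (D : {poly S}) :
  D \is monic -> (1 < size D)%N -> mk_monic D = D.
Proof. by rewrite /mk_monic => -> ->. Qed.

(** Remainders modulo a monic polynomial are unique, and a monic polynomial keeps its degree under
    [f]. *)
Lemma in_qpoly_map (S Q : comNzRingType) (f : {rmorphism S -> Q}) (D p :
  {poly S}) :
  D \is monic -> (1 < size D)%N ->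
  in_qpoly (map_poly f D) (map_poly f p) =
    map_poly f (in_qpoly D p) :> {poly Q}.
Proof.
move=> mD sD; have mD' : map_poly f D \is monic by apply: monic_map.
have sD' : size (map_poly f D) = size D.
  by apply: size_map_poly_id0; rewrite (monicP mD) rmorph1 oner_eq0.
rewrite /= !mk_monicE ?sD' //.
rewrite {1}(Pdiv.RingMonic.rdivp_eq mD p) rmorphD rmorphM /=.
rewrite Pdiv.RingMonic.rmodp_addl_mul_small // sD'.
apply: leq_ltn_trans (size_poly _ _) _.
by apply: Pdiv.Ring.ltn_rmodpN0; apply: monic_neq0.
Qed.

(* [{poly S} / D] is free over [S] on the powers of the variable. *)
Lemma qpoly_sys (S : comNzRingType) (D : {poly S}) e (I J : finType)
    (A : J -> I -> {poly S}) (c : I -> {poly S}) :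
  D \is monic -> size D = e.+2 ->
  solvable_sys
    (fun (jt : J * 'I_e.+1) (is' : I * 'I_e.+1) =>
       (in_qpoly D (A jt.1 is'.1 * 'X^(jt.2)) : {poly S})`_(is'.2))
    (fun is' => (in_qpoly D (c is'.1) : {poly S})`_(is'.2)) <->
  solvable_sys (fun j i => in_qpoly D (A j i)) (fun i => in_qpoly D (c i)).
Proof.
move=> mD sD; have MD : mk_monic D = D by rewrite mk_monicE ?sD.
pose lift (y : J * 'I_e.+1 -> S) j : {poly S} := \sum_t y (j, t) *: 'X^t.
have key (y : J * 'I_e.+1 -> S) i (s : 'I_e.+1) :
    \sum_(jt : J * 'I_e.+1) y jt * (in_qpoly D (A jt.1 i * 'X^(jt.2)) :
      {poly S})`_s =
    ((\sum_j in_qpoly D (lift y j) * in_qpoly D (A j i) : {poly %/ D})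
       : {poly S})`_s.
  transitivity (\sum_j \sum_(t < e.+1)
      y (j, t) * (in_qpoly D (A j i * 'X^t) : {poly S})`_s).
    by rewrite pair_bigA; apply: eq_bigr => -[j t].
  have -> : (\sum_j in_qpoly D (lift y j) * in_qpoly D (A j i) : {poly %/ D})
      = \sum_j \sum_t y (j, t) *: in_qpoly D (A j i * 'X^t).
    apply: eq_bigr => j _; rewrite -in_qpolyM /lift mulr_suml raddf_sum /=.
    by apply: eq_bigr => t _; rewrite -scalerAl in_qpolyZ [_ * A _ _]mulrC.
  rewrite poly_of_qpoly_sum coef_sum; apply: eq_bigr => j _.
  by rewrite poly_of_qpoly_sum coef_sum; apply: eq_bigr => t _; rewrite coefZ.
have sz (p : {poly %/ D}) : (size (p : {poly S}) <= e.+1)%N.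
  by rewrite -ltnS -sD -{2}MD size_mk_monic.
split=> [[y Hy]|[y Hy]].
  exists (fun j => in_qpoly D (lift y j)) => i; apply: val_inj;
    apply/polyP => s.
  have [es|se] := leqP e.+1 s;
    last by rewrite -(key y i (Ordinal se)) -(Hy (i, Ordinal se)).
  by rewrite !nth_default ?(leq_trans (sz _)).
pose y' (jt : J * 'I_e.+1) := (y jt.1 : {poly S})`_(jt.2).
exists y' => -[i s]; rewrite -[RHS]/((in_qpoly D (c i) : {poly S})`_s) -Hy key.
congr ((_ : {poly S})`_s); congr (val _); apply: eq_bigr => j _.
congr (_ * _); apply: val_inj.
have -> : lift y' j = y j :> {poly S}.
  rewrite /lift /y' /= -poly_def; apply/polyP => t; rewrite coef_poly ltnS.
  by case: leqP => // et; rewrite nth_default // (leq_trans (sz _)).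
exact: in_qpoly_small (size_mk_monic _).
Qed.

End QuotientSystems.

(** * Nagata's substitution *)

Section Nagata.
Import GRing.Theory.
Local Open Scope ring_scope.

(** Uniqueness of digits in base [e]. It separates the weights of distinct monomials whose exponents
    are below [e]. *)
Lemma base_digits_inj n e (a b : 'I_n -> nat) :
  (forall i, a i < e)%N -> (forall i, b i < e)%N ->
  (\sum_i a i * e ^ i = \sum_i b i * e ^ i)%N -> a =1 b.
Proof.
elim: n a b => [|n IH] a b Ha Hb; first by move=> _ [].
rewrite !big_ord_recl !expn0 !muln1.
have E (c : 'I_n.+1 -> nat) : (\sum_(i < n) c (lift ord0 i) * e ^ lift ord0 i =
    (\sum_(i < n) c (lift ord0 i) * e ^ i) * e)%N.
  rewrite big_distrl; apply: eq_bigr => i _.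
  by rewrite /= /bump add1n expnSr mulnA.
rewrite !E => H.
have e_gt0 : (0 < e)%N by apply: leq_ltn_trans (Ha ord0).
have e0 : a ord0 = b ord0.
  have := congr1 (modn^~ e) H.
  by rewrite ![(_ ord0 + _)%N]addnC !modnMDl !modn_small.
move: H; rewrite e0 => /addnI /eqP; rewrite eqn_pmul2r // => /eqP /IH H i.
case: (unliftP ord0 i) => [j ->|-> //].
by apply: (H _ _ j) => {j}j.
Qed.
Lemma seq_max (T : eqType) (W : T -> nat) x (s : seq T) :
  exists2 m, m \in x :: s & forall y, y \in x :: s -> (W y <= W m)%N.
Proof.
elim: s x => [|z s IH] x.
  by exists x; rewrite ?mem_head // => y; rewrite inE => /eqP ->.
have [m ms Hm] := IH z; have [le|lt] := leqP (W x) (W m).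
  exists m; first by rewrite in_cons ms orbT.
  by move=> y; rewrite in_cons => /orP [/eqP -> //|/Hm].
exists x; first by rewrite mem_head.
move=> y; rewrite in_cons => /orP [/eqP -> //|/Hm H].
exact: leq_trans H (ltnW lt).
Qed.
Variables (k : fieldType) (n e : nat).
Hypothesis e_gt0 : (0 < e)%N.
Local Notation S := {mpoly k[n]}.
Local Notation R := {mpoly k[n.+1]}.
(** The substitution of [X_i + X_0^(e^i)] for [X_i], [i > 0], with [X_0] as main variable and the
    others renumbered from 0. In all cases, [i = 0] included, the image is monic of degree [e^i]. *)
Definition nag_var (i : 'I_n.+1) : {poly S} :=
  if unlift ord0 i is Some j then 'X^(e ^ i) + ('X_j)%:P else 'X.
Definition nag : R -> {poly S} := mmap (polyC \o @mpolyC n k) nag_var.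
HB.instance Definition _ := GRing.RMorphism.on nag.
Definition nag_coef : S -> R := mmap (@mpolyC n.+1 k)
  (fun j => 'X_(lift ord0 j) - 'X_ord0 ^+ (e ^ lift ord0 j)).
HB.instance Definition _ := GRing.RMorphism.on nag_coef.
Definition nag_inv : {poly S} -> R :=
  horner_eval 'X_ord0 \o map_poly nag_coef.
HB.instance Definition _ := GRing.RMorphism.on nag_inv.
Lemma nag_invC c : nag_inv c%:P = nag_coef c.
Proof. by rewrite /nag_inv /= /horner_eval map_polyC hornerC. Qed.
Lemma nag_invX : nag_inv 'X = 'X_ord0.
Proof. by rewrite /nag_inv /= /horner_eval map_polyX hornerX. Qed.
Lemma nagK p : nag_inv (nag p) = p.
Proof.
rewrite [RHS]mpolyE /nag /mmap rmorph_sum; apply: eq_bigr => m _.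
rewrite rmorphM /= nag_invC /nag_coef mmapC -mul_mpolyC; congr (_ * _).
rewrite /mmap1 rmorph_prod [RHS]mpolyXE_id; apply: eq_bigr => i _.
rewrite rmorphXn /nag_var; congr (_ ^+ _).
case: unliftP => [j ->|->]; last exact: nag_invX.
rewrite rmorphD rmorphXn /= nag_invC nag_invX /nag_coef mmapX mmap1U.
by rewrite addrCA subrr addr0.
Qed.
Definition nag_weight (m : 'X_{1..n.+1}) := (\sum_i m i * e ^ i)%N.
Lemma nag_varP i : nag_var i \is monic /\ size (nag_var i) = (e ^ i).+1.
Proof.
rewrite /nag_var; case: unliftP => [j ->|->]; last first.
  by rewrite monicX size_polyX.
have lt : (size (('X_j : S)%:P) < size ('X^(e ^ lift ord0 j) : {poly S}))%N.
  by rewrite size_polyXn ltnS (leq_trans (size_polyC_leq1 _)) // expn_gt0 e_gt0.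
by rewrite monicE lead_coefDl // lead_coefXn eqxx size_polyDl // size_polyXn.
Qed.
Lemma nag_mon m : mmap1 nag_var m \is monic /\
  size (mmap1 nag_var m) = (nag_weight m).+1.
Proof.
rewrite /mmap1 /nag_weight.
pose K (p : {poly S}) w := p \is monic /\ size p = w.+1.
rewrite -/(K _ _); apply: (big_rec2 K) => [|i p w _ [mp sp]].
  by rewrite /K monic1 size_poly1.
have [mv sv] := nag_varP i.
have mX : nag_var i ^+ m i \is monic by apply: monic_exp.
split; first by rewrite monicMl.
rewrite size_monicM ?monic_neq0 // sp.
suff -> : size (nag_var i ^+ m i) = (m i * e ^ i).+1 by rewrite addSn /= addnS.
elim: (m i) => [|d IH]; first by rewrite expr0 size_poly1.
rewrite exprS size_monicM ?IH ?sv // ?monic_neq0 ?monic_exp //.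
by rewrite addSn /= addnS mulSn.
Qed.
(** By uniqueness of digits a single monomial of [p] attains the largest weight. Its image is monic,
    so the leading coefficient of [nag p] is a nonzero scalar, and [c] is the inverse of that
    scalar. *)
Lemma nag_monic (p : R) : p != 0 ->
  (forall m i, m \in msupp p -> m i < e)%N ->
  exists c : {poly S}, c * nag p \is monic.
Proof.
move=> p0 He.
have : msupp p != [::] by rewrite msupp_eq0.
case E : (msupp p) => [|m0 s] // _.
have [m ms Hm] := seq_max nag_weight m0 s; rewrite -E in ms Hm.
have lt y : y \in msupp p -> y != m -> (nag_weight y < nag_weight m)%N.
  move=> yp ym; rewrite ltn_neqAle Hm // andbT; apply: contra ym => /eqP H.
  by apply/eqP/mnmP; apply: (base_digits_inj _ _ H) => i; apply: He.
have [mm sm] := nag_mon m.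
pose lead : {poly S} := (p@_m)%:MP%:P * mmap1 nag_var m.
have pm : (p@_m)%:MP != 0 :> S by rewrite mpolyC_eq0 -mcoeff_msupp.
have sl : size lead = (nag_weight m).+1 by rewrite /lead mul_polyC size_scale.
have Hn : nag p = lead + \sum_(y <- msupp p | y != m)
    (p@_y)%:MP%:P * mmap1 nag_var y.
  by rewrite /nag /mmap (bigD1_seq m) //= msupp_uniq.
exists ((p@_m)^-1%:MP%:P); rewrite monicE Hn mulrDr lead_coefDl.
  rewrite /lead mulrA -!rmorphM /= mulVf ?rmorph1 ?mul1r; last first.
    by rewrite -mcoeff_msupp.
  exact: mm.
have lew (c : k) (y : {poly S}) : (size ((c%:MP%:P * y)%R : {poly S}) <=
  size y)%N.
  by rewrite mul_polyC size_scale_leq.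
rewrite /lead mulrA -!rmorphM /= mulVf -?mcoeff_msupp // !rmorph1 mul1r sm ltnS.
apply: leq_trans (lew _ _) _.
rewrite big_seq_cond; apply: leq_trans (size_sum _ _ _) _.
apply/bigmax_leqP_seq => y ys /andP [_ ym].
apply: leq_trans (lew _ _) _.
by have [_ ->] := nag_mon y; apply: lt.
Qed.
End Nagata.

(** * Finite quotients of polynomial rings *)

Section ResidualFiniteness.
Import GRing.Theory.
Local Open Scope ring_scope.
Lemma nagata (k : fieldType) n (p : {mpoly k[n.+1]}) : p != 0 ->
  exists (f : {rmorphism {mpoly k[n.+1]} -> {poly {mpoly k[n]}}})
    (g : {rmorphism {poly {mpoly k[n]}} -> {mpoly k[n.+1]}})
    (c : {poly {mpoly k[n]}}),
    (forall q, g (f q) = q) /\ c * f p \is monic.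
Proof.
(* [msize p] exceeds the total degree of every monomial of [p], hence every exponent. *)
move=> p0; pose e := msize p.
have e_gt0 : (0 < e)%N by rewrite lt0n msize_poly_eq0.
have [|c Hc] := nag_monic e_gt0 p0.
  move=> m i /msize_mdeg_lt; apply: leq_ltn_trans.
  by rewrite mdegE (bigD1 i) //= leq_addr.
exists (nag e), (nag_inv e), c; split=> //; exact: nagK.
Qed.
(** After Nagata's substitution a multiple of [h] is monic in the main variable, and setting the
    other variables to 0 leaves a monic [D0] over [k]. By degree [D0] is nonzero modulo ['X * D0],
    hence so is the image of [h]. *)
Lemma mpoly_residually_finite (k : finFieldType) n :
  residually_finite {mpoly k[n]}.
Proof.
case: n => [|n] h h0.
  exists k, (@mcoeff 0 k 0%MM).
  by apply: contra h0 => /eqP e; rewrite [h]nvar0_mpolyC e mpolyC0.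
have [f [g [c [_ mh]]]] := nagata h0.
pose f0 : {rmorphism {mpoly k[n]} -> k} := @mcoeff n k 0%MM.
pose D0 := map_poly f0 (c * f h).
have mD0 : D0 \is monic by apply: monic_map.
pose D := 'X * D0.
have mD : D \is monic by rewrite monicMl ?monicX.
have sD : size D = (size D0).+1.
  by rewrite /D mulrC size_mulX ?monic_neq0.
have sD1 : (1 < size D)%N by rewrite sD ltnS size_poly_gt0 monic_neq0.
exists {poly %/ D}, (in_qpoly D \o map_poly f0 \o f).
apply/eqP => /= e.
have : in_qpoly D D0 = 0.
  by rewrite /D0 rmorphM in_qpolyM e mulr0.
move=> /(congr1 val) /= /eqP; rewrite mk_monicE //.
rewrite Pdiv.Ring.rmodp_small ?sD //; apply/negP.
exact: monic_neq0.
Qed.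
Lemma in_qpoly_eq (S : comNzRingType) (D p q : {poly S}) :
  D \is monic -> (1 < size D)%N -> in_qpoly D p = in_qpoly D q ->
  exists z, p = q + D * z.
Proof.
move=> mD sD /(congr1 val) /=; rewrite mk_monicE // => E.
exists (Pdiv.Ring.rdivp p D - Pdiv.Ring.rdivp q D).
rewrite {1}(Pdiv.RingMonic.rdivp_eq mD p) {1}(Pdiv.RingMonic.rdivp_eq mD q) E.
by rewrite mulrBr ![D * _]mulrC [RHS]addrC addrA subrK.
Qed.

Lemma mpoly_finitely_refutable (k : finFieldType) n :
  finitely_refutable {mpoly k[n]}.
Proof.
elim: n => [|n IH] I J A c U.
  exists k, (@mcoeff 0 k 0%MM) => H; apply: U.
  have [y Hy] := solvable_sys_morph (@mpolyC 0 k) H.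
  exists y => i; rewrite [RHS]nvar0_mpolyC -Hy; apply: eq_bigr => j _.
  by rewrite {1}[A j i]nvar0_mpolyC.
have [//|[d d0 Hd]] := unsolvable_mod (@mpoly_residually_finite k n.+1) U.
have [f [g [u [gK md]]]] := nagata d0.
have [D0 mD0 eD0] : exists2 D0, D0 \is monic & D0 = u * f d by exists (u * f d).
(* The factor ['X] ensures size at least two, where [mk_monic] keeps [D] and [{poly %/ D}] is the
   quotient by [D]. A solution modulo this multiple of [f d] is also one modulo [f d]. *)
pose D := 'X * D0.
have mD : D \is monic by rewrite monicMl ?monicX.
have [e sD] : exists e, size D = e.+2.
  exists (size D0).-1; rewrite /D mulrC size_mulX ?monic_neq0 //.
  by rewrite prednK // size_poly_gt0 monic_neq0.
have sD1 : (1 < size D)%N by rewrite sD.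
pose A1 j i := f (A j i); pose c1 i := f (c i).
have U1 : ~ solvable_sys (fun j i => in_qpoly D (A1 j i))
              (fun i => in_qpoly D (c1 i)).
  move=> [y Hy]; apply: Hd.
  have [y' Hz] : exists y' : J -> {poly _}, forall i, exists z,
      \sum_j y' j * A1 j i = c1 i + D * z.
    exists (fun j => y j : {poly _}) => i; apply: in_qpoly_eq => //.
    rewrite -Hy rmorph_sum; apply: eq_bigr => j _.
    rewrite rmorphM; congr (_ * _); apply: val_inj.
    exact: in_qpoly_small (size_mk_monic _).
  have /choice [z {}Hz] := Hz; exists (g \o y').
  (* As [D] is ['X * (u * f d)], the map [g] sends multiples of [D] to multiples of [d]. *)
  exists (fun i => g ('X * u) * g (z i)) => i.
  have := congr1 g (Hz i); rewrite rmorph_sum rmorphD rmorphM /D eD0 /c1 /=.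
  rewrite gK !rmorphM /= gK => E; transitivity (\sum_j g (y' j * A1 j i)).
    by apply: eq_bigr => j _; rewrite rmorphM /A1 gK.
  by rewrite E; congr (_ + _); rewrite !mulrA; congr (_ * _);
    rewrite mulrC mulrA.
(* Expanding along the powers of the main variable gives a system in one variable less, to which the
   induction hypothesis applies. *)
have U2 := (fun H => U1 ((qpoly_sys A1 c1 mD sD).1 H)).
have [Q [h HQ]] := IH _ _ _ _ U2.
have mD' : map_poly h D \is monic by apply: monic_map.
have sD' : size (map_poly h D) = e.+2.
  by rewrite size_map_poly_id0 // (monicP mD) rmorph1 oner_eq0.
(* Coefficients are reduced by [h] before dividing by the image of [D]; since remainders commute
   with [h], the expanded system is the one already refuted over [Q]. *)
exists {poly %/ map_poly h D}, (in_qpoly (map_poly h D) \o map_poly h \o f).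
move=> /(qpoly_sys (fun j i => map_poly h (A1 j i)) (fun i => map_poly h (c1 i))
  mD' sD').2 [y Hy].
apply: HQ; exists y => i; have := Hy i.
rewrite in_qpoly_map // coef_map => <-; apply: eq_bigr => jt _.
by rewrite -(map_polyXn h) -rmorphM in_qpoly_map // coef_map.
Qed.
End ResidualFiniteness.

(** * The Magnus embedding *)

Section WreathStructure.
Import GRing.Theory.
Local Open Scope ring_scope.
Variables (k : fieldType) (r : nat) (Q : comNzRingType).
Variables (kap : {rmorphism k -> Q}) (X : 'I_r -> Q).

Definition ell (u : 'rV[k]_r) : Q := \sum_i kap (u 0 i) * X i.

Lemma ellD u v : ell (u + v) = ell u + ell v.
Proof.
rewrite /ell -big_split; apply: eq_bigr => i _.
by rewrite mxE rmorphD mulrDl.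
Qed.

Lemma ellZ c u : ell (c *: u) = kap c * ell u.
Proof.
rewrite /ell big_distrr; apply: eq_bigr => i _.
by rewrite mxE rmorphM /= mulrA.
Qed.

Lemma ell0 : ell 0 = 0.
Proof. by rewrite /ell big1 // => i _; rewrite mxE rmorph0 mul0r. Qed.

Lemma ell_delta i : ell (delta_mx 0 i) = X i.
Proof.
rewrite /ell (bigD1 i) //= mxE !eqxx rmorph1 mul1r big1 ?addr0 // => j ji.
by rewrite mxE eqxx (negbTE ji) rmorph0 mul0r.
Qed.

(** [Q] and the elements [X] are arbitrary so that the structure passes to quotients; [d] is [r] for
    the embedding itself and [r + n] for values affine in [n] unknown rows. *)
Definition wreath (d : nat) : lstruct k :=
  @LStruct k ('rV[k]_r * 'rV[Q]_d)%type (0, 0)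
    (fun x y => (x.1 + y.1, x.2 + y.2))
    (fun c x => (c *: x.1, kap c *: x.2))
    (fun x y => (0, ell x.1 *: y.2 - ell y.1 *: x.2)).

Lemma wreath_laws d : metab_laws (wreath d).
Proof.
split=> /=.
- by move=> x y z; rewrite !addrA.
- by move=> x y; rewrite [x.1 + _]addrC [x.2 + _]addrC.
- by move=> [u p]; rewrite !add0r.
- by move=> [u p]; rewrite rmorphN1 !scaleN1r !addNr.
- by move=> [u p]; rewrite rmorph1 !scale1r.
- move=> x y z; rewrite addr0 ellD; congr pair.
  by apply/rowP => i; rewrite !mxE; ring.
- move=> x y z; rewrite addr0 ellD; congr pair.
  by apply/rowP => i; rewrite !mxE; ring.
- by move=> x; rewrite subrr.
- move=> x y z; rewrite !addr0 !ell0; congr pair.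
  by apply/rowP => i; rewrite !mxE; ring.
- by move=> x y z w; rewrite !ell0 !scale0r subr0.
- by move=> c x y; rewrite !scalerDr.
- move=> c x z; rewrite ellZ scaler0; congr pair.
  by apply/rowP => i; rewrite !mxE; ring.
- move=> c x z; rewrite ellZ scaler0; congr pair.
  by apply/rowP => i; rewrite !mxE; ring.
- by move=> c d' x; rewrite rmorphM !scalerA.
- by move=> c d' x; rewrite rmorphD !scalerDl.
Qed.

Definition wgen (i : nat) : wreath r :=
  if insub i is Some j then (delta_mx 0 j, delta_mx 0 j) else (0, 0).

(** The first Koszul differential. Over the polynomial ring its kernel is spanned by the elements
    [X_i e_j - X_j e_i], the images of the commutators of generators. *)
Definition delta_map (p : 'rV[Q]_r) : Q := \sum_i p 0 i * X i.

Lemma delta_mapD p q : delta_map (p + q) = delta_map p + delta_map q.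
Proof.
by rewrite -big_split; apply: eq_bigr => i _; rewrite mxE mulrDl.
Qed.

Lemma delta_mapZ c p : delta_map (c *: p) = c * delta_map p.
Proof.
by rewrite /delta_map big_distrr; apply: eq_bigr => i _; rewrite mxE -mulrA.
Qed.

Lemma delta_map0 : delta_map 0 = 0.
Proof. by rewrite /delta_map big1 // => i _; rewrite mxE mul0r. Qed.

Lemma delta_map_delta i : delta_map (delta_mx 0 i) = X i.
Proof.
rewrite /delta_map (bigD1 i) //= mxE !eqxx mul1r big1 ?addr0 // => j ji.
by rewrite mxE eqxx (negbTE ji) mul0r.
Qed.

Lemma wgenE (i : 'I_r) : wgen i = (delta_mx 0 i, delta_mx 0 i).
Proof. by rewrite /wgen insubT //= => lt; congr pair; congr delta_mx;
  apply: val_inj. Qed.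

End WreathStructure.

(** * Additive maps prescribed on monomials *)

Section LinearExtension.
Import GRing.Theory.
Local Open Scope ring_scope.
Variables (k : fieldType) (n : nat) (V : zmodType) (G : 'X_{1..n} -> k -> V).
Hypothesis GD : forall m a b, G m (a + b) = G m a + G m b.

(** [G] receives the coefficient because [V] is only an additive group: in one use [k] acts on a Lie
    algebra, in the other on polynomial entries. *)
Definition lext (q : {mpoly k[n]}) : V := \sum_(m <- msupp q) G m q@_m.

Lemma lext_G0 m : G m 0 = 0.
Proof. by apply: (addrI (G m 0)); rewrite -GD !addr0. Qed.

Lemma lextE q s : uniq s -> {subset msupp q <= s} ->
  lext q = \sum_(m <- s) G m q@_m.
Proof.
move=> us sub; rewrite [RHS](bigID (fun m => m \in msupp q)) /=.
rewrite [X in _ + X]big1 ?addr0 => [|m]; last first.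
  by move=> H; rewrite memN_msupp_eq0 ?lext_G0.
rewrite -[RHS]big_filter; apply: perm_big; apply: uniq_perm => //.
- exact: filter_uniq.
- move=> m; rewrite mem_filter; apply/idP/andP => [H|[]//].
  by split; last exact: sub.
Qed.

Lemma lextD p q : lext (p + q) = lext p + lext q.
Proof.
pose s := undup (msupp p ++ msupp q ++ msupp (p + q)).
have us : uniq s by apply: undup_uniq.
have [sp sq spq] : [/\ {subset msupp p <= s}, {subset msupp q <= s} &
    {subset msupp (p + q) <= s}].
  by split=> m H; rewrite mem_undup !mem_cat H ?orbT.
rewrite !(@lextE _ s) //.
by rewrite -big_split; apply: eq_bigr => m _; rewrite mcoeffD GD.
Qed.

Lemma lext0 : lext 0 = 0.
Proof. by rewrite /lext msupp0 big_nil. Qed.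

Lemma lextX m : lext 'X_[m] = G m 1.
Proof. by rewrite /lext msuppX big_seq1 mcoeffX eqxx. Qed.

Lemma lextCX c m : lext (c *: 'X_[m]) = G m c.
Proof.
rewrite (@lextE _ [:: m]) // ?big_seq1 ?mcoeffZ ?mcoeffX ?eqxx ?mulr1 //.
by move=> m' /msuppZ_le; rewrite msuppX.
Qed.

End LinearExtension.

Section Multinomials.
Variable n : nat.
Implicit Types (m : 'X_{1..n}) (i j : 'I_n).

Definition minvar m : option 'I_n :=
  [pick j | (m j != 0) && [forall l, (m l != 0) ==> (j <= l)]].

Variant minvar_spec m : option 'I_n -> Prop :=
| MinvarSome j of m j != 0 & (forall l, m l != 0 -> j <= l) :
    minvar_spec m (Some j)
| MinvarNone of (forall l, m l = 0) : minvar_spec m None.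

Lemma minvarP m : minvar_spec m (minvar m).
Proof.
rewrite /minvar; case: pickP => [j /andP [mj /forallP H]|H].
  by constructor=> // l; apply/implyP.
constructor=> l; apply/eqP; apply: contraFT (H l) => ml.
case: (@arg_minnP _ l (fun j => m j !=
  0) (fun j => nat_of_ord j) ml) => j mj Hj.
have := H j; rewrite mj /= => /negP; case.
by apply/forallP => l'; apply/implyP => /Hj.
Qed.

Lemma addUE m i j : (m + U_(i))%MM j = m j + (i == j).
Proof. by rewrite mnmDE mnm1E. Qed.

Lemma minvar_addU m i j : minvar (m + U_(i))%MM = Some j ->
  j <> i -> exists m', m = (m' + U_(j))%MM.
Proof.
case: minvarP => // j' nz _ [<-] ji; exists (m - U_(j'))%MM.
rewrite submK // lep1mP; move: nz; rewrite addUE.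
have /negbTE -> : i != j' by apply/eqP => e; case: ji; rewrite e.
by rewrite addn0.
Qed.

End Multinomials.

(** * The Magnus embedding is injective *)

Section Faithful.
Import GRing.Theory.
Local Open Scope ring_scope.
Variables (k : fieldType) (r : nat) (L : lieAlgebra k).
Hypothesis mL : metabelian L.
Variable va : nat -> L.
Local Notation R := {mpoly k[r]}.
Local Notation br := (@lie_br k L).
Local Notation W := (wreath (@mpolyC r k) (fun i => 'X_i) r).
Implicit Types (x y z : L) (m : 'X_{1..r}) (i j l : 'I_r) (p q : 'rV[R]_r).

Let laws := lie_struct_laws mL.

Lemma brDl x y z : br (x + y) z = br x z + br y z.
Proof. exact: (law_brDl laws). Qed.
Lemma brDr x y z : br z (x + y) = br z x + br z y.
Proof. exact: (law_brDr laws). Qed.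
Lemma brZl c x z : br (c *: x) z = c *: br x z.
Proof. exact: (law_brZl laws). Qed.
Lemma brZr c x z : br z (c *: x) = c *: br z x.
Proof. exact: (law_brZr laws). Qed.
Lemma br0l z : br 0 z = 0.
Proof. by apply: (addrI (br 0 z)); rewrite -brDl !addr0. Qed.
Lemma br0r z : br z 0 = 0.
Proof. by apply: (addrI (br z 0)); rewrite -brDr !addr0. Qed.
Lemma brNr x z : br z (- x) = - br z x.
Proof. by rewrite -scaleN1r brZr scaleN1r. Qed.
Lemma brC x y : br x y = - br y x.
Proof.
apply/eqP; rewrite -addr_eq0; apply/eqP.
have := lie_brxx (x + y : L).
by rewrite brDl !brDr !lie_brxx add0r addr0.
Qed.

(* [derived] is a substitute for membership in the derived algebra: it holds on
   commutators, is linear, and makes [derived] elements commute. *)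
Definition central_der z := forall a b, br (br a b) z = 0.
Definition derived y := central_der y /\ forall z, central_der z -> br y z = 0.

Lemma derived_br a b : derived (br a b).
Proof. by split=> [c d|z cz]; [apply: mL | apply: cz]. Qed.

Lemma derived0 : derived 0.
Proof. by split=> [a b|z _]; rewrite ?br0r ?br0l. Qed.

Lemma derivedD y z : derived y -> derived z -> derived (y + z).
Proof.
move=> [c1 d1] [c2 d2]; split=> [a b|w cw].
  by rewrite brDr c1 c2 addr0.
by rewrite brDl d1 // d2 // addr0.
Qed.

Lemma derivedZ c y : derived y -> derived (c *: y).
Proof.
move=> [c1 d1]; split=> [a b|w cw]; first by rewrite brZr c1 scaler0.
by rewrite brZl d1 // scaler0.
Qed.

Definition ad i y := br (va i) y.

(** The Jacobi identity, in which the bracket of [y] with a commutator vanishes. This is what lets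
    polynomials act on derived elements. *)
Lemma adC i j y : derived y -> ad i (ad j y) = ad j (ad i y).
Proof.
move=> [cy _]; have := lie_jacobi (va i : L) (va j) y.
rewrite [br y (br _ _)]brC cy oppr0 addr0 [br y (va i)]brC brNr /ad.
by move=> /eqP; rewrite subr_eq0 => /eqP.
Qed.

(** The action of the monomial [X^m], in a fixed order of the variables; by [adC] the order is
    immaterial on derived elements. *)
Definition mact m y := foldr (fun i z => iter (m i) (ad i) z) y (enum 'I_r).

Lemma ad_iter i j d y : derived y ->
  ad i (iter d (ad j) y) = iter d (ad j) (ad i y) /\ derived (iter d (ad j) y).
Proof.
move=> dy; elim: d => [|d [IH dd]] //=; split; last exact: derived_br.
by rewrite adC // IH.
Qed.

Lemma mactU m i y : derived y -> mact (m + U_(i)) y = ad i (mact m y).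
Proof.
move=> dy; rewrite /mact.
have : uniq (enum 'I_r) by apply: enum_uniq.
have : i \in enum 'I_r by rewrite mem_enum.
have step (s : seq 'I_r) : uniq s ->
    derived (foldr (fun i z => iter (m i) (ad i) z) y s) /\
    foldr (fun j z => iter ((m + U_(i))%MM j) (ad j) z) y s =
    (if i \in s then ad i else id) (foldr (fun i z => iter (m i) (ad i) z) y s).
  elim: s => //= j s IH /andP [js us].
  have [ds E] := IH us; have [E1 d1] := ad_iter i j (m j) ds.
  split=> //; rewrite E addUE in_cons.
  have [->|ij] := eqVneq i j; first by rewrite (negbTE js) /= addn1.
  by rewrite addn0 /=; case: (i \in s) => //; rewrite E1.
by move=> Hi us; have [_ ->] := step _ us; rewrite Hi.
Qed.

Lemma ad_mact i m y : derived y -> ad i (mact m y) = mact m (ad i y).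
Proof.
move=> dy; rewrite /mact; elim: (enum 'I_r) => //= a s <-.
apply: (ad_iter i a (m a) _).1.
elim: s => //= b s IH; exact: (ad_iter b b (m b) IH).2.
Qed.

Lemma mact0 y : mact 0%MM y = y.
Proof. by rewrite /mact; elim: (enum 'I_r) => //= j s ->; rewrite mnm0E. Qed.

Lemma mactD m y z : mact m (y + z) = mact m y + mact m z.
Proof.
rewrite /mact; elim: (enum 'I_r) => //= j s ->.
by elim: (m j) => //= d ->; rewrite /ad brDr.
Qed.

Lemma mactN m y : mact m (- y) = - mact m y.
Proof.
rewrite /mact; elim: (enum 'I_r) => //= j s ->.
by elim: (m j) => //= d ->; rewrite /ad brNr.
Qed.

(* The image of [X^m e_i]. The monomials [X^m e_i] with [minvar m = j < i] lead
   the elements [X^(m - U_j) (X_j e_i - X_i e_j)], which are the images of the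
   basic left-normed commutators. *)
Definition mimg m i : L :=
  if minvar m is Some j then
    if (j < i)%N then mact (m - U_(j))%MM (br (va j) (va i)) else 0
  else 0.

(** If [X_i] is the least variable of [X^m X_i], the second term is 0 and the first is the right
    side by definition. Otherwise the least variable [X_l], [l < i], divides [X^m], and the claim is
    the Jacobi identity for [a_l], [a_i], [a_j] acted on by [X^(m - U_l)]. *)
Lemma mimg_wedge m i j : (i < j)%N ->
  mimg (m + U_(i))%MM j - mimg (m + U_(j))%MM i = mact m (br (va i) (va j)).
Proof.
move=> ij; rewrite /mimg.
case: (minvarP (m + U_(i))%MM) => [l nz Hl|H]; last first.
  by have := H i; rewrite addUE eqxx addn1.
have li : (l <= i)%N by apply: Hl; rewrite addUE eqxx addn1.
rewrite (leq_ltn_trans li ij).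
have [eli|nli] := eqVneq l i.
  rewrite eli addmK; case: (minvarP (m + U_(j))%MM) => [l' nz' Hl'|_];
    last first.
    by rewrite subr0.
  suff -> : (l' < i)%N = false by rewrite subr0.
  apply: negbTE; rewrite -leqNgt -eli.
  have [e|jl'] := eqVneq j l'; first by rewrite -e (leq_trans li (ltnW ij)).
  by apply: Hl; move: nz'; rewrite !addUE (negbTE jl') addn0; case: (m l').
have lti : (l < i)%N by rewrite ltn_neqAle li andbT.
have [m' em] : exists m', m = (m' + U_(l))%MM.
  exists (m - U_(l))%MM; rewrite submK // lep1mP; move: nz.
  by rewrite addUE [i == l]eq_sym (negbTE nli) addn0.
have El i' : minvar (m + U_(i'))%MM = Some l \/ (i' < l)%N.
  have [|ge] := ltnP i' l; [by right | left].
  case: minvarP => [l' nz' Hl'|H]; last first.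
    by have := H l; rewrite em !addUE eqxx addn1.
  congr Some; apply: val_inj; apply/eqP; rewrite /= eqn_leq; apply/andP; split.
    by apply: Hl'; rewrite em !addUE eqxx addn1.
  have [e|jl'] := eqVneq i' l'; first by rewrite -e.
  by apply: Hl; move: nz'; rewrite !addUE (negbTE jl') addn0; case: (m l').
have [->|jl] := El j; last by have := ltn_trans jl (ltn_trans lti ij);
  rewrite ltnn.
rewrite lti em.
have E i' : ((m' + U_(l) + U_(i')) - U_(l) = m' + U_(i'))%MM.
  by rewrite -addmA [(U_(l) + _)%MM]addmC addmA addmK.
rewrite !E !mactU; [|exact: derived_br..].
rewrite !ad_mact; [|exact: derived_br..].
rewrite -mactN -mactD; congr mact; rewrite /ad.
have := lie_jacobi (va l : L) (va i) (va j).
move=> /eqP; rewrite -addrA addr_eq0 => /eqP ->.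
rewrite opprD; congr (_ + _).
by rewrite [br (va j) (va l)]brC brNr opprK.
Qed.

Definition Phi p : L := \sum_i lext (fun m c => c *: mimg m i) (p 0 i).

Lemma mimgD i m (a b : k) : (a + b) *: mimg m i = a *: mimg m i + b *: mimg m i.
Proof. exact: scalerDl. Qed.

Lemma PhiD p q : Phi (p + q) = Phi p + Phi q.
Proof.
rewrite /Phi -big_split; apply: eq_bigr => i _.
by rewrite mxE lextD //; exact: mimgD.
Qed.

Lemma Phi0 : Phi 0 = 0.
Proof. by rewrite /Phi big1 // => i _; rewrite mxE lext0. Qed.

Lemma PhiZ (c : k) p : Phi (c%:MP *: p) = c *: Phi p.
Proof.
rewrite /Phi scaler_sumr; apply: eq_bigr => i _; rewrite mxE mul_mpolyC.
rewrite (@lextE _ _ _ _ (mimgD i) _ (msupp (p 0 i))) ?msupp_uniq //; last first.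
  exact: msuppZ_le.
by rewrite /lext scaler_sumr; apply: eq_bigr => m _; rewrite mcoeffZ scalerA.
Qed.

Lemma Phi_mono m i : Phi ('X_[m] *: delta_mx 0 i) = mimg m i.
Proof.
rewrite /Phi (bigD1 i) //=
  !mxE !eqxx mulr1 lextX scale1r big1 ?addr0 // => j ji.
by rewrite !mxE eqxx (negbTE ji) mulr0 lext0.
Qed.

(* [Phi] is [R]-linear on the submodule spanned by the Koszul relations, with
   [X_i] acting as [ad i]. *)
Definition phi_val p y := forall m, Phi ('X_[m] *: p) = mact m y.

Lemma phi_val_Phi p y : phi_val p y -> Phi p = y.
Proof. by move=> /(_ 0%MM); rewrite mpolyX0 scale1r mact0. Qed.

Lemma mactZ m (c : k) y : mact m (c *: y) = c *: mact m y.
Proof.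
rewrite /mact; elim: (enum 'I_r) => //= j s ->.
by elim: (m j) => //= d ->; rewrite /ad brZr.
Qed.

Lemma phi_val0 : phi_val 0 0.
Proof. by move=> m; rewrite scaler0 Phi0 -(scale0r (0 : L)) mactZ !scale0r. Qed.

Lemma phi_valD p q y z : phi_val p y -> phi_val q z -> phi_val (p + q) (y + z).
Proof. by move=> H1 H2 m; rewrite scalerDr PhiD H1 H2 mactD. Qed.

Lemma phi_valZ (c : k) p y : phi_val p y -> phi_val (c%:MP *: p) (c *: y).
Proof.
by move=> H m; rewrite scalerA mulrC -scalerA PhiZ H mactZ.
Qed.

Lemma phi_val_sum (I : finType) (F : I -> 'rV[R]_r) (G : I -> L) :
  (forall a : I, phi_val (F a) (G a)) ->
  phi_val (\sum_a F a) (\sum_a G a).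
Proof.
move=> H; elim: (index_enum I) => [|a s IH].
  by rewrite !big_nil; apply: phi_val0.
by rewrite !big_cons; apply: phi_valD.
Qed.

Lemma phi_valX i p y : derived y -> phi_val p y -> phi_val ('X_i *: p) (ad i y).
Proof.
by move=> dy H m; rewrite scalerA -mpolyXD H mactU // ad_mact.
Qed.

Definition wedge i j : 'rV[R]_r := 'X_i *: delta_mx 0 j - 'X_j *: delta_mx 0 i.

Lemma PhiB p q : Phi (p - q) = Phi p - Phi q.
Proof.
have -> : - q = (- 1)%:MP *: q by rewrite rmorphN1 scaleN1r.
by rewrite PhiD PhiZ scaleN1r.
Qed.

Lemma phi_val_wedge i j : phi_val (wedge i j) (br (va i) (va j)).
Proof.
have E m : Phi ('X_[m] *: wedge i j) =
    mimg (m + U_(i))%MM j - mimg (m + U_(j))%MM i.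
  by rewrite scalerBr !scalerA -!mpolyXD PhiB !Phi_mono.
move=> m; rewrite E; have [ij|ji|/val_inj <-] := ltngtP i j.
- exact: mimg_wedge.
- by rewrite -opprB mimg_wedge // -mactN [br (va j) _]brC opprK.
by rewrite subrr lie_brxx -(scale0r (0 : L)) mactZ !scale0r.
Qed.

Definition urow (u : 'rV[k]_r) : 'rV[R]_r := \sum_i (u 0 i)%:MP *: delta_mx 0 i.
Definition ulin (u : 'rV[k]_r) : L := \sum_i u 0 i *: va i.
Local Notation ellR := (@ell k r R (@mpolyC r k) (fun i => 'X_i)).

Lemma br_suml (I : finType) (F : I -> L) y :
  br (\sum_a F a) y = \sum_a br (F a) y.
Proof. by apply: (big_morph (fun x => br x y)) => [x z|];
  rewrite ?brDl ?br0l. Qed.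

Lemma br_sumr (I : finType) (F : I -> L) y :
  br y (\sum_a F a) = \sum_a br y (F a).
Proof. by apply: (big_morph (fun x => br y x)) => [x z|];
  rewrite ?brDr ?br0r. Qed.

Lemma phi_val_ell u p y : derived y -> phi_val p y ->
  phi_val (ellR u *: p) (br (ulin u) y).
Proof.
move=> dy H; rewrite /ell scaler_suml br_suml; apply: phi_val_sum => i.
by rewrite -scalerA brZl; apply: phi_valZ; apply: phi_valX.
Qed.

Lemma phi_val_urow u v :
  phi_val (ellR u *: urow v - ellR v *: urow u) (br (ulin u) (ulin v)).
Proof.
have E a b : ellR a *: urow b =
    \sum_i \sum_j (a 0 i * b 0 j)%:MP *: ('X_i *: delta_mx 0 j).
  rewrite /ell scaler_suml; apply: eq_bigr => i _.
  rewrite scaler_sumr; apply: eq_bigr => j _.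
  by rewrite !scalerA rmorphM /= -!mulrA [_ * 'X_i]mulrC.
rewrite !E [X in _ - X]exchange_big -sumrB /ulin br_suml;
  apply: phi_val_sum => i.
rewrite -sumrB br_sumr; apply: phi_val_sum => j.
rewrite [v 0 j * _]mulrC -scalerBr brZl brZr scalerA.
by apply: phi_valZ; apply: phi_val_wedge.
Qed.

(** Relates a pair [(u, p)] to its value in [L]: [ulin u] plus the value [z] of the remainder
    [p - urow u]. Asking for [phi_val] rather than an equation for [Phi] keeps the action of
    polynomials available in inductions. *)
Definition magnus_val (x : W) (y : L) : Prop :=
  exists z, [/\ phi_val (x.2 - urow x.1) z, derived z & y = ulin x.1 + z].

Lemma urowD u v : urow (u + v) = urow u + urow v.
Proof.
by rewrite -big_split; apply: eq_bigr => i _; rewrite mxE rmorphD scalerDl.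
Qed.

Lemma urowZ c u : urow (c *: u) = c%:MP *: urow u.
Proof.
by rewrite scaler_sumr; apply: eq_bigr => i _; rewrite mxE rmorphM scalerA.
Qed.

Lemma urow0 : urow 0 = 0.
Proof. by rewrite /urow big1 // => i _; rewrite mxE rmorph0 scale0r. Qed.

Lemma ulinD u v : ulin (u + v) = ulin u + ulin v.
Proof. by rewrite -big_split; apply: eq_bigr => i _; rewrite mxE scalerDl. Qed.

Lemma ulinZ c u : ulin (c *: u) = c *: ulin u.
Proof. by rewrite scaler_sumr; apply: eq_bigr => i _; rewrite mxE scalerA. Qed.

Lemma ulin0 : ulin 0 = 0.
Proof. by rewrite /ulin big1 // => i _; rewrite mxE scale0r. Qed.

Lemma urow_delta i : urow (delta_mx 0 i) = delta_mx 0 i.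
Proof.
rewrite /urow (bigD1 i) //= mxE !eqxx scale1r big1 ?addr0 // => j ji.
by rewrite mxE eqxx (negbTE ji) rmorph0 scale0r.
Qed.

Lemma ulin_delta i : ulin (delta_mx 0 i) = va i.
Proof.
rewrite /ulin (bigD1 i) //= mxE !eqxx scale1r big1 ?addr0 // => j ji.
by rewrite mxE eqxx (negbTE ji) scale0r.
Qed.

Lemma magnus_val_closed (t : lterm k) (vx : nat -> W) (vx' : nat -> L) :
  lwf r 0 t ->
  magnus_val (seval (wgen (@mpolyC r k) (fun i => 'X_i)) vx t) (leval va vx' t).
Proof.
elim: t => [i ir|j //||t IHt u IHu|c t IHt|t IHt u IHu].
- exists 0; rewrite /= (wgenE _ _ (Ordinal ir)) /=
  urow_delta subrr ulin_delta addr0.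
  by split=> //; [apply: phi_val0 | apply: derived0].
- exists 0; rewrite /= urow0 subrr ulin0 addr0.
  by split=> //; [apply: phi_val0 | apply: derived0].
- move=> /= /andP [/IHt [y [Hy dy ->]] /IHu [z [Hz dz ->]]]; exists (y + z).
  rewrite urowD ulinD opprD addrACA [_ + y + _]addrACA; split=> //.
    exact: phi_valD.
  exact: derivedD.
- move=> /= /IHt [y [Hy dy ->]]; exists (c *: y).
  rewrite urowZ ulinZ -scalerBr [_ *: (_ + y)]scalerDr; split=> //.
    exact: phi_valZ.
  exact: derivedZ.
move=> /= /andP [/IHt [y [Hy dy ->]] /IHu [z [Hz dz ->]]].
set a := seval _ _ t in Hy *; set b := seval _ _ u in Hz *.
exists (br (ulin a.1 + y) (ulin b.1 + z)).
split; [|exact: derived_br|by rewrite ulin0 add0r].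
(* As [[y, z] = 0], three brackets remain: linear with linear, and linear with derived twice. The
   second component is then split in the same way. *)
rewrite urow0 subr0 brDl !brDr [br y z]dy.2 ?addr0; last exact: dz.1.
rewrite [br y _]brC.
have -> : ellR a.1 *: b.2 - ellR b.1 *: a.2 =
    (ellR a.1 *: urow b.1 - ellR b.1 *: urow a.1) + ellR a.1 *: (b.2 - urow b.1)
      - ellR b.1 *: (a.2 - urow a.1).
  by apply/rowP => i; rewrite !mxE; ring.
apply: phi_valD; first apply: phi_valD.
- exact: phi_val_urow.
- exact: phi_val_ell.
by have := phi_valZ (- 1) (phi_val_ell b.1 dy Hy); rewrite rmorphN1 !scaleN1r.
Qed.

Lemma magnus_faithful (t : lterm k) (vx : nat -> W) (vx' : nat -> L) :
  lwf r 0 t -> seval (wgen (@mpolyC r k) (fun i => 'X_i)) vx t = (0, 0) ->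
  leval va vx' t = 0.
Proof.
move=> wt; have [z []] := magnus_val_closed vx vx' wt.
move=> H _ -> e; move: H; rewrite e /= urow0 subrr ulin0 add0r.
by move=> /phi_val_Phi <-; rewrite Phi0.
Qed.

End Faithful.

(** * The image of the Magnus embedding *)

Section Surjective.
Import GRing.Theory.
Local Open Scope ring_scope.
Variables (k : fieldType) (r : nat).
Local Notation R := {mpoly k[r]}.
Local Notation kap := (@mpolyC r k).
Local Notation X := (fun i : 'I_r => 'X_i : R).
Local Notation W := (wreath kap X r).
Implicit Types (m : 'X_{1..r}) (i j l : 'I_r) (p q : 'rV[R]_r) (u : 'rV[k]_r).

Definition represented (x : W) : Prop :=
  exists2 t : lterm k, lwf r 0 t & seval (wgen kap X) (fun=> s0 W) t = x.

Lemma represented0 : represented (0, 0).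
Proof. by exists L0. Qed.

Lemma representedD (x y : W) : represented x -> represented y ->
  represented (x.1 + y.1, x.2 + y.2).
Proof. by move=> [t wt <-] [t' wt' <-]; exists (LAdd t t'); rewrite //= wt. Qed.

Lemma representedZ c (x : W) : represented x -> represented (c *: x.1, c%:MP *:
  x.2).
Proof. by move=> [t wt <-]; exists (LScale c t). Qed.

Lemma represented_gen i : represented (delta_mx 0 i, delta_mx 0 i).
Proof. by exists (LA (nat_of_ord i)); rewrite /= ?ltn_ord ?wgenE. Qed.

Lemma represented_br (x y : W) : represented x -> represented y ->
  represented (0, ell kap X x.1 *: y.2 - ell kap X y.1 *: x.2).
Proof. by move=> [t wt <-] [t' wt' <-]; exists (LBr t t'); rewrite //= wt. Qed.

Definition rep0 p := represented (0, p).

Lemma rep0_0 : rep0 0. Proof. exact: represented0. Qed.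

Lemma rep0D p q : rep0 p -> rep0 q -> rep0 (p + q).
Proof. by move=> Hp Hq; have := representedD Hp Hq; rewrite /= addr0. Qed.

Lemma rep0Z (c : k) p : rep0 p -> rep0 (c%:MP *: p).
Proof. by move=> Hp; have := representedZ c Hp; rewrite /= scaler0. Qed.

(** On pairs with zero linear part, bracketing with the generator [a_i] multiplies by [X_i]. *)
Lemma rep0X i p : rep0 p -> rep0 ('X_i *: p).
Proof.
move=> Hp; have := represented_br (represented_gen i) Hp.
by rewrite /= ell_delta ell0 scale0r subr0.
Qed.

Lemma rep0_scale (f : R) p : rep0 p -> rep0 (f *: p).
Proof.
move=> Hp; rewrite [f]mpolyE scaler_suml; apply: big_ind => [||m _].
- exact: rep0_0.
- exact: rep0D.
rewrite -mul_mpolyC -scalerA; apply: rep0Z; rewrite mpolyXE_id.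
pose K (g : R) := forall q, rep0 q -> rep0 (g *: q).
suff : K (\prod_(i < r) 'X_i ^+ m i) by apply.
apply: (big_ind K) => [q|g h Kg Kh q /Kh /Kg|i _ q Hq].
- by rewrite scale1r.
- by rewrite scalerA.
elim: (m i) => [|d IH]; first by rewrite expr0 scale1r.
by rewrite exprS -scalerA; apply: rep0X.
Qed.

Lemma rep0_wedge i j : rep0 (wedge k i j).
Proof.
have := represented_br (represented_gen i) (represented_gen j).
by rewrite /= !ell_delta.
Qed.

Lemma represented_urow u : represented (u, urow u).
Proof.
have : represented (\sum_i u 0 i *: delta_mx 0 i, urow u).
  rewrite /urow; elim: (index_enum _) => [|i s IH].
    by rewrite !big_nil; apply: represented0.
  rewrite !big_cons.
  exact: representedD (representedZ (u 0 i) (represented_gen i)) IH.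
suff <- : u = \sum_i u 0 i *: delta_mx 0 i by [].
exact: row_sum_delta.
Qed.

(* A section, up to represented elements, of [delta_map]: it sends [X^m] to
   [X^(m - U_j) e_j] for the least variable [X_j] of [X^m]. *)
Definition msect m (c : k) : 'rV[R]_r :=
  if minvar m is Some j then (c *: 'X_[m - U_(j)]) *: delta_mx 0 j else 0.

Lemma msectD m a b : msect m (a + b) = msect m a + msect m b.
Proof.
rewrite /msect; case: minvar => [j|]; last by rewrite addr0.
by rewrite scalerDl scalerDl.
Qed.

Definition koszul p := p - lext msect (delta_map X p).

Lemma koszulD p q : koszul (p + q) = koszul p + koszul q.
Proof.
rewrite /koszul delta_mapD lextD; last exact: msectD.
by rewrite opprD addrACA.
Qed.

Lemma koszul0 : koszul 0 = 0.
Proof. by rewrite /koszul delta_map0 lext0 subr0. Qed.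

(** Let [X_j] be the least variable of [X^m X_i]. If [j = i] the difference is 0; otherwise
    [m = m' + U_j] and it is [c X^m' (X_j e_i - X_i e_j)], a multiple of the image of a
    commutator. *)
Lemma rep0_koszul_mono c m i : rep0 (koszul ((c *: 'X_[m]) *: delta_mx 0 i)).
Proof.
have -> : koszul ((c *: 'X_[m]) *: delta_mx 0 i) =
    (c *: 'X_[m]) *: delta_mx 0 i - msect (m + U_(i))%MM c.
  congr (_ - _); rewrite -(lextCX msectD); congr lext.
  rewrite /delta_map (bigD1 i) //= !mxE !eqxx mulr1 big1 ?addr0 => [|j ji].
    by rewrite -scalerAl mpolyXD.
  by rewrite !mxE eqxx (negbTE ji) mulr0 mul0r.
rewrite /msect; case E : (minvar _) => [j|]; last first.
  by case: minvarP E => // /(_ i); rewrite addUE eqxx addn1.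
have [ji|ji] := eqVneq j i.
  by rewrite ji addmK subrr; apply: rep0_0.
have [m' ->] := minvar_addU E (elimN eqP ji).
have -> : (m' + U_(j) + U_(i) - U_(j))%MM = (m' + U_(i))%MM.
  by rewrite -addmA [(U_(j) + _)%MM]addmC addmA addmK.
suff -> : (c *: 'X_[(m' + U_(j))%MM]) *: delta_mx 0 i -
    (c *: 'X_[(m' + U_(i))%MM]) *: delta_mx 0 j = (c *: 'X_[m']) *: wedge k j i.
  by apply: rep0_scale; apply: rep0_wedge.
by rewrite /wedge scalerBr !scalerA -!scalerAl !mpolyXD.
Qed.

Lemma rep0_koszul p : rep0 (koszul p).
Proof.
rewrite [p]row_sum_delta.
elim: (index_enum _) => [|i s IH].
  by rewrite big_nil koszul0; apply: rep0_0.
rewrite big_cons koszulD; refine (rep0D _ IH).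
rewrite [p 0 i]mpolyE scaler_suml; elim: (msupp _) => [|m s' IH'].
  by rewrite big_nil koszul0; apply: rep0_0.
rewrite big_cons koszulD; exact: (rep0D (rep0_koszul_mono _ _ _) IH').
Qed.

Lemma delta_map_urow u : delta_map X (urow u) = ell kap X u.
Proof.
rewrite /delta_map /ell; apply: eq_bigr => i _; congr (_ * _).
rewrite /urow summxE (bigD1 i) //= !mxE !eqxx mulr1 big1 ?addr0 // => j ji.
by rewrite !mxE eqxx eq_sym (negbTE ji) mulr0.
Qed.

Lemma magnus_surjective u p : delta_map X p = ell kap X u -> represented (u, p).
Proof.
move=> H; have := rep0_koszul (p - urow u).
(* [delta_map] kills [p - urow u], so the section subtracts nothing. *)
have -> : koszul (p - urow u) = p - urow u.
  rewrite /koszul; suff -> : delta_map X (p - urow u) =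
    0 by rewrite lext0 subr0.
  apply: (addIr (delta_map X (urow u))).
  by rewrite -delta_mapD subrK H delta_map_urow add0r.
by move=> /(representedD (represented_urow u)); rewrite /= addr0 addrC subrK.
Qed.

End Surjective.

(** * Reduction to linear systems *)

Section Admissible.
Import GRing.Theory.
Local Open Scope ring_scope.
Variables (k : fieldType) (r n : nat) (S : seq (lterm k)).
Variable u : {ffun 'I_n -> 'rV[k]_r}.

Section OverRing.
Variables (Q : comNzRingType) (kap : {rmorphism k -> Q}) (X : 'I_r -> Q).

Definition wvars (P : 'M[Q]_(n, r)) (j : nat) : wreath kap X r :=
  if insub j is Some j' then (u j', row j' P) else (0, 0).

(* A solution with linear parts [u] in the subalgebra of the wreath structure
   cut out by [delta_map p = ell u]. *)
Definition admissible : Prop := exists P : 'M[Q]_(n, r),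
  (forall j, delta_map X (row j P) = ell kap X (u j)) /\
  forall f, List.In f S -> seval (wgen kap X) (wvars P) f = (0, 0).

(* Generic values, affine in the unknown matrix [P]: constant part in the first
   [r] columns, coefficients of the rows of [P] in the last [n]. *)
Definition agen (i : nat) : wreath kap X (r + n) :=
  if insub i is Some j then (delta_mx 0 j, row_mx (delta_mx 0 j) 0) else (0, 0).
Definition avar (j : nat) : wreath kap X (r + n) :=
  if insub j is Some j' then (u j', row_mx 0 (delta_mx 0 j')) else (0, 0).
Definition aval f := seval agen avar f.

(** Second components enter the bracket linearly, with scalars depending on first components only,
    so right multiplication by the block column of [1] and [P] is a homomorphism. This is why fixing
    the linear parts makes the equations affine in [P]. *)
Lemma aval_spec P f : seval (wgen kap X) (wvars P) f =
  ((aval f).1, lsubmx (aval f).2 + rsubmx (aval f).2 *m P).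
Proof.
pose h (x : wreath kap X (r + n)) : wreath kap X r :=
  (x.1, x.2 *m col_mx 1%:M P).
have hh : is_hom h.
  split=> //=; rewrite /h /=.
  - by rewrite mul0mx.
  - by move=> x y; rewrite mulmxDl.
  - by move=> c x; rewrite scalemxAl.
  - by move=> x y; rewrite mulmxBl !scalemxAl.
have -> : wgen kap X = h \o agen.
  apply/funext => i; rewrite /wgen /agen /h /=; case: insubP => [j _ _|_] /=.
    by rewrite mul_row_col mulmx1 mul0mx addr0.
  by rewrite mul0mx.
have -> : wvars P = h \o avar.
  apply/funext => i; rewrite /wvars /avar /h /=; case: insubP => [j _ _|_] /=.
    by rewrite mul_row_col mul0mx add0r rowE.
  by rewrite mul0mx.
rewrite -(seval_hom hh) -/(aval f) /h; congr pair.
by rewrite -[(aval f).2 in LHS]hsubmxK mul_row_col mulmx1.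
Qed.

Local Notation I := (('I_(size S) * 'I_r) + 'I_n)%type.
Local Notation J := ('I_n * 'I_r)%type.

(** Two families of scalar equations: the coordinates of the equations of [S], and for each unknown
    the condition [delta_map p = ell u]. *)
Definition sysA (jl : J) (i : I) : Q :=
  match i with
  | inl (a, l) => (jl.2 == l)%:R * rsubmx (aval (nth L0 S a)).2 0 jl.1
  | inr j => (jl.1 == j)%:R * X jl.2
  end.

Definition sysc (i : I) : Q :=
  match i with
  | inl (a, l) => - lsubmx (aval (nth L0 S a)).2 0 l
  | inr j => ell kap X (u j)
  end.

Lemma admissible_sys : (forall f, List.In f S -> (aval f).1 = 0) ->
  admissible <-> solvable_sys sysA sysc.
Proof.
move=> H0.
have E1 (y : J -> Q) a l : \sum_jl y jl * sysA jl (inl (a, l)) =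
    (rsubmx (aval (nth L0 S a)).2 *m (\matrix_(j, l) y (j, l))) 0 l.
  transitivity (\sum_j \sum_l' y (j, l') * sysA (j, l') (inl (a, l))).
    by rewrite pair_bigA; apply: eq_bigr => -[].
  rewrite mxE; apply: eq_bigr => j _;
    rewrite (bigD1 l) //= eqxx mul1r mxE mulrC.
  by rewrite big1 ?addr0 // => l' /negbTE ->; rewrite mul0r mulr0.
have E2 (y : J -> Q) j : \sum_jl y jl * sysA jl (inr j) =
    delta_map X (row j (\matrix_(j, l) y (j, l))).
  transitivity (\sum_j' \sum_l' y (j', l') * sysA (j', l') (inr j)).
    by rewrite pair_bigA; apply: eq_bigr => -[].
  rewrite (bigD1 j) //= [X in _ + X]big1 ?addr0 => [|j' /negbTE nj]; last first.
    by rewrite big1 // => l _; rewrite nj mul0r mulr0.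
  by apply: eq_bigr => l _; rewrite eqxx mul1r !mxE.
split=> [[P [Hd HS]]|[y Hy]].
  exists (fun jl => P jl.1 jl.2).
  have EP : \matrix_(j, l) P j l = P by apply/matrixP => j l; rewrite mxE.
  case=> [[a l]|j]; rewrite ?E1 ?E2 /= EP ?Hd //.
  have := HS _ (In_nth L0 (ltn_ord a));
    rewrite aval_spec => -[_ /rowP /(_ l) e].
  by rewrite mxE [RHS]mxE in e; apply/eqP; rewrite -addr_eq0 addrC e.
exists (\matrix_(j, l) y (j, l)); split=> [j|f fS].
  by rewrite -E2 Hy.
have [a aS <-] := nth_In L0 fS; rewrite aval_spec H0; last exact: In_nth.
congr pair; apply/rowP => l; rewrite mxE [RHS]mxE.
by have := Hy (inl (Ordinal aS, l)); rewrite E1 /= => ->; rewrite addrN.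
Qed.

End OverRing.

Section Morphism.
Variables (Q Q' : comNzRingType) (kap : {rmorphism k -> Q}) (X : 'I_r -> Q).
Variables (kap' : {rmorphism k -> Q'}) (X' : 'I_r -> Q') (h :
  {rmorphism Q -> Q'}).
Hypothesis hkap : forall c, kap' c = h (kap c).
Hypothesis hX : forall i, X' i = h (X i).

Lemma ell_morph v : ell kap' X' v = h (ell kap X v).
Proof.
rewrite /ell rmorph_sum; apply: eq_bigr => i _.
by rewrite rmorphM hkap hX.
Qed.

Lemma delta_map_morph p : delta_map X' (map_mx h p) = h (delta_map X p).
Proof.
rewrite /delta_map rmorph_sum; apply: eq_bigr => i _.
by rewrite rmorphM hX mxE.
Qed.

Definition wmap d (x : wreath kap X d) : wreath kap' X' d := (x.1,
  map_mx h x.2).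

Lemma wmap_hom d : is_hom (@wmap d).
Proof.
split=> //=; rewrite /wmap /=.
- by rewrite map_mx0.
- by move=> x y; rewrite map_mxD.
- by move=> c x; rewrite map_mxZ hkap.
- by move=> x y; rewrite map_mxB !map_mxZ !ell_morph.
Qed.

Lemma aval_morph f : aval kap' X' f = wmap (aval kap X f).
Proof.
rewrite /aval (seval_hom (@wmap_hom _)); congr seval; apply/funext => i /=.
  rewrite /agen /wmap; case: insubP => [j _ _|_] /=; last by rewrite map_mx0.
  by rewrite map_row_mx map_delta_mx map_mx0.
rewrite /avar /wmap; case: insubP => [j _ _|_] /=; last by rewrite map_mx0.
by rewrite map_row_mx map_delta_mx map_mx0.
Qed.

Lemma admissible_morph : admissible kap X -> admissible kap' X'.
Proof.
move=> [P [Hd HS]]; exists (map_mx h P); split=> [j|f fS].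
  by rewrite -map_row delta_map_morph Hd ell_morph.
have -> : wgen kap' X' = @wmap r \o wgen kap X.
  apply/funext => i; rewrite /wgen /wmap /=.
  by case: insubP => [j _ _|_] /=; rewrite ?map_delta_mx ?map_mx0.
have -> : wvars kap' X' (map_mx h P) = @wmap r \o wvars kap X P.
  apply/funext => i; rewrite /wvars /wmap /=.
  by case: insubP => [j _ _|_] /=; rewrite ?map_row ?map_mx0.
by rewrite -(seval_hom (@wmap_hom _)) HS // /wmap /= map_mx0.
Qed.

Lemma sysA_morph jl i : sysA kap' X' jl i = h (sysA kap X jl i).
Proof.
case: i => [[a l]|j] /=; rewrite rmorphM rmorph_nat ?hX //.
by rewrite aval_morph /= !mxE.
Qed.

Lemma sysc_morph i : sysc kap' X' i = h (sysc kap X i).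
Proof.
case: i => [[a l]|j] /=; last exact: ell_morph.
by rewrite rmorphN aval_morph /= !mxE.
Qed.

End Morphism.
End Admissible.

HB.instance Definition _ (Q1 Q2 : finComNzRingType) := Finite.on (Q1 * Q2)%type.

(** * Finite algebras refuting unsolvable systems *)

Section Refutation.
Import GRing.Theory.
Local Open Scope ring_scope.
Variables (k : finFieldType) (r n : nat) (S : seq (lterm k)).
Hypothesis wS : all (lwf r n) S.
Local Notation R := {mpoly k[r]}.
Local Notation kap := (@mpolyC r k).
Local Notation X := (fun i : 'I_r => 'X_i : R).
Implicit Types u : {ffun 'I_n -> 'rV[k]_r}.

(** Surjectivity turns the rows into Lie polynomials; faithfulness turns vanishing over the
    polynomial ring into vanishing in every metabelian algebra. *)
Lemma admissible_solvable u : admissible S u kap X -> solvable r n S.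
Proof.
move=> [P [Hd HS]].
have /choice [b Hb] (j : 'I_n) : exists t : lterm k, lwf r 0 t /\
    seval (wgen kap X) (fun=> s0 _) t = (u j, row j P).
  by have [t wt <-] := magnus_surjective (Hd j); exists t.
pose bs := [seq b j | j <- enum 'I_n].
have sbs : size bs = n by rewrite size_map size_enum_ord.
have nbs (j : 'I_n) : nth L0 bs j = b j.
  by rewrite (nth_map j) ?size_enum_ord // nth_ord_enum.
have wbs : all (lwf r 0) bs.
  by apply/allIn => t /(nth_In L0) [j]; rewrite sbs => jn <-;
    rewrite (nbs (Ordinal jn)) (Hb _).1.
exists bs; split=> // f fS L mL va; rewrite leval_lsubst.
have wf : lwf r n f by move/allIn: wS => /(_ f fS).
apply: (@magnus_faithful k r L mL va _ (fun=> s0 _)).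
  by apply: lwf_lsubst => //; rewrite sbs.
rewrite /lsubst seval_lsubst -[RHS](HS f fS).
apply: seval_eq wf _ _ => [i ir //|j jn] /=.
by rewrite /wvars insubT /= (nbs (Ordinal jn)) (Hb _).2.
Qed.

Lemma inadmissible_finite u : ~ admissible S u kap X ->
  exists (Q : finComNzRingType) (h : {rmorphism R -> Q}),
    ~ admissible S u (h \o kap) (h \o X).
Proof.
move=> U.
have [H0|H1] := pselect (forall f, List.In f S -> (aval u kap X f).1 = 0).
  have [Q [h Hh]] := mpoly_finitely_refutable (fun H => U ((admissible_sys
    H0).2 H)).
  exists Q, h => A; apply: Hh.
  have H0' f : List.In f S -> (aval u (h \o kap) (h \o X) f).1 = 0.
    by move=> fS; rewrite (@aval_morph _ _ _ _ _ _ kap X _ _ h) //= H0.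
  have [y Hy] := (admissible_sys H0').1 A; exists y => i.
  rewrite -(@sysc_morph _ _ _ _ _ _ _ kap X (h \o kap) (h \o X)) // -Hy.
  apply: eq_bigr => jl _.
  by rewrite -(@sysA_morph _ _ _ _ _ _ _ kap X (h \o kap) (h \o X)).
(* Some equation has a nonzero linear part. It depends on [u] alone and survives every morphism, so
   any finite quotient refutes the system. *)
have [Q [h _]] := @mpoly_residually_finite k r 1 (oner_neq0 _).
exists Q, h => -[P [_ HS]]; apply: H1 => f fS.
have := HS f fS; rewrite aval_spec => -[+ _].
by rewrite (@aval_morph _ _ _ _ _ _ kap X _ _ h).
Qed.

Definition pair_morph (Q1 Q2 : finComNzRingType) (h1 : R -> Q1) (h2 : R -> Q2)
  (x : R) : Q1 * Q2 := (h1 x, h2 x).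

Section PairMorph.
Variables (Q1 Q2 : finComNzRingType) (h1 : {rmorphism R -> Q1}).
Variable h2 : {rmorphism R -> Q2}.

Lemma pair_morph_is_additive : zmod_morphism (pair_morph h1 h2).
Proof. by move=> x y; rewrite /pair_morph !rmorphB. Qed.

Lemma pair_morph_is_multiplicative : monoid_morphism (pair_morph h1 h2).
Proof.
by split=> [|x y]; rewrite /pair_morph ?rmorph1 ?rmorphM.
Qed.

HB.instance Definition _ := GRing.isZmodMorphism.Build R (Q1 * Q2)%type
  (pair_morph h1 h2) pair_morph_is_additive.
HB.instance Definition _ := GRing.isMonoidMorphism.Build R (Q1 * Q2)%type
  (pair_morph h1 h2) pair_morph_is_multiplicative.
End PairMorph.

(** A solution over a product of rings projects to each factor, so one product serves for the
    finitely many [u]. *)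
Lemma inadmissible_all : (forall u, ~ admissible S u kap X) ->
  exists (Q : finComNzRingType) (h : {rmorphism R -> Q}),
    forall u, ~ admissible S u (h \o kap) (h \o X).
Proof.
move=> U.
suff H (s : seq {ffun 'I_n -> 'rV[k]_r}) :
    exists (Q : finComNzRingType) (h : {rmorphism R -> Q}),
      forall u, u \in s -> ~ admissible S u (h \o kap) (h \o X).
  have [Q [h Hh]] := H (enum {: {ffun 'I_n -> 'rV[k]_r}}).
  by exists Q, h => u; apply: Hh; rewrite mem_enum.
elim: s => [|u s [Q1 [h1 H1]]].
  have [Q [h _]] := @mpoly_residually_finite k r 1 (oner_neq0 _).
  by exists Q, h.
have [Q2 [h2 H2]] := inadmissible_finite (U u).
exists (Q1 * Q2)%type, (pair_morph h1 h2) => v.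
rewrite in_cons => /orP [/eqP ->|vs] A.
  by apply: H2; apply: (@admissible_morph _ _ _ _ _ _ _ _ _ _ _
    (@snd Q1 Q2) _ _ A).
by apply: (H1 v vs); apply: (@admissible_morph _ _ _ _ _ _ _ _ _ _ _
    (@fst Q1 Q2) _ _ A).
Qed.

Section FiniteWreath.
Variables (Q : finComNzRingType) (kapQ : {rmorphism k -> Q}) (XQ : 'I_r -> Q).
Local Notation W := (wreath kapQ XQ r).
Local Notation el := (ell kapQ XQ).
Local Notation dl := (delta_map XQ).

Let inF (x : 'rV[k]_r * 'rV[Q]_r) := dl x.2 == el x.1.

(** The whole wreath structure would be too large: its elements need not satisfy the constraint
    demanded in [admissible]. *)
Definition fin_wreath : finType := {x : 'rV[k]_r * 'rV[Q]_r | inF x}.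

Definition fin_mk x (H : inF x) : fin_wreath := Sub x H.

Lemma fin_wreath0 : inF (s0 W).
Proof. by rewrite /inF /= delta_map0 ell0. Qed.

Lemma fin_wreathD x y : inF x -> inF y -> inF (@sadd k W x y).
Proof. by move=> /eqP Hx /eqP Hy; rewrite /inF /= delta_mapD ellD Hx Hy. Qed.

Lemma fin_wreathZ c x : inF x -> inF (@ssc k W c x).
Proof. by move=> /eqP Hx; rewrite /inF /= delta_mapZ ellZ Hx. Qed.

Lemma fin_wreath_br x y : inF x -> inF y -> inF (@sbr k W x y).
Proof.
move=> /eqP Hx /eqP Hy; rewrite /inF /= ell0 -scaleNr delta_mapD !delta_mapZ.
by rewrite Hx Hy mulNr mulrC subrr.
Qed.

Lemma fin_wreath_gen i : inF (wgen kapQ XQ i).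
Proof.
rewrite /inF /wgen; case: insubP => [j _ _|_] /=; last exact: fin_wreath0.
by rewrite delta_map_delta ell_delta.
Qed.

Definition fin_struct : lstruct k := @LStruct k fin_wreath
  (fin_mk fin_wreath0)
  (fun x y => fin_mk (fin_wreathD (valP x) (valP y)))
  (fun c x => fin_mk (fin_wreathZ c (valP x)))
  (fun x y => fin_mk (fin_wreath_br (valP x) (valP y))).

Definition fin_gen (i : nat) : fin_struct := fin_mk (fin_wreath_gen i).

Definition fin_val (x : fin_struct) : W := val (x : fin_wreath).

Lemma fin_val_hom : is_hom fin_val. Proof. by []. Qed.

Lemma fin_struct_laws : metab_laws fin_struct.
Proof.
have /modelsP/List.Forall_forall H := wreath_laws kapQ XQ r.
apply/modelsP/List.Forall_forall => e He va vx; apply: val_inj.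
rewrite -/(fin_val _) -[RHS]/(fin_val _) !(seval_hom fin_val_hom).
exact: H.
Qed.

(** An assignment solving the system in the finite algebra would make its own linear parts
    admissible. *)
Lemma fin_wreath_derives : (forall u, ~ admissible S u kapQ XQ) ->
  derives (program k r) [:: 2; encode_system n S].
Proof.
move=> U; apply: (@derives_unsolvable k r fin_wreath _ _ _ _ fin_struct_laws
  fin_gen) => //.
move=> vx; apply: contrapT => H.
apply: (U [ffun j : 'I_n => (fin_val (vx j)).1]).
exists (\matrix_(j < n) (fin_val (vx j)).2).
split=> [j|f fS]; first by rewrite rowK ffunE; apply/eqP;
  exact: (valP (vx j : fin_wreath)).
have : seval fin_gen vx f = s0 fin_struct.
  by apply: contrapT => Hf; apply: H; exists f.
move/(congr1 fin_val); rewrite (seval_hom fin_val_hom) => e.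
rewrite -[RHS]/(fin_val (s0 fin_struct)) -e {e}.
have wf : lwf r n f by move/allIn: wS => /(_ f fS).
apply: seval_eq wf _ _ => [i ir //|j jn].
by rewrite /wvars insubT /= ffunE rowK -surjective_pairing.
Qed.

End FiniteWreath.

Lemma unsolvable_derives : ~ solvable r n S ->
  derives (program k r) [:: 2; encode_system n S].
Proof.
move=> U; have [|Q [h H]] := inadmissible_all.
  by move=> u /admissible_solvable.
exact: fin_wreath_derives H.
Qed.

End Refutation.

Theorem theorem4p5 (k : finFieldType) (r : nat) (hr : (2 <= r)%N) :
  exists M : prf,
    forall (n : nat) (S : seq (lterm k)),
      all (lwf r n) S ->
      (solvable r n S /\ peval M [:: encode_system n S] 1%N) \/
      (~ solvable r n S /\ peval M [:: encode_system n S] 0%N).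
Proof.
have [M HM] := derives_decide (program k r); exists M => n S wS.
have [H1 H0] := HM (encode_system n S).
(* The case is chosen classically; soundness then excludes a derivation of the opposite predicate,
   as [derives_decide] demands. *)
have [s|ns] := pselect (solvable r n S); [left|right]; split=> //.
  apply: H1; first exact: solvable_derives.
  by move=> /program_sound /(_ n S erefl wS).
apply: H0; first exact: unsolvable_derives.
by move=> /program_sound /(_ n S erefl wS).
Qed.
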